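(* Let $\Omega$ be an open subset of $\mathbb{R}^s$ and let $R\in\mathcal{E}_M(\Omega)$ (i.e. $R$ is moderate). Then each of the following conditions is equivalent to $R\in\mathcal{N}(\Omega)$ (i.e. to $R$ being negligible): $(0^\circ)$ For all $K\subset\subset\Omega$ and all $n\in\mathbb{N}$ there exists $q\in\mathbb{N}$ such that for every bounded subset $B$ of $\mathcal{D}(\mathbb{R}^s)$: $$R_\varepsilon(\varphi,x)=O(\varepsilon^n)\qquad(\varepsilon\to0)$$ uniformly for $x\in K$, $\varphi\in B\cap\mathcal{A}_q(\mathbb{R}^s)$. $(1^\circ)$ For all $K\subset\subset\Omega$, all $\alpha\in\mathbb{N}_0^s$ and all $n\in\mathbb{N}$ there exists $q\in\mathbb{N}$ such that for every bounded subset $B$ of $\mathcal{D}(\mathbb{R}^s)$: $$\partial^\alpha R_\varepsilon(\varphi,x)=O(\varepsilon^n)\qquad(\varepsilon\to0)$$ uniformly for $x\in K$, $\varphi\in B\cap\mathcal{A}_q(\mathbb{R}^s)$. $(2^\circ)$ For all $K\subset\subset\Omega$, all $\alpha\in\mathbb{N}_0^s$, all $k\in\mathbb{N}_0$ and all $n\in\mathbb{N}$ there exists $q\in\mathbb{N}$ such that for every bounded subset $B$ of $\mathcal{D}(\mathbb{R}^s)$: $$\partial^\alpha \mathrm{d}_1^k R_\varepsilon(\varphi,x)(\psi_1,\dots,\psi_k)=O(\varepsilon^n)\qquad(\varepsilon\to0)$$ uniformly for $x\in K$, $\varphi\in B\cap\mathcal{A}_q(\mathbb{R}^s)$, $\psi_1,\dots,\psi_k\in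 B\cap\mathcal{A}_{q0}(\mathbb{R}^s)$.
   Context: Notation: $\mathbb{N}=\{1,2,\dots\}$, $\mathbb{N}_0=\mathbb{N}\cup\{0\}$, $I=(0,1]$; $K\subset\subset\Omega$ means that $K$ is a compact subset of $\Omega$. $\mathcal{D}(\Omega)$ is the space of (complex-valued) compactly supported smooth functions on $\Omega$ with its usual (LF) topology. $\mathcal{A}_0(\Omega)=\{\varphi\in\mathcal{D}(\Omega):\int\varphi=1\}$; for $q\in\mathbb{N}$, $\mathcal{A}_q(\Omega)=\{\varphi\in\mathcal{A}_0(\Omega):\int\xi^\alpha\varphi(\xi)\,d\xi=0\text{ for }1\le|\alpha|\le q\}$; for $q\in\mathbb{N}_0$, $\mathcal{A}_{q0}(\Omega)=\{\psi\in\mathcal{D}(\Omega):\int\xi^\alpha\psi(\xi)\,d\xi=0\text{ for }0\le|\alpha|\le q\}$. Calculus is that of convenient vector spaces (Kriegl–Michor): a map between (open subsets of closed affine subspaces of) locally convex spaces is smooth if it maps smooth curves to smooth curves. $S_\varepsilon\varphi(\xi)=\varepsilon^{-s}\varphi(\xi/\varepsilon)$. $U(\Omega)=\{(\varphi,x)\in\mathcal{A}_0(\mathbb{R}^s)\times\Omega: x+\operatorname{supp}\varphi\subseteq\Omega\}$; the map $T(\varphi,x)=(\varphi(\cdot-x),x)$ is a bijection $U(\Omega)\to\mathcal{A}_0(\Omega)\times\Omega$. $\mathcal{E}(\Omega)=\mathcal{C}^\infty(U(\Omega))$ is the set of all $R:U(\Omega)\to\mathbb{C}$ such that $R\circ T^{-1}:\mathcal{A}_0(\Omega)\times\Omega\to\mathbb{C}$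 is smooth. For $R\in\mathcal{E}(\Omega)$, $R_\varepsilon(\varphi,x):=R(S_\varepsilon\varphi,x)$ whenever $(S_\varepsilon\varphi,x)\in U(\Omega)$ (for $\varphi$ in a bounded subset of $\mathcal{D}(\mathbb{R}^s)$ and $x$ in a compact subset of $\Omega$ this holds for all sufficiently small $\varepsilon$). $\partial^\alpha$ denotes partial derivatives with respect to $x$, $\mathrm{d}_1^k$ the $k$-th differential with respect to the first variable $\varphi$, and $\partial^\alpha\mathrm{d}_1^kR_\varepsilon$ means $\partial^\alpha\mathrm{d}_1^k(R_\varepsilon)$. $\mathcal{C}_b^\infty(I\times\Omega,\mathcal{A}_q(\mathbb{R}^s))$ is the set of all smooth maps $\phi:I\times\Omega\to\mathcal{A}_q(\mathbb{R}^s)$ such that for every $K\subset\subset\Omega$ and $\alpha\in\mathbb{N}_0^s$ the set $\{\partial_x^\alpha\phi(\varepsilon,x):\varepsilon\in I,\ x\in K\}$ is bounded in $\mathcal{D}(\mathbb{R}^s)$. $\mathcal{E}_M(\Omega)$ (moderate functions): $R\in\mathcal{E}(\Omega)$ such that for all $K\subset\subset\Omega$, $\alpha\in\mathbb{N}_0^s$ there is $N\in\mathbb{N}$ such that for all $\phi\in\mathcal{C}_b^\infty(I\times\Omega,\mathcal{A}_0(\mathbb{R}^s))$: $\sup_{x\in K}|\partial^\alpha(R(S_\varepsilon\phi(\varepsilon,x),x))|=O(\varepsilon^{-N})$ as $\varepsilon\to0$. $\mathcal{N}(\Omega)$ (negligible functions): for all $K\subset\subset\Omega$, $\alpha\in\mathbb{N}_0^s$,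 $n\in\mathbb{N}$ there is $q\in\mathbb{N}$ such that for all $\phi\in\mathcal{C}_b^\infty(I\times\Omega,\mathcal{A}_q(\mathbb{R}^s))$: $\sup_{x\in K}|\partial^\alpha(R(S_\varepsilon\phi(\varepsilon,x),x))|=O(\varepsilon^{n})$ as $\varepsilon\to0$. *)

(* Defs.v *)
From HB Require Import structures.
From mathcomp Require Import all_boot all_order all_algebra.
From mathcomp Require Import complex.
From mathcomp Require Import all_classical all_reals all_analysis.

Set Implicit Arguments.
Unset Strict Implicit.
Unset Printing Implicit Defensive.
Import Order.TTheory GRing.Theory Num.Theory.
Import numFieldNormedType.Exports.

Local Open Scope classical_set_scope.
Local Open Scope ring_scope.

(* The complex numbers are the library's [Rcomplex R], R[i] as a real vector
   space normed by the modulus; it lacks the topological structure. *)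
Section complex_normed.
Variable R : realType.

HB.instance Definition _ :=
  PseudoMetric.copy (Rcomplex R) (pseudoMetric_normed (Rcomplex R)).
HB.instance Definition _ := isPointed.Build (Rcomplex R) 0.
HB.instance Definition _ :=
  NormedZmod_PseudoMetric_eq.Build R (Rcomplex R) erefl.

Lemma Rcomplex_normZ (l : R) (z : Rcomplex R) : `|l *: z| = `|l| * `|z|.
Proof.
case: z => a b; rewrite /Num.norm /= /GRing.scale /=.
by rewrite !exprMn -mulrDr sqrtrM ?sqr_ge0// sqrtr_sqr.
Qed.

HB.instance Definition _ :=
  PseudoMetricNormedZmod_Lmodule_isNormedModule.Build R (Rcomplex R)
    Rcomplex_normZ.

End complex_normed.

Section calculus.
Variable R : realType.
Local Notation C := (Rcomplex R).

Definition seminorm (E : lmodType R) (p : E -> R) : Prop :=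
  (forall x y, p (x + y) <= p x + p y) /\
  (forall (a : R) x, p (a *: x) = `|a| * p x).

Definition tvs_bounded (E : tvsType R) (B : set E) : Prop :=
  forall U : set E, nbhs 0 U ->
    \forall r \near +oo%R, B `<=` [set (r : R) *: u | u in U].

(* The library's [derivable] and [derive] ['D_v f a], which require normed
   spaces, for a function from a bare vector space to a locally convex space. *)
Definition tderivable (V : lmodType R) (E : tvsType R) (f : V -> E) (a v : V) :=
  exists l : E, h^-1 *: (f (h *: v + a) - f a) @[h --> (0 : R)^'] --> l.

Definition tderive (V : lmodType R) (E : tvsType R) (f : V -> E) (a v : V) : E :=
  xget 0 [set l : E | h^-1 *: (f (h *: v + a) - f a) @[h --> (0 : R)^'] --> l].

Lemma tderivableE (V E : normedModType R) (f : V -> E) a v :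
  tderivable f a v <-> derivable f a v.
Proof.
split; last by move=> h; exists ('D_v f a); exact: h.
by case=> l hl; apply: cvgP hl.
Qed.

Lemma tderiveE (V E : normedModType R) (f : V -> E) a v :
  derivable f a v -> tderive f a v = 'D_v f a.
Proof.
move=> df; rewrite /tderive; case: xgetP => [y -> /= yl|/(_ ('D_v f a))].
  by apply/esym/cvg_lim => //; exact: norm_hausdorff.
by case; exact: df.
Qed.

(* The calculus of convenient vector spaces; a limit of difference quotients is
   taken in the topology of E. *)
Definition smooth_curve (E : tvsType R) (c : R -> E) : Prop :=
  forall n t, tderivable (iter n (fun g u => tderive g u 1) c) t 1.

Definition smooth_map (E F : tvsType R) (X : set E) (f : E -> F) : Prop :=
  forall c : R -> E, smooth_curve c -> (forall t, X (c t)) ->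
    smooth_curve (f \o c).

Variable s : nat.
Local Notation "'Rs'" := 'rV[R]_s.
Definition multi := {ffun 'I_s -> nat}.
Definition mdegree (al : multi) : nat := \sum_i al i.
Definition monomial (al : multi) (x : Rs) : R := \prod_i x 0 i ^+ al i.

(* iterated partial derivatives, in the order given by the word l *)
Definition partials (E : tvsType R) (l : seq 'I_s) (f : Rs -> E) : Rs -> E :=
  foldr (fun i g x => tderive g x (delta_mx 0 i)) f l.

Definition pderiv (E : tvsType R) (al : multi) (f : Rs -> E) : Rs -> E :=
  partials (flatten [seq nseq (al i) i | i <- enum 'I_s]) f.

Definition smooth (f : Rs -> C) : Prop := forall l x,
  {for x, continuous (partials l f)} /\
  forall i, derivable (partials l f) x (delta_mx 0 i).

Definition tsupp (f : Rs -> C) : set Rs := closure [set x | f x != 0].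

Definition test_fun (Om : set Rs) : {pred Rs -> C} :=
  [pred f | `[< [/\ smooth f, compact (tsupp f) & tsupp f `<=` Om] >]].


Lemma smoothP (a : R) (f g : Rs -> C) : smooth f -> smooth g ->
  forall l, partials l (a *: f + g) = a *: partials l f + partials l g.
Proof.
move=> sf sg; elim=> [//|i l IH] /=; apply/funext => x.
have [_ /(_ i) df] := sf l x; have [_ /(_ i) dg] := sg l x.
rewrite !fctE IH tderiveE; last by apply: derivableD => //; exact: derivableZ.
rewrite deriveD//; last exact: derivableZ.
by rewrite deriveZ// !tderiveE.
Qed.

Lemma smooth_lin (a : R) (f g : Rs -> C) :
  smooth f -> smooth g -> smooth (a *: f + g).
Proof.
move=> sf sg l x; rewrite smoothP//; have [cf df] := sf l x.
have [cg dg] := sg l x; split.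
  by apply: continuousD => //; exact: continuousZl_tmp.
by move=> i; apply: derivableD => //; exact: derivableZ.
Qed.

Lemma smooth0 : smooth (0 : Rs -> C).
Proof.
have p0 l : partials l (0 : Rs -> C) = 0.
  elim: l => [//|i l /= ->]; apply/funext => x.
  by rewrite tderiveE; [exact: derive_cst|exact: derivable_cst].
move=> l x; rewrite p0; split; first exact: cst_continuous.
by move=> i; exact: derivable_cst.
Qed.

Lemma test_fun_submod Om : submod_closed (test_fun Om).
Proof.
split.
  have t0 : tsupp (0 : Rs -> C) = set0.
    rewrite /tsupp (_ : [set x | _] = set0) ?closure0//.
    by apply/seteqP; split => x //=; rewrite eqxx.
  by apply/asboolP; split; [exact: smooth0|rewrite t0; exact: compact0|rewrite t0].
move=> a f g /asboolP[sf cf of_] /asboolP[sg cg og]; apply/asboolP.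
have sub : tsupp (a *: f + g) `<=` tsupp f `|` tsupp g.
  rewrite /tsupp -closureU; apply: closureS => x /=.
  rewrite !fctE; have [->|] := eqVneq (f x) 0; last by left.
  by rewrite scaler0 add0r; right.
split; first exact: smooth_lin.
  apply: subclosed_compact sub; first exact: closed_closure.
  exact: compactU.
by move=> x /sub[/of_|/og].
Qed.

End calculus.

Section test_functions.
Variables (R : realType) (s : nat) (Om : set 'rV[R]_s).
Local Notation C := (Rcomplex R).

HB.instance Definition _ := GRing.isSubmodClosed.Build R ('rV[R]_s -> C)
  (test_fun Om) (test_fun_submod Om).

Record testfun : predArgType := TestFun {
  testfun_val :> 'rV[R]_s -> C;
  testfunP : testfun_val \in test_fun Om }.

HB.instance Definition _ := [isSub for testfun_val].
HB.instance Definition _ := [Choice of testfun by <:].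
HB.instance Definition _ := [SubChoice_isSubLmodule of testfun by <:].

(* The seminorms on D(Om) that are continuous for the LF topology: those whose
   restriction to each Frechet space D_K, K compact in Om, is continuous, i.e.
   p f <= c * max_(|al| <= m) sup |d^al f| for all f with support in K (the
   max is written as the least upper bound M). *)
Definition lf_seminorm (p : testfun -> R) : Prop :=
  seminorm p /\
  forall K, compact K -> K `<=` Om -> exists (m : nat) (c : R),
    forall (f : testfun) (M : R), tsupp f `<=` K ->
      (forall al x, (mdegree al <= m)%N -> `|pderiv al f x| <= M) ->
      p f <= c * M.

Definition lf_nbhs (f : testfun) (A : set testfun) : Prop :=
  exists2 p, lf_seminorm p & [set g | p (g - f) < 1] `<=` A.

Lemma seminorm0 (E : lmodType R) (p : E -> R) : seminorm p -> p 0 = 0.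
Proof. by move=> [_ /(_ 0 0)]; rewrite scale0r normr0 mul0r. Qed.

Lemma seminormN (E : lmodType R) (p : E -> R) x : seminorm p -> p (- x) = p x.
Proof. by move=> [_ /(_ (-1) x)]; rewrite scaleN1r normrN1 mul1r. Qed.

Lemma seminorm_ge0 (E : lmodType R) (p : E -> R) x : seminorm p -> 0 <= p x.
Proof.
move=> sp; have := sp.1 x (- x); rewrite subrr seminorm0// seminormN//.
by rewrite -mulr2n pmulrn_lge0.
Qed.

Lemma lf_seminormZ (a : R) p : 0 <= a -> lf_seminorm p ->
  lf_seminorm (fun f => a * p f).
Proof.
move=> a0 [[pD pZ] pK]; split.
  split=> [x y|b x]; first by rewrite -mulrDr ler_wpM2l.
  by rewrite pZ mulrCA.
move=> K cK KO; have [m [c h]] := pK K cK KO; exists m, (a * c) => f M fK fM.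
by rewrite -mulrA ler_wpM2l//; exact: h.
Qed.

Lemma lf_seminormD p q : lf_seminorm p -> lf_seminorm q ->
  lf_seminorm (fun f => p f + q f).
Proof.
move=> [[pD pZ] pK] [[qD qZ] qK]; split.
  split=> [x y|b x]; first by rewrite addrACA lerD.
  by rewrite pZ qZ mulrDr.
move=> K cK KO; have [m [c h]] := pK K cK KO; have [n [d k]] := qK K cK KO.
exists (maxn m n), (c + d) => f M fK fM.
rewrite mulrDl lerD//; [apply: h|apply: k] => // al x le; apply: fM.
  by rewrite (leq_trans le)// leq_maxl.
by rewrite (leq_trans le)// leq_maxr.
Qed.

Lemma lf_seminorm0 : lf_seminorm (fun=> 0).
Proof.
split; first by split=> *; rewrite ?addr0 ?mulr0.
by move=> K _ _; exists 0, 0 => f M _ _; rewrite mul0r.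
Qed.

Fact lf_nbhs_filter f : ProperFilter (lf_nbhs f).
Proof.
split.
  move=> [p lp /(_ f)]; apply => /=.
  by rewrite subrr seminorm0 ?ltr01//; exact: lp.1.
split; first by exists (fun=> 0) => //; exact: lf_seminorm0.
  move=> P Q [p lp pP] [q lq qQ].
  exists (fun g => p g + q g); first exact: lf_seminormD.
  move=> g /= h; split; [apply: pP|apply: qQ] => /=; apply: le_lt_trans h.
    by rewrite lerDl seminorm_ge0//; exact: lq.1.
  by rewrite lerDr seminorm_ge0//; exact: lp.1.
by move=> P Q PQ [p lp pP]; exists p => // g /pP/PQ.
Qed.

Fact lf_nbhs_singleton f A : lf_nbhs f A -> A f.
Proof.
move=> [p lp]; apply => /=.
by rewrite subrr seminorm0 ?ltr01//; exact: lp.1.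
Qed.

Lemma lf_ball_nbhs p f g : lf_seminorm p -> p (g - f) < 1 ->
  lf_nbhs g [set h | p (h - f) < 1].
Proof.
move=> lp pg; have [sp _] := lp.
have d0 : 0 < 1 - p (g - f) by rewrite subr_gt0.
exists (fun h => (1 - p (g - f))^-1 * p h).
  by apply: lf_seminormZ => //; rewrite invr_ge0 ltW.
move=> h /=; rewrite mulrC ltr_pdivrMr// mul1r => ph.
rewrite -(subrK g h) -addrA; apply: le_lt_trans (sp.1 _ _) _.
by rewrite -ltrBrDr.
Qed.

Fact lf_nbhs_nbhs f A : lf_nbhs f A -> lf_nbhs f (lf_nbhs^~ A).
Proof.
move=> [p lp pA]; exists p => // g /= /(lf_ball_nbhs lp)[q lq qp].
by exists q => // h /qp/pA.
Qed.

HB.instance Definition _ := hasNbhs.Build testfun lf_nbhs.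
HB.instance Definition _ := Nbhs_isNbhsTopological.Build testfun
  lf_nbhs_filter lf_nbhs_singleton lf_nbhs_nbhs.

Lemma nbhs_lf f A : nbhs f A = lf_nbhs f A.
Proof. by []. Qed.

Fact lf_add_continuous : continuous (fun z : testfun * testfun => z.1 + z.2).
Proof.
move=> [f g] A [p lp pA].
exists ([set h | 2 * p (h - f) < 1], [set h | 2 * p (h - g) < 1]).
  by split; exists (fun h => 2 * p h) => //; exact: lf_seminormZ.
move=> [h k] /= [ph pk]; apply: pA => /=; have [[pD _] _] := lp.
rewrite opprD addrACA; apply: le_lt_trans (pD _ _) _.
by rewrite -(ltr_pM2l (ltr0Sn R 1)) mulrDr mulr1 [ltRHS]mulr2n ltrD.
Qed.

Fact lf_scale_continuous : continuous (fun z : R^o * testfun => z.1 *: z.2).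
Proof.
move=> [a f] A [p lp pA]; have [sp _] := lp; have pf := seminorm_ge0 f sp.
have af : 0 < `|a| + 1 by rewrite ltr_wpDl.
have pf1 : 0 < p f + 1 by rewrite ltr_wpDl.
exists ([set b : R^o | 2 * (`|b - a| * (p f + 1)) < 1 /\ `|b - a| < 1],
        [set h | 2 * (`|a| + 1) * p (h - f) < 1]).
  split; last first.
    by exists (fun h => 2 * (`|a| + 1) * p h) => //; apply: lf_seminormZ.
  near=> b; split; last by near: b; apply: cvgr_distC_lt; first exact: cvg_id.
  rewrite mulrCA -ltr_pdivlMr; last exact: mulr_gt0.
  near: b; apply: cvgr_distC_lt; first exact: cvg_id.
  by rewrite divr_gt0// mulr_gt0.
move=> [b h] /= [[b1 b2] ph]; apply: pA => /=.
have -> : b *: h - a *: f = b *: (h - f) + (b - a) *: f.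
  by rewrite scalerBr scalerBl addrA subrK.
apply: le_lt_trans (sp.1 _ _) _; rewrite !sp.2.
have bl : `|b| <= `|a| + 1.
  by rewrite -(subrK a b) (le_trans (ler_normD _ _))// addrC lerD2l ltW.
rewrite -(ltr_pM2l (ltr0Sn R 1)) mulrDr mulr1 [ltRHS]mulr2n ltrD//.
  by apply: le_lt_trans ph; rewrite -mulrA ler_pM2l// ler_wpM2r// seminorm_ge0.
by apply: le_lt_trans b1; rewrite ler_pM2l// ler_wpM2l// lerDl.
Unshelve. all: by end_near. Qed.

Local Open Scope convex_scope.

Fact lf_locally_convex :
  exists2 B : set_system testfun, (forall b, b \in B -> convex_set b) & basis B.
Proof.
exists [set b | exists f, exists2 p, lf_seminorm p & b = [set g | p (g - f) < 1]].
  move=> b /set_mem[f [p [sp _] ->]]; apply/convex_setW.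
  move=> x y /set_mem/= px /set_mem/= py l l0 l1; apply/mem_set => /=.
  have -> : (x : convex_lmodType testfun) <| l |> y - f =
      l%:num *: (x - f) + (1 - l%:num) *: (y - f).
    by rewrite !scalerBr addrACA -opprD -scalerDl subrKC scale1r.
  apply: le_lt_trans (sp.1 _ _) _; rewrite !sp.2 !ger0_norm ?subr_ge0//.
  have l1' : 0 < 1 - l%:num by rewrite subr_gt0.
  rewrite -[ltRHS](subrKC l%:num) ltrD//.
    by rewrite -[ltRHS]mulr1 ltr_pM2l.
  by rewrite -[ltRHS]mulr1 ltr_pM2l.
split.
  move=> b [f [p lp ->]]; rewrite openE => g /= pg.
  exact: lf_ball_nbhs.
move=> f A [p lp pA]; exists [set g | p (g - f) < 1] => //; split.
  by exists f, p.
by rewrite /= subrr seminorm0 ?ltr01//; exact: lp.1.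
Qed.

(* This factory only provides the uniform structure; the instances that follow
   it supply the remaining fields of [tvsType]. *)
HB.instance Definition _ := PreTopologicalLmod_isTvs.Build R testfun
  lf_add_continuous lf_scale_continuous lf_locally_convex.
HB.instance Definition _ :=
  PreTopologicalNmodule_isTopologicalNmodule.Build testfun lf_add_continuous.
HB.instance Definition _ :=
  TopologicalNmodule_isTopologicalLmodule.Build R testfun lf_scale_continuous.
HB.instance Definition _ := Uniform_isTvs.Build R testfun lf_locally_convex.


End test_functions.

Section affine_change.
Variables (R : realType) (s : nat).
Local Notation C := (Rcomplex R).
Local Notation "'Rs'" := 'rV[R]_s.

Lemma cvg_scale_dnbhs (a : R) : a != 0 -> a * h @[h --> (0 : R)^'] --> (0 : R)^'.
Proof.
move=> a0 A [e /= e0 eA]; exists (e / `|a|) => /=; first by rewrite divr_gt0// normr_gt0.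
move=> h /=; rewrite sub0r normrN => he h0; apply: eA => /=.
  by rewrite sub0r normrN normrM mulrC -ltr_pdivlMr// normr_gt0.
by rewrite mulf_neq0.
Qed.

Lemma is_derive_affine (f : Rs -> C) (c a : R) (b x v : Rs) : a != 0 ->
  derivable f (a *: x + b) v ->
  is_derive x v (fun y => c *: f (a *: y + b)) ((c * a) *: 'D_v f (a *: x + b)).
Proof.
move=> a0 df.
have H : h^-1 *: (c *: f (a *: (h *: v + x) + b) - c *: f (a *: x + b))
    @[h --> (0 : R)^'] --> (c * a) *: 'D_v f (a *: x + b).
  have -> : (fun h : R => h^-1 *: (c *: f (a *: (h *: v + x) + b) -
        c *: f (a *: x + b))) = (fun h => (c * a) *: ((a * h)^-1 *:
        (f ((a * h) *: v + (a *: x + b)) - f (a *: x + b)))).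
    apply/funext => h; rewrite -scalerBr !scalerA invfM mulrA mulfK//.
    by rewrite [h^-1 * c]mulrC; congr (_ *: (f _ - _)); rewrite scalerDr scalerA addrA.
  apply: cvgZl_tmp.
  apply: (cvg_comp (fun h => a * h)
    (fun h => h^-1 *: (f (h *: v + (a *: x + b)) - f (a *: x + b))) _ df).
  exact: cvg_scale_dnbhs.
apply: DeriveDef; first exact: cvgP H.
by apply/cvg_lim => //; exact: norm_hausdorff.
Qed.

Lemma partials_affine (f : Rs -> C) (c a : R) (b : Rs) l : a != 0 -> smooth f ->
  partials l (fun y => c *: f (a *: y + b)) =
  (fun y => (c * a ^+ size l) *: partials l f (a *: y + b)).
Proof.
move=> a0 sf; elim: l => [|i l IH] /=; first by rewrite mulr1.
apply/funext => x; rewrite IH; have [_ /(_ i) df] := sf l (a *: x + b).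
have D := is_derive_affine (c * a ^+ size l) a0 df.
by rewrite !tderiveE// derive_val exprSr mulrA.
Qed.

Lemma test_fun_affine (Om : set Rs) (f : testfun Om) (c a : R) (b : Rs) : a != 0 ->
  (fun y => c *: f (a *: y + b)) \in test_fun setT.
Proof.
move=> a0; have /asboolP[sf cf _] := testfunP f; apply/asboolP.
have caff : continuous (fun y : Rs => a *: y + b).
  by move=> y; apply: (@continuousD _ _ _ (fun y => a *: y) (fun=> b));
    [exact: scaler_continuous|exact: cst_continuous].
pose K := (fun y => a^-1 *: (y - b)) @` tsupp f.
have cinv : continuous (fun y : Rs => a^-1 *: (y - b)).
  move=> y; apply: (@continuous_comp _ _ _ (fun y : Rs => y - b) (fun y => a^-1 *: y)).
    by apply: (@continuousB _ _ _ id (fun=> b)); [exact: cvg_id|exact: cst_continuous].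
  exact: scaler_continuous.
have cK : compact K.
  by apply: continuous_compact => //; exact: continuous_subspaceT.
have sub : tsupp (fun y => c *: f (a *: y + b)) `<=` K.
  have /closure_id -> : closed K by apply: compact_closed => //; exact: norm_hausdorff.
  apply: closureS => y /= fy; exists (a *: y + b); last first.
    by rewrite addrK scalerA mulVf// scale1r.
  by apply: subset_closure => /=; apply: contraNneq fy => ->; rewrite scaler0.
split => //; last exact: subclosed_compact (@closed_closure _ _) cK sub.
move=> l x; rewrite partials_affine//; have [cl dl] := sf l (a *: x + b); split.
  apply: continuousZl_tmp.
  have := @continuous_comp _ _ _ (fun y : Rs => a *: y + b) (partials l f) x (caff x).
  exact.
by move=> i; have [] := is_derive_affine (c * a ^+ size l) a0 (dl i).
Qed.

(* For e = 0 the function in [dilate] need not be a test function; [dilateE] and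
   [translateE] show that the default value 0 is not used otherwise. *)
Definition dilate (e : R) (phi : testfun [set: Rs]) : testfun [set: Rs] :=
  insubd 0 (fun y => e ^- s *: phi (e^-1 *: y)).

Definition translate (Om : set Rs) (x : Rs) (phi : testfun Om) :
  testfun [set: Rs] := insubd 0 (fun y => phi (y + x)).

Lemma dilateE e phi y : e != 0 -> dilate e phi y = e ^- s *: phi (e^-1 *: y).
Proof.
move=> e0; rewrite /dilate.
have := test_fun_affine phi (e ^- s) 0 (invr_neq0 e0).
under eq_fun do rewrite addr0.
by move=> h; rewrite -[LHS]/(val _ y) insubdK.
Qed.

Lemma translateE Om x (phi : testfun Om) y : translate x phi y = phi (y + x).
Proof.
have := test_fun_affine phi 1 x (oner_neq0 R).
under eq_fun do rewrite !scale1r.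
by move=> h; rewrite -[LHS]/(val _ y) insubdK.
Qed.

End affine_change.

Section moments.
Variables (R : realType) (s : nat).
Local Notation C := (Rcomplex R).
Local Notation "'Rs'" := 'rV[R]_s.

(* The integral over R^n as an iterated Lebesgue integral; it is only applied
   to continuous functions with compact support, for which it is the integral
   with respect to n-dimensional Lebesgue measure. *)
Fixpoint integral_rV (n : nat) : ('rV[R]_n -> R) -> R :=
  match n with
  | 0 => fun f => f 0
  | n'.+1 => fun f => \int[@lebesgue_measure R]_t
      integral_rV (fun y : 'rV[R]_n' => f (row_mx (t%:M : 'rV[R]_1) y))
  end.

Definition integral_complex (f : Rs -> C) : C :=
  (integral_rV (fun x => complex.Re (f x)) +i*
   integral_rV (fun x => complex.Im (f x)))%C.

Definition moment (al : multi s) (f : Rs -> C) : C :=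
  integral_complex (fun x => monomial al x *: f x).

(* A_0 is [calA Om 0], the condition on the moments being void for q = 0. *)
Definition calA (Om : set Rs) (q : nat) : set (testfun Om) :=
  [set phi | integral_complex phi = 1 /\
    forall al, (1 <= mdegree al <= q)%N -> moment al phi = 0].

Definition calA0 (Om : set Rs) (q : nat) : set (testfun Om) :=
  [set psi | forall al, (mdegree al <= q)%N -> moment al psi = 0].

End moments.
Arguments calA {R s} Om q _.
Arguments calA0 {R s} Om q _.

Section generalized_functions.
Variables (R : realType) (s : nat).
Local Notation C := (Rcomplex R).
Local Notation "'Rs'" := 'rV[R]_s.
Local Notation "'DRs'" := (testfun [set: Rs]).

(* T^-1; its image of A_0(Om) x Om is U(Om). *)
Definition Tinv (Om : set Rs) (p : testfun Om * Rs) : DRs * Rs :=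
  (translate p.2 p.1, p.2).

(* Functions on U(Om) are represented by total functions, whose values outside
   U(Om) play no role. *)
Definition calE (Om : set Rs) (u : DRs * Rs -> C) : Prop :=
  smooth_map (calA Om 0 `*` Om) (u \o @Tinv Om).

Definition rescale (u : DRs * Rs -> C) (e : R) (p : DRs * Rs) : C :=
  u (dilate e p.1, p.2).

Definition unitI : set R := [set e | 0 < e <= 1].

Definition compact_in (K Om : set Rs) : Prop := compact K /\ K `<=` Om.

(* Smoothness on I x Om, which is not open, is also tested along the smooth curves
   of R x R^s with values in I x Om. *)
Definition Cb_infty (Om : set Rs) (q : nat) (phi : R * Rs -> DRs) : Prop :=
  [/\ forall p, (unitI `*` Om) p -> calA [set: Rs] q (phi p),
      smooth_map (unitI `*` Om) phi &
      forall K (al : multi s), compact_in K Om ->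
        tvs_bounded [set pderiv al (fun y => phi (p.1, y)) p.2
                    | p in unitI `*` K]].

(* f e t = O(g e) as e -> 0+, uniformly for t in P *)
Definition unif_bigO (T : Type) (P : set T) (f : R -> T -> C) (g : R -> R) :=
  exists M : R, \forall e \near (0 : R)^'+, forall t, P t -> `|f e t| <= M * g e.

Definition moderate_gf (Om : set Rs) (u : DRs * Rs -> C) : Prop :=
  calE Om u /\
  forall K (al : multi s), compact_in K Om ->
    exists2 N, (0 < N)%N & forall phi, Cb_infty Om 0 phi ->
      unif_bigO K
        (fun e x => pderiv al (fun y => rescale u e (phi (e, y), y)) x)
        (fun e => e ^- N).

Definition negligible_gf (Om : set Rs) (u : DRs * Rs -> C) : Prop :=
  calE Om u /\
  forall K (al : multi s) n, compact_in K Om -> (0 < n)%N ->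
    exists2 q, (0 < q)%N & forall phi, Cb_infty Om q phi ->
      unif_bigO K
        (fun e x => pderiv al (fun y => rescale u e (phi (e, y), y)) x)
        (fun e => e ^+ n).

(* d_1^k u (phi, x) (psi_1, ..., psi_k), as an iterated directional derivative *)
Definition diff1 (k : nat) (u : DRs * Rs -> C) (p : DRs * Rs)
    (psi : k.-tuple DRs) : C :=
  foldr (fun v (g : DRs -> C) phi => tderive g phi v)
    (fun phi => u (phi, p.2)) psi p.1.

End generalized_functions.

(* Main.v *)
Require Import Defs.
From HB Require Import structures.
From mathcomp Require Import all_boot all_order all_algebra.
From mathcomp Require Import complex.
From mathcomp Require Import all_classical all_reals all_analysis.
From mathcomp Require Import ring lra.
Set Implicit Arguments.
Unset Strict Implicit.
Unset Printing Implicit Defensive.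
Import Order.TTheory GRing.Theory Num.Theory.
Import numFieldNormedType.Exports.
Local Open Scope classical_set_scope.
Local Open Scope ring_scope.

(** The second condition specializes to the first one for k = 0, and the first one to
    the zeroth one for alpha = 0. What remains is to pass from the zeroth condition to
    negligibility, and from negligibility to the second condition.

    From the zeroth condition to negligibility. Let phi be a test object and let
    f_e(x) = R(S_e phi(e, x), x). The values phi(e, x), for x in a compact set, form a
    bounded set, so that f_e itself is small, while moderateness bounds every derivative
    of f_e by some power of 1 / e. Landau's inequality, which bounds |f'| by
    2 sup |f| / h + 4 h sup |f''| on a segment of length h, propagates smallness from one
    derivative to the next one ([zeroth_order_partials]).

    From negligibility to the second condition. Negligibility concerns total derivatives
    in x along test objects, the second condition concerns partial derivatives in phi and x.
    Derivatives in the directions psi_1, ..., psi_k and in x are bounded by derivatives in x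
    of the functions y |-> R_e(phi + l(y - x) sum a_i psi_i, y), where l is a coordinate
    and the a_i are bounded: pure derivatives in a direction v + sum a_i t_i are polynomials
    in the a_i, and mixed derivatives are among their coefficients
    ([mixed_derivative_reduction]). If the second condition failed along sequences e_j -> 0,
    phi_j, x_j and psi_ji, the interpolant
      Phi(e, y) = phi_0 + sum_j chi(e / e_j) (phi_j - phi_0 + l(y - x_j) sum_i a_ji psi_ji),
    with a bump function chi that is 1 at 1, would be one test object, of the same order of
    vanishing moments, that contains all of these functions ([interpolant_Cb]); and R would
    violate negligibility along it ([negligible_differential]).

    Both arguments differentiate R_e along families with finitely many parameters, whereas
    R is only known to map smooth curves to smooth curves. Two results bridge this gap. A
    function on an open subset of a normed space that is smooth along smooth curves has
    locally bounded difference quotients of all orders ([boman]); the class of these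
    functions ([diff_bounded]) is closed under directional derivatives and has symmetric
    second derivatives, the chain rule along curves and Landau's inequality. And a smooth
    curve of test functions is jointly smooth in the parameter and the variable
    ([smooth_curve_joint]), while conversely a jointly smooth function whose supports lie,
    locally in the parameter, in a common compact set defines a smooth curve
    ([joint_curve]). Therefore t |-> R(S_e p_t, x_t) is smooth for smooth curves p and x as
    soon as the rescaled supports stay in Om ([rescaled_curve]). Linearity and affine
    invariance of the iterated integral show that the moment conditions survive these
    constructions. *)

(** * Directional derivatives and smooth curves *)

Section directional_derivatives.
Variable R : realType.

Definition hasd (V : lmodType R) (E : tvsType R) (f : V -> E) (a v : V) (l : E) :=
  h^-1 *: (f (h *: v + a) - f a) @[h --> (0 : R)^'] --> l.

Lemma tderive_hasd (V : lmodType R) (E : tvsType R) (f : V -> E) a v l :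
  hausdorff_space E -> hasd f a v l -> tderive f a v = l.
Proof.
move=> hE fl; rewrite /tderive; case: xgetP => [y _ yl|/(_ l)/(_ fl)//].
apply: (cvg_unique _ yl fl) => //; exact: fmap_proper_filter.
Qed.

Lemma hasd_tderive (V : lmodType R) (E : tvsType R) (f : V -> E) a v :
  tderivable f a v -> hasd f a v (tderive f a v).
Proof. by move=> [l fl]; rewrite /tderive; case: xgetP => [y -> //|/(_ l)/(_ fl)]. Qed.

(** The derivative depends on the difference quotients alone, which makes
    affine changes of variables available without differentiability. *)
Lemma tderive_quot (V W : lmodType R) (E : tvsType R) (f : V -> E) (g : W -> E) a b v w :
  (forall h : R, f (h *: v + a) = g (h *: w + b)) -> tderive f a v = tderive g b w.
Proof.
move=> fg; have f0 : f a = g b by have := fg 0; rewrite !scale0r !add0r.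
have e : (fun h : R => h^-1 *: (f (h *: v + a) - f a)) =
    (fun h => h^-1 *: (g (h *: w + b) - g b)) by apply/funext => h; rewrite fg f0.
by rewrite /tderive e.
Qed.

Lemma hasd_near (V : lmodType R) (E : tvsType R) (f g : V -> E) a v l :
  f a = g a -> (\forall h \near (0 : R)^', f (h *: v + a) = g (h *: v + a)) ->
  hasd f a v l -> hasd g a v l.
Proof.
move=> fga fg fl; apply: cvg_trans fl; apply: near_eq_cvg.
by apply: filterS fg => h /= ->; rewrite fga.
Qed.

Lemma tderive_near (V : lmodType R) (E : tvsType R) (f g : V -> E) a v :
  f a = g a -> (\forall h \near (0 : R)^', f (h *: v + a) = g (h *: v + a)) ->
  tderive f a v = tderive g a v.
Proof.
move=> fga fg; rewrite /tderive; congr (xget 0 _); apply/funext => l.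
apply/propext; split; first exact: hasd_near.
by apply: hasd_near => //; apply: filterS fg => h /= ->.
Qed.

Lemma line_cvg (V : normedModType R) (x v : V) :
  h *: v + x @[h --> (0 : R)] --> x.
Proof.
rewrite -[X in _ --> X]add0r -[X in _ --> X + _](scale0r v).
apply: cvgD; last exact: cvg_cst.
by apply: cvgZr_tmp; exact: cvg_id.
Qed.

Lemma near_line (V : normedModType R) (x v : V) (A : set V) : nbhs x A ->
  \forall h \near (0 : R), A (h *: v + x).
Proof. by move=> Ax; exact: line_cvg. Qed.

Lemma near_line_punctured (V : normedModType R) (x v : V) (A : set V) : nbhs x A ->
  \forall h \near (0 : R)^', A (h *: v + x).
Proof. by move=> /(near_line v) h; exact: nbhs_dnbhs. Qed.

Lemma tderive_local (V : normedModType R) (E : tvsType R) (f g : V -> E) a v :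
  (\forall x \near a, f x = g x) -> tderive f a v = tderive g a v.
Proof.
move=> fg; apply: tderive_near; first exact: nbhs_singleton fg.
exact: near_line_punctured fg.
Qed.

Lemma hasd_local (V : normedModType R) (E : tvsType R) (f g : V -> E) a v l :
  (\forall x \near a, f x = g x) -> hasd f a v l -> hasd g a v l.
Proof.
move=> fg; apply: hasd_near; first exact: nbhs_singleton fg.
exact: near_line_punctured fg.
Qed.

Lemma hasd_cvg (V : lmodType R) (E : normedModType R) (f : V -> E) a v l :
  hasd f a v l -> f (h *: v + a) @[h --> (0 : R)^'] --> f a.
Proof.
move=> fl; rewrite -[X in _ --> X](subrK (f a)) subrr.
have -> : (fun h : R => f (h *: v + a)) =
    (fun h => (f (h *: v + a) - f a) + f a) by apply/funext => h; rewrite subrK.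
apply: cvgD; last exact: cvg_cst.
rewrite -(scale0r l).
have H : h *: (h^-1 *: (f (h *: v + a) - f a)) @[h --> (0 : R)^'] --> 0 *: l.
  by apply: cvgZ => //; exact: cvg_within.
apply: cvg_trans H; apply: near_eq_cvg.
near=> h; rewrite scalerA divff ?scale1r//.
by near: h; exact: nbhs_dnbhs_neq.
Unshelve. all: by end_near. Qed.

Lemma hasd_cst (V : lmodType R) (E : tvsType R) (c : E) (a v : V) :
  hasd (fun=> c) a v 0.
Proof.
rewrite /hasd; under eq_fun do rewrite subrr scaler0.
exact: cvg_cst.
Qed.

Lemma hasdD (V : lmodType R) (E : tvsType R) (f g : V -> E) a v l m :
  hasd f a v l -> hasd g a v m -> hasd (fun x => f x + g x) a v (l + m).
Proof.
move=> fl gm; rewrite /hasd; under eq_fun do rewrite opprD addrACA scalerDr.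
by apply: continuous2_cvg => //; exact: (@add_continuous E (l, m)).
Qed.

Lemma hasd_scaled_vector (V : lmodType R) (E : tvsType R) (a : V -> R) (f : E) x v l :
  hasd a x v l -> hasd (fun y => a y *: f) x v (l *: f).
Proof.
move=> al; rewrite /hasd; under eq_fun do rewrite -scalerBl scalerA.
have : t *: f @[t --> (l : R)] --> (l *: f : E).
  apply: (@continuous2_cvg R R^o E E _ _ id (fun=> f) (fun (t : R^o) (g : E) => t *: g) l f).
  - exact: (@scale_continuous R E (l, f)).
  - exact: cvg_id.
  - exact: cvg_cst.
by apply: cvg_comp.
Qed.

Lemma hasdM (V : lmodType R) (E : normedModType R) (f : V -> R) (g : V -> E) a v l m :
  hasd f a v l -> hasd g a v m ->
  hasd (fun x => f x *: g x) a v (l *: g a + f a *: m).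
Proof.
move=> fl gm.
rewrite /hasd.
have -> : (fun h : R => h^-1 *: (f (h *: v + a) *: g (h *: v + a) - f a *: g a)) =
  (fun h : R => (h^-1 *: (f (h *: v + a) - f a)) *: g (h *: v + a) +
  f a *: (h^-1 *: (g (h *: v + a) - g a))).
  apply/funext => h.
  rewrite -[(h^-1 *: _) *: _]scalerA [f a *: (h^-1 *: _)]scalerA [f a * _]mulrC -scalerA.
  by rewrite -!scalerDr; congr (_ *: _); rewrite scalerBl scalerBr addrA subrK.
apply: cvgD; first by apply: cvgZ => //; exact: (hasd_cvg gm).
by apply: cvgZl_tmp.
Qed.

Lemma hasdZ (V : lmodType R) (E : normedModType R) (c : R) (f : V -> E) a v l :
  hasd f a v l -> hasd (fun x => c *: f x) a v (c *: l).
Proof.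
move=> fl; have := hasdM (hasd_cst c a v) fl.
by rewrite scale0r add0r.
Qed.

Lemma hasdN (V : lmodType R) (E : normedModType R) (f : V -> E) a v l :
  hasd f a v l -> hasd (fun x => - f x) a v (- l).
Proof.
move=> fl; have := hasdZ (c := -1) fl; rewrite scaleN1r.
by under eq_fun do rewrite scaleN1r.
Qed.

Lemma hasd_dirZ (V : lmodType R) (E : normedModType R) (c : R) (f : V -> E) a v l :
  hasd f a v l -> hasd f a (c *: v) (c *: l).
Proof.
have [->|c0] := eqVneq c 0.
  move=> _; rewrite !scale0r /hasd.
  under eq_fun do rewrite scaler0 add0r subrr scaler0.
  exact: cvg_cst.
move=> fl.
have := cvg_comp (fun h => c * h) _ (cvg_scale_dnbhs c0) fl.
rewrite /hasd => H.
have {}H := cvgZl_tmp (FF := dnbhs_filter (0 : R)) (k := c) H.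
apply: cvg_trans H; apply: near_eq_cvg.
near=> h => /=; rewrite scalerA invfM mulrA mulrV ?unitfE// mul1r.
by rewrite scalerA [c * h]mulrC.
Unshelve. all: by end_near. Qed.

End directional_derivatives.

Section curves.
Variable R : realType.

Fixpoint nder (E : tvsType R) (n : nat) (c : R -> E) : Prop :=
  if n is n'.+1 then exists2 c', (forall t, hasd c t 1 (c' t)) & nder n' c'
  else True.

Lemma smooth_curveP (E : tvsType R) (c : R -> E) : hausdorff_space E ->
  smooth_curve c <-> forall n, nder n c.
Proof.
move=> hE; split.
  move=> sc n; elim: n c sc => [//|n IH] c sc.
  exists (fun t => tderive c t 1); first by move=> t; exact/hasd_tderive/(sc 0%N).
  by apply: IH => m t; have := sc m.+1 t; rewrite iterSr.
move=> nc n t; have {nc} := nc n.+1; elim: n c => [|n IH] c.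
  by move=> [c' cc' _]; exists (c' t); exact: cc'.
move=> [c' cc' nc']; rewrite iterSr.
rewrite (_ : (fun u => tderive c u 1) = c'); first exact: IH.
by apply/funext => u; apply: tderive_hasd.
Qed.

Lemma nderW (E : tvsType R) n (c : R -> E) : nder n.+1 c -> nder n c.
Proof.
elim: n c => [//|n IH] c [c' cc' nc']; exists c' => //; exact: IH.
Qed.

Lemma smooth_curve_deriv (E : tvsType R) (c c' : R -> E) : hausdorff_space E ->
  (forall t, hasd c t 1 (c' t)) -> smooth_curve c -> smooth_curve c'.
Proof.
move=> hE cc' sc n t; have := sc n.+1 t; rewrite iterSr.
rewrite (_ : (fun u => tderive c u 1) = c')//.
by apply/funext => u; apply: tderive_hasd.
Qed.

Lemma nder_cst (E : tvsType R) n (c : E) : nder n (fun=> c : E).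
Proof.
elim: n c => [//|n IH] c /=; exists (fun=> 0) => // t; exact: hasd_cst.
Qed.

Lemma hasd_id (t : R) : hasd (@idfun R) t (1 : R) (1 : R).
Proof.
have : (fun=> 1) h @[h --> (0 : R)^'] --> (1 : R) by exact: cvg_cst.
apply: cvg_trans; apply: near_eq_cvg.
near=> h => /=; rewrite addrK scalerA mulVf ?scale1r//.
by near: h; exact: nbhs_dnbhs_neq.
Unshelve. all: by end_near. Qed.

Lemma nder_id n : nder n (@idfun R).
Proof.
case: n => [//|n] /=; exists (fun=> 1) => [t|]; first exact: hasd_id.
exact: nder_cst.
Qed.

Lemma nderD (E : tvsType R) n (c d : R -> E) :
  nder n c -> nder n d -> nder n (fun t => c t + d t).
Proof.
elim: n c d => [//|n IH] c d [c' cc' nc'] [d' dd' nd'].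
exists (fun t => c' t + d' t); last exact: IH.
by move=> t; exact: hasdD.
Qed.

Lemma nder_scaled_vector (E : tvsType R) n (a : R -> R) (f : E) :
  nder n a -> nder n (fun t => a t *: f).
Proof.
elim: n a => [//|n IH] a [a' aa' na']; exists (fun t => a' t *: f); last exact: IH.
by move=> t; exact: hasd_scaled_vector.
Qed.

(** By uniqueness of limits the derivatives of the local pieces agree, so they
    glue to a global derivative. *)
Lemma nder_local (E : tvsType R) n (c : R -> E) : hausdorff_space E ->
  (forall t0 : R, exists2 d, nder n d & \forall t \near t0, c t = d t) -> nder n c.
Proof.
move=> hE; elim: n c => [//|n IH] c loc; exists (fun t => tderive c t 1).
  move=> t; have [d [d' dd' _] cd] := loc t; apply: hasd_tderive; exists (d' t).
  apply: (@hasd_local R R E d); last exact: dd'.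
  by apply: filterS cd => u ->.
apply: IH => t0; have [d [d' dd' nd'] cd] := loc t0; exists d' => //.
move: cd => /nbhs_interior; apply: filterS => t cd.
rewrite (@tderive_local R R E c d) //; exact: tderive_hasd.
Qed.

Lemma nderM (E : normedModType R) n (c : R -> R) (d : R -> E) :
  nder n c -> nder n d -> nder n (fun t => c t *: d t).
Proof.
elim: n c d => [//|n IH] c d nc nd.
have [c' cc' nc'] := nc; have [d' dd' nd'] := nd.
exists (fun t => c' t *: d t + c t *: d' t); first by move=> t; exact: hasdM.
by apply: nderD; apply: IH => //; exact: nderW.
Qed.

Lemma nder_sum (E : normedModType R) n (I : Type) (r : seq I) (c : I -> R -> E) :
  (forall i, nder n (c i)) -> nder n (fun t => \sum_(i <- r) c i t).
Proof.
move=> nc; elim: r => [|i r IH].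
  by under eq_fun do rewrite big_nil; exact: nder_cst.
by under eq_fun do rewrite big_cons; exact: nderD.
Qed.

Lemma nderZ (E : normedModType R) n (a : R) (d : R -> E) :
  nder n d -> nder n (fun t => a *: d t).
Proof. by apply: nderM; exact: nder_cst. Qed.

Lemma nderB (E : normedModType R) n (c d : R -> E) :
  nder n c -> nder n d -> nder n (fun t => c t - d t).
Proof.
move=> nc nd; under eq_fun do rewrite -scaleN1r.
by apply: nderD => //; exact: nderZ.
Qed.

(** Given the value [c' (s t)] at 0, the difference quotient of c at s t becomes
    continuous at 0, and is composed with the increment of s. *)
Lemma hasd_comp1 (E : normedModType R) (c c' : R -> E) (s : R -> R) t l :
  (forall u, hasd c u 1 (c' u)) -> hasd s t 1 l ->
  hasd (fun u => c (s u)) t 1 (l *: c' (s t)).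
Proof.
move=> cc' sl; have scont := hasd_cvg sl.
pose q k : E := if k == 0 then c' (s t) else k^-1 *: (c (k + s t) - c (s t)).
have qc : q k @[k --> (0 : R)] --> c' (s t).
  have := cc' (s t); rewrite /hasd => cl.
  apply/cvgrPdist_lt => e e0.
  have /cvgrPdist_lt/(_ e e0) := cl; rewrite /dnbhs near_withinE => H.
  apply: filterS H => k Hk; rewrite /q; case: ifPn => [_|k0].
    by rewrite subrr normr0.
  by have := Hk k0; rewrite -[k%:A]/(k * 1) mulr1.
have H : (h^-1 *: (s (h *: 1 + t) - s t)) *: q (s (h *: 1 + t) - s t)
    @[h --> (0 : R)^'] --> l *: c' (s t).
  apply: cvgZ; first exact: sl.
  apply: cvg_comp qc; rewrite -[X in _ `=>` nbhs X](subrr (s t)).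
  by apply: cvgB => //; exact: cvg_cst.
apply: cvg_trans H; apply: near_eq_cvg; near=> h => /=.
rewrite -scalerA; congr (_ *: _); rewrite /q; case: eqVneq => [k0|k0].
  by rewrite k0 scale0r; move/eqP: k0; rewrite subr_eq0 => /eqP ->; rewrite subrr.
by rewrite scalerA divff// scale1r subrK.
Unshelve. all: by end_near. Qed.

Lemma nder_comp (E : normedModType R) n (c : R -> E) (s : R -> R) :
  nder n c -> nder n s -> nder n (fun t => c (s t)).
Proof.
elim: n c s => [//|n IH] c s nc ns.
have [c' cc' nc'] := nc; have [s' ss' ns'] := ns.
exists (fun t => s' t *: c' (s t)); first by move=> t; exact: hasd_comp1.
by apply: nderM => //; apply: IH => //; exact: nderW.
Qed.

Lemma nder_lin (E F : normedModType R) (f : E -> F) n (c : R -> E) :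
  linear f -> continuous f -> nder n c -> nder n (fun t => f (c t)).
Proof.
move=> lf cf; elim: n c => [//|n IH] c [c' cc' nc'].
have f0 : f 0 = 0 by have := lf (-1) 0 0; rewrite !scaleN1r addr0 oppr0 addNr.
have fZ a x : f (a *: x) = a *: f x by rewrite -[a *: x]addr0 lf f0 addr0.
have fD x y : f (x + y) = f x + f y by rewrite -[x in LHS]scale1r lf scale1r.
have fB x y : f (x - y) = f x - f y by rewrite -scaleN1r fD fZ scaleN1r.
exists (fun t => f (c' t)); last exact: IH.
move=> t; rewrite /hasd; under eq_fun do rewrite -fB -fZ.
by apply: (cvg_comp _ f (cc' t)); exact: cf.
Qed.

Lemma nder_coord n s i (c : R -> 'rV[R]_s) :
  nder n c -> nder n (fun t => c t 0 i).
Proof.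
apply: (@nder_lin _ R (fun x : 'rV[R]_s => x 0 i)).
  by move=> a x y; rewrite !mxE.
exact: coord_continuous.
Qed.

Lemma nder_fst (E F : normedModType R) n (c : R -> E * F) :
  nder n c -> nder n (fun t => (c t).1).
Proof. by apply: (@nder_lin _ E fst) => // -[x y]; exact: cvg_fst. Qed.

Lemma nder_snd (E F : normedModType R) n (c : R -> E * F) :
  nder n c -> nder n (fun t => (c t).2).
Proof. by apply: (@nder_lin _ F snd) => // -[x y]; exact: cvg_snd. Qed.

Lemma nder_pair (E F : tvsType R) n (c : R -> E) (d : R -> F) :
  nder n c -> nder n d -> nder (E := (E * F)%type) n (fun t => (c t, d t)).
Proof.
elim: n c d => [//|n IH] c d [c' cc' nc'] [d' dd' nd'].
exists (fun t => (c' t, d' t)); last exact: IH.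
move=> t; have := cvg_pair (cc' t) (dd' t); exact.
Qed.

Lemma nder_inv n (c : R -> R) : (forall t, c t != 0) ->
  nder n c -> nder n (fun t => (c t)^-1).
Proof.
move=> c0; elim: n => [//|n IH] nc; have [c' cc' nc'] := nc.
have {}IH := IH (nderW nc).
exists (fun t => - c' t *: ((c t)^-1 *: (c t)^-1)); last first.
  apply: nderM; last by apply: nderM.
  by under eq_fun do rewrite -scaleN1r; exact: nderZ.
move=> t; have H : - (h^-1 *: (c (h *: 1 + t) - c t)) *:
    ((c (h *: 1 + t))^-1 *: (c t)^-1)
    @[h --> (0 : R)^'] --> - c' t *: ((c t)^-1 *: (c t)^-1).
  apply: cvgZ; first by apply: cvgN; exact: cc'.
  by apply: cvgZr_tmp; apply: cvgV => //; exact: hasd_cvg (cc' t).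
apply: cvg_trans H; apply: near_eq_cvg; near=> h => /=.
rewrite /GRing.scale /= -mulrN opprB -!mulrA; congr (_ * _).
by rewrite mulrA mulrBl mulfV// mulrBl mul1r -mulrA mulrCA mulfV// mulr1.
Unshelve. all: by end_near. Qed.

End curves.

(** * Complex-valued functions of a real variable *)

Section complex_values.
Variable R : realType.
Local Notation C := (Rcomplex R).

Lemma hasdE (V E : normedModType R) (f : V -> E) a v l :
  hasd f a v l <-> is_derive a v f l.
Proof.
split=> [fl|[df <-]]; last exact: df.
apply: DeriveDef; first exact: cvgP fl.
by apply/cvg_lim => //; exact: norm_hausdorff.
Qed.

Lemma normC_def (z : C) : `|z| = Num.sqrt (complex.Re z ^+ 2 + complex.Im z ^+ 2).
Proof. by case: z. Qed.

Lemma ReC_le (z : C) : `|complex.Re z| <= `|z|.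
Proof.
rewrite normC_def -sqrtr_sqr ler_wsqrtr// lerDl; exact: sqr_ge0.
Qed.

Lemma ImC_le (z : C) : `|complex.Im z| <= `|z|.
Proof.
rewrite normC_def -sqrtr_sqr ler_wsqrtr// lerDr; exact: sqr_ge0.
Qed.

Lemma normC_le (z : C) : `|z| <= `|complex.Re z| + `|complex.Im z|.
Proof.
rewrite normC_def -[leRHS]ger0_norm ?addr_ge0// -sqrtr_sqr ler_wsqrtr//.
rewrite sqrrD !real_normK ?num_real// lerD2r lerDl.
by rewrite mulrn_wge0// mulr_ge0.
Qed.

Lemma ReC_linear : linear (@complex.Re R : C -> R).
Proof. by move=> a [x y] [z t]. Qed.

Lemma ImC_linear : linear (@complex.Im R : C -> R).
Proof. by move=> a [x y] [z t]. Qed.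

Lemma ReB (z w : C) : complex.Re (z - w) = complex.Re z - complex.Re w.
Proof. by case: z w => [x y] [a b]. Qed.

Lemma ImB (z w : C) : complex.Im (z - w) = complex.Im z - complex.Im w.
Proof. by case: z w => [x y] [a b]. Qed.

Lemma lin_contraction (E F : normedModType R) (f : E -> F) :
  linear f -> (forall x, `|f x| <= `|x|) -> continuous f.
Proof.
move=> lf fle x; apply/cvgrPdist_lt => e e0.
have fB u v : f (u - v) = f u - f v.
  by rewrite [u - v]addrC -scaleN1r lf scaleN1r addrC.
have : \forall y \near x, `|x - y| < e.
  by apply: cvgr_dist_lt => //; exact: cvg_id.
by apply: filterS => y; rewrite -fB; exact: le_lt_trans.
Qed.

Lemma ReC_continuous : continuous (@complex.Re R : C -> R).
Proof. exact: lin_contraction ReC_linear ReC_le. Qed.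

Lemma ImC_continuous : continuous (@complex.Im R : C -> R).
Proof. exact: lin_contraction ImC_linear ImC_le. Qed.

Lemma hasd_lin (V : lmodType R) (E F : normedModType R) (f : E -> F) (g : V -> E) a v l :
  linear f -> continuous f -> hasd g a v l -> hasd (fun x => f (g x)) a v (f l).
Proof.
move=> lf cf gl.
have f0 : f 0 = 0 by have := lf (-1) 0 0; rewrite !scaleN1r addr0 oppr0 addNr.
have fZ b x : f (b *: x) = b *: f x by rewrite -[b *: x]addr0 lf f0 addr0.
have fD x y : f (x + y) = f x + f y by rewrite -[x in LHS]scale1r lf scale1r.
have fB x y : f (x - y) = f x - f y by rewrite -scaleN1r fD fZ scaleN1r.
rewrite /hasd; under eq_fun do rewrite -fB -fZ.
by apply: (cvg_comp _ f gl); exact: cf.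
Qed.

Lemma mean_value_real (f f' : R -> R) a b M : a <= b ->
  (forall t, a <= t <= b -> hasd f t 1 (f' t)) ->
  (forall t, a <= t <= b -> `|f' t| <= M) -> `|f b - f a| <= M * (b - a).
Proof.
move=> ab ff' f'M.
have [||c] := @MVT_segment R f f' a b ab.
- move=> x; rewrite in_itv/= => /andP[ax xb]; apply/hasdE/ff'.
  by rewrite !ltW.
- apply: derivable_within_continuous => x; rewrite in_itv/= => xab.
  exact: cvgP (ff' x xab).
rewrite in_itv/= => cab ->; rewrite normrM [`|b - a|]ger0_norm ?subr_ge0//.
by rewrite ler_wpM2r ?subr_ge0//; exact: f'M.
Qed.

(** The factor 2 comes from treating the real and imaginary parts separately. *)
Lemma mean_value (g g' : R -> C) a b M : a <= b ->
  (forall t, a <= t <= b -> hasd g t 1 (g' t)) ->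
  (forall t, a <= t <= b -> `|g' t| <= M) -> `|g b - g a| <= 2 * M * (b - a).
Proof.
move=> ab gg' g'M; apply: le_trans (normC_le _) _.
rewrite -mulrA [2 * _]mulrDl mul1r; apply: lerD.
  rewrite ReB; apply: (mean_value_real (f := fun t => complex.Re (g t)) ab).
    by move=> t /gg'; apply: hasd_lin; [exact: ReC_linear|exact: ReC_continuous].
  by move=> t /g'M; apply: le_trans; exact: ReC_le.
rewrite ImB; apply: (mean_value_real (f := fun t => complex.Im (g t)) ab).
  by move=> t /gg'; apply: hasd_lin; [exact: ImC_linear|exact: ImC_continuous].
by move=> t /g'M; apply: le_trans; exact: ImC_le.
Qed.

Lemma cauchy_real (q : R -> R) (d K : R) : 0 < d -> 0 <= K ->
  (forall h k, 0 < `|h| < d -> 0 < `|k| < d -> `|q h - q k| <= K * (`|h| + `|k|)) ->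
  cvg (q h @[h --> (0 : R)^']).
Proof.
move=> d0 K0 qK; apply/cauchy_cvgP; apply: cauchy_exP => e e0.
have K1 : 0 < K + 1 by rewrite ltr_wpDl.
pose r := Num.min d (e / (K + 1) / 2).
have r0 : 0 < r by rewrite lt_min d0/= !divr_gt0.
have rd : r / 2 < d.
  by apply: lt_le_trans (_ : r <= d); [rewrite ltr_pdivrMr// ltr_pMr// ltrDl|
    rewrite ge_min lexx].
exists (q (r / 2)).
suff H : \forall k \near (0 : R)^', `|q (r / 2) - q k| < e by exact: H.
near=> k.
have k0 : 0 < `|k| by rewrite normr_gt0; near: k; exact: nbhs_dnbhs_neq.
have kr : `|k| < r by near: k; exact: dnbhs0_lt.
have h0 : `|r / 2| = r / 2 by rewrite ger0_norm// divr_ge0// ltW.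
apply: le_lt_trans (qK _ _ _ _) _.
- by rewrite h0 divr_gt0.
- by rewrite k0 (lt_le_trans kr)// ge_min lexx.
have : `|r / 2| + `|k| < e / (K + 1).
  rewrite [ltRHS](splitr); apply: ltr_leD.
    rewrite h0; apply: lt_le_trans (_ : r <= _); last by rewrite ge_min lexx orbT.
    by rewrite ltr_pdivrMr// ltr_pMr// ltrDl.
  by apply: ltW (lt_le_trans kr _); rewrite ge_min lexx orbT.
rewrite ltr_pdivlMr// mulrC; apply: le_lt_trans.
by rewrite ler_wpM2r ?addr_ge0// lerDl.
Unshelve. all: by end_near. Qed.

(** The form in which completeness of C gives derivatives: the functions q
    below are difference quotients. *)
Lemma cauchy_complex (q : R -> C) (d K : R) : 0 < d -> 0 <= K ->
  (forall h k, 0 < `|h| < d -> 0 < `|k| < d -> `|q h - q k| <= K * (`|h| + `|k|)) ->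
  exists l : C, q h @[h --> (0 : R)^'] --> l.
Proof.
move=> d0 K0 qK.
have /cvg_ex[x qx] : cvg (complex.Re (q h) @[h --> (0 : R)^']).
  apply: (cauchy_real d0 K0) => h k hd kd.
  by rewrite -ReB; apply: le_trans (ReC_le _) _; exact: qK.
have /cvg_ex[y qy] : cvg (complex.Im (q h) @[h --> (0 : R)^']).
  apply: (cauchy_real d0 K0) => h k hd kd.
  by rewrite -ImB; apply: le_trans (ImC_le _) _; exact: qK.
exists (Complex x y); apply/cvgrPdist_lt => e e0.
have e20 : 0 < e / 2 by rewrite divr_gt0.
move/cvgrPdist_lt/(_ _ e20) : qx => qx; move/cvgrPdist_lt/(_ _ e20) : qy => qy.
apply: filterS2 qx qy => h hx hy; apply: le_lt_trans (normC_le _) _.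
by rewrite ReB ImB/= (splitr e) ltrD.
Qed.

End complex_values.

(** * Bump functions and series of bumps *)

Section bumps.
Variable R : realType.

(** The family is indexed by k because it is closed under derivation up to
    linear combinations, see [hasd_flat]. *)
Definition flat (k : nat) (t : R) : R :=
  if 0 < t then t^-1 ^+ k * expR (- t^-1) else 0.

Lemma flat_ge0 k t : 0 <= flat k t.
Proof.
rewrite /flat; case: ifP => // t0.
by rewrite mulr_ge0 ?expR_ge0// exprn_ge0// invr_ge0 ltW.
Qed.

Lemma flat0_gt0 t : 0 < t -> 0 < flat 0 t.
Proof. by move=> t0; rewrite /flat t0 expr0 mul1r expR_gt0. Qed.

Lemma flat_le k t : 0 <= t -> flat k t <= (k.+1)`!%:R * t.
Proof.
move=> t0; rewrite /flat; case: ifP => [{}t0|_]; last by rewrite mulr_ge0.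
have y0 : 0 < t^-1 by rewrite invr_gt0.
have := expR_ge1Dxn k (ltW y0); set f := (k.+1)`!%:R => H.
have f0 : 0 < f by rewrite ltr0n fact_gt0.
have {}H : t^-1 ^+ k.+1 <= f * expR t^-1.
  rewrite mulrC -ler_pdivrMr//; apply: le_trans H; by rewrite lerDr.
rewrite expRN ler_pdivrMr ?expR_gt0//.
by rewrite mulrAC -ler_pdivrMr// mulrC -exprS.
Qed.

Lemma hasd_flat k t : hasd (flat k) t 1 (- k%:R * flat k.+1 t + flat k.+2 t).
Proof.
have [t0|t0|<-] := ltgtP 0 t.
- apply: (@hasd_local R R R (fun t : R => t^-1 ^+ k * expR (- t^-1))).
    by near=> x; rewrite /flat ifT//; near: x; exact: lt_nbhsr.
  rewrite /flat t0; apply/hasdE.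
  have tn0 : t != 0 by rewrite gt_eqF.
  have D1 : is_derive t 1 (fun t : R => t^-1) (- t ^- 2 *: 1).
    exact: (@is_deriveV R id t 1 1 tn0).
  have D2 := is_deriveX k D1.
  have D3 : is_derive t 1 (fun t : R => - t^-1) (t ^- 2).
    by apply: is_derive_eq (is_deriveN D1) _; rewrite scaleNr opprK [_ *: _]mulr1.
  have D4 := @is_derive1_comp R expR (fun t : R => - t^-1) t _ _
    (is_derive_expR (- t^-1)) D3.
  have := is_deriveM D2 D4; rewrite [X in is_derive _ _ X _ -> _](_ : _ =
    (fun t => t^-1 ^+ k * expR (- t^-1))); last first.
    by apply/funext => x; rewrite !fctE.
  move=> D; apply: is_derive_eq D _; rewrite !fctE /GRing.scale/= !mulr1 -exprVn.
  case: k {D2} => [|k]; first by rewrite !expr0; ring.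
  by rewrite /= !exprS; ring.
- rewrite /flat !ifF ?mulr0 ?addr0; try by rewrite ltNge ltW.
  apply: (@hasd_local R R R (fun=> 0)); last exact: hasd_cst.
  by near=> x; rewrite ifF//; apply: negbTE; rewrite -leNgt ltW//; near: x; exact: lt_nbhsl.
rewrite /flat ltxx mulr0 addr0; apply/cvgrPdist_lt => e e0.
pose f : R := (k.+2)`!%:R.
have f0 : 0 < f by rewrite ltr0n fact_gt0.
near=> h; rewrite sub0r normrN addr0 [h%:A]mulr1 ltxx subr0 -/(flat k h).
have [h0|h0] := ltP 0 h; last first.
  by rewrite /flat [0 < h]ltNge h0 scaler0 normr0.
rewrite [_ *: _](_ : _ = flat k.+1 h); last first.
  by rewrite /flat h0 exprS -mulrA.
rewrite ger0_norm ?flat_ge0//; apply: le_lt_trans (flat_le _ (ltW h0)) _.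
rewrite mulrC -ltr_pdivlMr//; apply: le_lt_trans (ler_norm _) _.
by near: h; apply: dnbhs0_lt; rewrite divr_gt0.
Unshelve. all: by end_near. Qed.

Lemma nder_flat n k : nder n (flat k).
Proof.
elim: n k => [//|n IH] k; exists (fun t => - k%:R * flat k.+1 t + flat k.+2 t).
  by move=> t; exact: hasd_flat.
by apply: nderD => //; exact: nderZ.
Qed.

Definition smooth_step (t : R) : R := flat 0 t * (flat 0 t + flat 0 (1 - t))^-1.

Lemma smooth_step_den t : 0 < flat 0 t + flat 0 (1 - t).
Proof.
have [t0|t0] := ltP 0 t; first by rewrite ltr_pwDl ?flat0_gt0 ?flat_ge0.
by rewrite ltr_wpDl ?flat0_gt0 ?flat_ge0// subr_gt0 (le_lt_trans t0).
Qed.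

Lemma nder_smooth_step n : nder n smooth_step.
Proof.
apply: nderM; first exact: nder_flat.
apply: nder_inv; first by move=> t; rewrite gt_eqF// smooth_step_den.
apply: nderD; first exact: nder_flat.
apply: (@nder_comp _ _ _ (flat 0)); first exact: nder_flat.
by apply: nderB; [exact: nder_cst|exact: nder_id].
Qed.

Lemma smooth_step0 t : t <= 0 -> smooth_step t = 0.
Proof. by move=> t0; rewrite /smooth_step {1}/flat ltNge t0 mul0r. Qed.

Lemma smooth_step1 t : 1 <= t -> smooth_step t = 1.
Proof.
move=> t1; rewrite /smooth_step [flat 0 (1 - t)]/flat ifF; last first.
  by rewrite subr_gt0 ltNge t1.
by rewrite addr0 mulfV// gt_eqF// flat0_gt0// (lt_le_trans _ t1).
Qed.

Definition bump (t : R) : R :=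
  smooth_step (8 * (t - 3 / 4)) * smooth_step (8 * (5 / 4 - t)).

Lemma nder_bump n : nder n bump.
Proof.
apply: nderM; apply: (@nder_comp _ _ _ smooth_step); try exact: nder_smooth_step.
  by apply: (@nderZ _ _ _ 8); apply: nderB; [exact: nder_id|exact: nder_cst].
by apply: (@nderZ _ _ _ 8); apply: nderB; [exact: nder_cst|exact: nder_id].
Qed.

Lemma bump1 t : `|t - 1| <= 1 / 8 -> bump t = 1.
Proof.
by rewrite ler_norml => /andP[t1 t2]; rewrite /bump !smooth_step1 ?mulr1//; lra.
Qed.

Lemma bump0 t : ~~ (3 / 4 < t < 5 / 4) -> bump t = 0.
Proof.
rewrite negb_and -!leNgt /bump => /orP[] tl.
  by rewrite smooth_step0 ?mul0r//; lra.
by rewrite [X in _ * X]smooth_step0 ?mulr0//; lra.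
Qed.

Lemma bump_ge0 t : 0 <= bump t.
Proof. by rewrite /bump !mulr_ge0 ?flat_ge0// invr_ge0 ltW// smooth_step_den. Qed.

Lemma bump_le1 t : bump t <= 1.
Proof.
have s1 u : smooth_step u <= 1.
  by rewrite ler_pdivrMr ?smooth_step_den// mul1r lerDl flat_ge0.
have s0 u : 0 <= smooth_step u.
  by rewrite mulr_ge0 ?flat_ge0// invr_ge0 ltW// smooth_step_den.
by rewrite /bump mulr_ile1.
Qed.

End bumps.

Section bump_series.
Variables (R : realType) (V : normedModType R).

(** A series of bumps concentrated near the points 1 / tau n. For g supported in
    [3/4, 5/4] and tau n at least 2^n, the terms with 2^n > 2 / t vanish at t, so
    that the sum may be cut off at [Num.bound (2 / t)]. *)
Definition bseries (W : lmodType R) (g : R -> R) (tau : nat -> R) (w : nat -> W) (t : R) : W :=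
  \sum_(n < Num.bound (2 / t)) g (tau n * t) *: w n.

Definition bump_supp (g : R -> R) := forall u, ~~ (3 / 4 <= u <= 5 / 4) -> g u = 0.

(** The decay of the coefficients that makes all derivatives of the series
    tend to 0 at 0, where the bumps accumulate. *)
Definition rapid (tau : nat -> R) (w : nat -> V) :=
  forall m, exists2 A, 0 <= A & forall n, tau n ^+ m * `|w n| <= A * 2 ^- n.

Lemma bump_supp_deriv g g' : bump_supp g -> (forall t, hasd g t 1 (g' t)) ->
  bump_supp g'.
Proof.
move=> sg gg' u; rewrite negb_and -!ltNge => ul.
apply: (cvg_unique _ (gg' u)); first exact: norm_hausdorff.
apply: (@hasd_local R R R (fun=> 0)); last exact: hasd_cst.
case/orP : ul => ul; near=> v; rewrite sg// negb_and -!ltNge; apply/orP; [left|right];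
  near: v; [exact: lt_nbhsl|exact: lt_nbhsr].
Unshelve. all: by end_near. Qed.

Lemma bump_supp_bounded g : bump_supp g -> nder 1 g ->
  exists2 M : R, 0 <= M & forall u, `|g u| <= M.
Proof.
move=> sg [g' gg' _].
have l : 3 / 4 <= 5 / 4 :> R by lra.
have cg : {within `[3 / 4, 5 / 4], continuous (fun u => `|g u|)}.
  apply: continuous_subspaceT => u; apply: continuous_comp; last exact: norm_continuous.
  by have /hasdE[/derivable1_diffP/differentiable_continuous] := gg' u.
have [c _ cM] := EVT_max l cg.
exists `|g c| => // u; have [ui|ui] := boolP (3 / 4 <= u <= 5 / 4).
  by apply: cM; rewrite in_itv.
by rewrite sg// normr0.
Qed.

Lemma sum_pow2_le N : \sum_(n < N) 2 ^- n <= 2 :> R.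
Proof.
suff : \sum_(n < N) 2 ^- n = 2 - 2 * 2 ^- N :> R.
  move=> ->; rewrite gerBl mulr_ge0// invr_ge0 exprn_ge0//.
elim: N => [|N IH]; first by rewrite big_ord0 expr0; lra.
rewrite big_ord_recr/= IH exprS invfM mulrA divff// mul1r.
by rewrite mulr_natl mulr2n opprD -!addrA addNr addr0.
Qed.

Lemma bseries_le g tau (w : nat -> V) t K :
  (forall n, `|g (tau n * t)| * `|w n| <= K * 2 ^- n) ->
  `|bseries g tau w t| <= 2 * K.
Proof.
move=> gK; rewrite /bseries; set N := Num.bound _.
have K0 : 0 <= K by have := gK 0%N; rewrite expr0 invr1 mulr1; apply: le_trans; exact: mulr_ge0.
apply: le_trans (ler_norm_sum _ _ _) _.
apply: (@le_trans _ _ (\sum_(n < N) K * 2 ^- n)).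
  by apply: ler_sum => i _; rewrite normrZ.
by rewrite -mulr_sumr mulrC ler_wpM2r// sum_pow2_le.
Qed.

Lemma sum_trunc (W : zmodType) (F : nat -> W) N M : (N <= M)%N ->
  (forall n, (N <= n)%N -> F n = 0) -> \sum_(n < M) F n = \sum_(n < N) F n.
Proof.
move=> NM F0; rewrite -!(big_mkord xpredT F) (big_cat_nat (leq0n N) NM)/=.
rewrite [X in _ + X]big_nat_cond [X in _ + X]big1 ?addr0// => i.
by rewrite andbT => /andP[/F0].
Qed.

Section at_tau.
Variable tau : nat -> R.
Hypothesis tau2 : forall n, 2 ^+ n <= tau n.

Lemma tau_gt0 n : 0 < tau n.
Proof. by apply: lt_le_trans (tau2 n); rewrite exprn_gt0. Qed.

Lemma bump_supp_far g N n t : bump_supp g -> 0 < t -> 2 <= 2 ^+ N * t ->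
  (N <= n)%N -> g (tau n * t) = 0.
Proof.
move=> sg t0 Nt Nn; apply: sg; rewrite negb_and -!ltNge; apply/orP; right.
have : 2 <= tau n * t.
  apply: le_trans Nt _; apply: ler_wpM2r; first exact: ltW.
  by apply: le_trans (tau2 n); rewrite ler_weXn2l// ler1n.
by apply: lt_le_trans; lra.
Qed.

Lemma bseriesE (W : lmodType R) g (w : nat -> W) N t : bump_supp g -> 0 < t -> 2 <= 2 ^+ N * t ->
  bseries g tau w t = \sum_(n < N) g (tau n * t) *: w n.
Proof.
move=> sg t0 Nt; rewrite /bseries; set B := Num.bound _.
have Bt : 2 <= 2 ^+ B * t.
  by rewrite -ler_pdivrMr// ltW//; apply: upper_nthrootP.
have H m M : 2 <= 2 ^+ m * t -> (m <= M)%N ->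
    \sum_(n < M) g (tau n * t) *: w n = \sum_(n < m) g (tau n * t) *: w n.
  move=> mt mM; apply: (sum_trunc (F := fun n => g (tau n * t) *: w n) mM) => n mn.
  by rewrite (bump_supp_far sg t0 mt mn) scale0r.
by have [NB|/ltnW BN] := leqP N B; [exact: H|apply/esym/H].
Qed.

Lemma bseries_nonpos (W : lmodType R) g (w : nat -> W) t : bump_supp g -> t <= 0 -> bseries g tau w t = 0.
Proof.
move=> sg t0; rewrite /bseries big1// => n _; rewrite sg ?scale0r//.
rewrite negb_and -!ltNge; apply/orP; left; apply: (@le_lt_trans _ _ 0); last by lra.
by rewrite mulr_ge0_le0// ltW// tau_gt0.
Qed.

(** When tau at least doubles at each step, the supports of the bumps are
    disjoint. *)
Lemma bseries_block (W : lmodType R) g (w : nat -> W) n t : (forall n, 2 * tau n <= tau n.+1) ->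
  bump_supp g -> 3 / 4 <= tau n * t <= 5 / 4 ->
  bseries g tau w t = g (tau n * t) *: w n.
Proof.
move=> tauS sg nt.
have tn := tau_gt0 n.
have t0 : 0 < t.
  by rewrite -(pmulr_rgt0 _ tn); case/andP : nt => nt _; apply: lt_le_trans nt; lra.
have tauD i j : (i < j)%N -> 2 * tau i <= tau j.
  elim: j => // j IH; rewrite ltnS leq_eqVlt => /orP[/eqP ->|/IH ij]; first exact: tauS.
  apply: le_trans ij (le_trans _ (tauS j)).
  by rewrite -[leLHS]mul1r ler_wpM2r// ?ler1n// ltW// tau_gt0.
have sm m : m != n -> g (tau m * t) = 0.
  rewrite neq_ltn => /orP[] /tauD mn; apply: sg; rewrite negb_and -!ltNge; apply/orP.
    left; rewrite -(ltr_pM2l (ltr0Sn R 1)) mulrA.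
    apply: (@le_lt_trans _ _ (tau n * t)); first by rewrite ler_wpM2r// ltW.
    by case/andP : nt => _ /le_lt_trans -> //; lra.
  right; apply: (@lt_le_trans _ _ (2 * tau n * t)); last by rewrite ler_wpM2r// ltW.
  by case/andP : nt => nt _; rewrite -mulrA; lra.
pose N := maxn (Num.bound (2 / t)) n.+1.
rewrite (bseriesE (N := N) _ sg t0); last first.
  by rewrite -ler_pdivrMr// ltW//; apply: upper_nthrootP; rewrite leq_max leqnn.
have nN : (n < N)%N by rewrite leq_max leqnn orbT.
rewrite (bigD1 (Ordinal nN))//= big1 ?addr0// => i ni.
by rewrite sm ?scale0r.
Qed.

Lemma rapidM w : rapid tau w -> rapid tau (fun n => tau n *: w n).
Proof.
move=> rw m; have [A A0 wA] := rw m.+1; exists A => // n.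
rewrite normrZ [`|tau n|]ger0_norm; last by rewrite ltW// tau_gt0.
by rewrite mulrA -exprSr.
Qed.

Lemma hasd_scaled (g g' : R -> R) : (forall t, hasd g t 1 (g' t)) ->
  forall a t, hasd (fun t => g (a * t)) t 1 (a * g' (a * t)).
Proof.
move=> gg' a t; have := @hasd_comp1 R R g g' (fun t => a * t) t a gg'; apply.
have := hasdZ (c := a) (hasd_id t); rewrite [a *: _]mulr1; exact.
Qed.

Lemma hasd_sum (N : nat) (F F' : 'I_N -> R -> V) t :
  (forall i, hasd (F i) t 1 (F' i t)) ->
  hasd (fun t => \sum_(i < N) F i t) t 1 (\sum_(i < N) F' i t).
Proof.
elim: N F F' => [|N IH] F F'.
  move=> _; rewrite big_ord0 [X in hasd X](_ : _ = fun=> 0); first exact: hasd_cst.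
  by apply/funext => u; rewrite big_ord0.
move=> FF'; under eq_fun do rewrite big_ord_recr; rewrite big_ord_recr/=.
have := IH (fun i => F (widen_ord (leqnSn N) i)) (fun i => F' (widen_ord (leqnSn N) i)).
move=> /(_ (fun i => FF' _)) H; have := FF' ord_max; exact: hasdD H.
Qed.

(** Away from 0 the sum is locally finite; at 0 the difference quotient is
    bounded by a multiple of t thanks to the decay of w. *)
Lemma hasd_bseries g g' (w : nat -> V) t : bump_supp g -> (forall t, hasd g t 1 (g' t)) ->
  rapid tau w ->
  hasd (bseries g tau w) t 1 (bseries g' tau (fun n => tau n *: w n) t).
Proof.
move=> sg gg' rw; have sg' := bump_supp_deriv sg gg'.
have [t0|t0|t0] := ltgtP 0 t.
- pose N := Num.bound (4 / t).
  have Nt x : t / 2 < x -> 2 <= 2 ^+ N * x.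
    move=> tx; have : 4 / t < 2 ^+ N by exact: upper_nthrootP.
    rewrite ltr_pdivrMr// => N4.
    have : 2 ^+ N * (t / 2) <= 2 ^+ N * x by rewrite ler_wpM2l ?exprn_ge0// ltW.
    by apply: le_trans; rewrite mulrA; lra.
  have tt : t / 2 < t by rewrite ltr_pdivrMr// ltr_pMr// ltrDl.
  have t20 : 0 < t / 2 by rewrite divr_gt0.
  apply: (@hasd_local R R V (fun t => \sum_(n < N) g (tau n * t) *: w n)).
    near=> x; apply/esym.
    have tx : t / 2 < x by near: x; exact: lt_nbhsr.
    by apply: bseriesE => //; [exact: lt_trans tx|exact: Nt].
  rewrite (bseriesE _ sg' t0 (Nt t tt)).
  apply: (@hasd_sum N (fun n t => g (tau n * t) *: w n)
    (fun n t => g' (tau n * t) *: (tau n *: w n))) => i.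
  have := hasdM (hasd_scaled (a := tau i) (t := t) gg') (hasd_cst (w i) t 1).
  by rewrite scaler0 addr0 scalerA mulrC.
- rewrite bseries_nonpos ?ltW//.
  apply: (@hasd_local R R V (fun=> 0)); last exact: hasd_cst.
  by near=> x; rewrite bseries_nonpos// ltW//; near: x; exact: lt_nbhsl.
rewrite -t0 bseries_nonpos//.
have [M M0 gM] : exists2 M : R, 0 <= M & forall u, `|g u| <= M.
  by apply: bump_supp_bounded => //; exists g'.
have [A A0 wA] := rw 2%N.
have H h : `|bseries g tau w h| <= 2 * (4 * M * A * h ^+ 2).
  apply: bseries_le => n.
  have [hn|hn] := boolP (3 / 4 <= tau n * h <= 5 / 4); last first.
    rewrite sg// normr0 mul0r; apply: mulr_ge0; last by rewrite invr_ge0 exprn_ge0.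
    by apply: mulr_ge0 (sqr_ge0 _); rewrite !mulr_ge0.
  have h1 : 1 <= 4 * (tau n * h) ^+ 2.
    by case/andP : hn => + _; move: (tau n * h) => y; rewrite expr2; nra.
  apply: (@le_trans _ _ (M * (4 * (tau n * h) ^+ 2 * `|w n|))).
    apply: ler_pM => //; rewrite -[leLHS]mul1r ler_wpM2r//.
  have := wA n; rewrite exprMn => wn.
  have : M * 4 * h ^+ 2 * (tau n ^+ 2 * `|w n|) <= M * 4 * h ^+ 2 * (A / 2 ^+ n).
    by apply: ler_wpM2l => //; apply: mulr_ge0 (sqr_ge0 _); rewrite mulr_ge0.
  by congr (_ <= _); ring.
set B := 8 * M * A + 1; have B0 : 0 < B by rewrite ltr_wpDl// !mulr_ge0.
apply/cvgrPdist_lt => e e0; near=> h.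
have b0 : bseries g tau w 0 = 0 by exact: bseries_nonpos.
rewrite sub0r normrN addr0 b0 subr0 [h%:A]mulr1 normrZ normfV.
have h0 : 0 < `|h| by rewrite normr_gt0; near: h; exact: nbhs_dnbhs_neq.
rewrite mulrC ltr_pdivrMr//; apply: le_lt_trans (H h) _.
have he : `|h| < e / B by near: h; apply: dnbhs0_lt; rewrite divr_gt0.
move: he; rewrite ltr_pdivlMr// => he.
rewrite -real_normK ?num_real// expr2 !mulrA ltr_pM2r//.
apply: le_lt_trans he; rewrite mulrC -!mulrA ler_wpM2l// /B.
by rewrite -[leLHS]addr0; apply: lerD => //; rewrite !mulrA; lra.
Unshelve. all: by end_near. Qed.

Lemma nder_bseries g (w : nat -> V) n : bump_supp g -> (forall n, nder n g) ->
  rapid tau w -> nder n (bseries g tau w).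
Proof.
elim: n g w => [//|n IH] g w sg ng rw.
have sm : smooth_curve g by apply/smooth_curveP => //; exact: norm_hausdorff.
have gg' t : hasd g t 1 (tderive g t 1) by apply: hasd_tderive; exact: (sm 0%N).
exists (bseries (fun t => tderive g t 1) tau (fun n => tau n *: w n)).
  by move=> t; exact: hasd_bseries.
apply: IH; [exact: bump_supp_deriv gg'| |exact: rapidM].
apply/smooth_curveP; first exact: norm_hausdorff.
by apply: smooth_curve_deriv gg' sm; exact: norm_hausdorff.
Qed.

End at_tau.
End bump_series.

(** * Iterated differences *)

Section differences.
Variables (R : realType) (V : normedModType R).
Local Notation C := (Rcomplex R).
Implicit Types (f g : V -> C) (l : seq V).

Definition fdiff (a : V) f : V -> C := fun x => f (x + a) - f x.

Definition mdiff l f : V -> C := foldl (fun g a => fdiff a g) f l.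

Arguments mdiff : simpl never.

Lemma mdiff_cons a l f : mdiff (a :: l) f = mdiff l (fdiff a f).
Proof. by []. Qed.

Lemma fdiffC a b f : fdiff a (fdiff b f) = fdiff b (fdiff a f).
Proof.
by apply/funext => x; rewrite /fdiff [x + a + b]addrAC; ring.
Qed.

Lemma fdiff_mdiff a l f : fdiff a (mdiff l f) = mdiff l (fdiff a f).
Proof. by elim: l f => // b l IH f; rewrite /= !mdiff_cons IH fdiffC. Qed.

Lemma mdiff_consE a l f x : mdiff (a :: l) f x = mdiff l f (x + a) - mdiff l f x.
Proof. by rewrite mdiff_cons -fdiff_mdiff. Qed.

Lemma mdiffZ (b : R) l f x : mdiff l (fun x => b *: f x) x = b *: mdiff l f x.
Proof. by elim: l x => // a l IH x; rewrite !mdiff_consE !IH scalerBr. Qed.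

Lemma mdiff0 l f x : 0 \in l -> mdiff l f x = 0.
Proof.
elim: l x => // a l IH x; rewrite in_cons mdiff_consE => /orP[/eqP <-|l0].
  by rewrite addr0 subrr.
by rewrite !IH// subrr.
Qed.

(** The sign is (-1)^(p - k), as p + k and p - k have the same parity. *)
Definition pcoef (p k : nat) : R := (-1) ^+ (p + k) * 'C(p, k)%:R.

Lemma mdiff_nseq p w f x :
  mdiff (nseq p w) f x = \sum_(k < p.+1) pcoef p k *: f (x + k%:R *: w).
Proof.
elim: p x => [|p IH] x.
  rewrite big_ord_recr big_ord0 /= add0r /pcoef bin0 mulr1 expr0 scale1r.
  by rewrite scale0r addr0.
rewrite /= mdiff_consE !IH [RHS]big_ord_recl.
under [in RHS]eq_bigr => i _ do rewrite /pcoef binS natrD mulrDr scalerDl.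
rewrite big_split /= addrA [RHS]addrC; congr (_ + _).
  apply: eq_bigr => i _; rewrite /fintype.bump/= add1n.
  have -> : (-1) ^+ (p.+1 + i.+1) = (-1) ^+ (p + i) :> R.
    by rewrite addnS addSn !exprS !mulN1r opprK.
  congr (_ *: f _).
  by rewrite -addrA; congr (_ + _); rewrite -[i.+1%:R]natr1 scalerDl scale1r addrC.
rewrite big_ord_recl [in RHS]big_ord_recr/= opprD.
rewrite [pcoef p.+1 0]/pcoef [pcoef p 0]/pcoef !bin0 !mulr1 !addn0 exprS mulN1r scaleNr.
congr (_ + _).
rewrite bin_small// mulr0 scale0r addr0 -sumrN; apply: eq_bigr => i _.
by rewrite /fintype.bump/= add1n /pcoef [(p.+1 + _)%N]addSn exprS mulN1r mulNr scaleNr.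
Qed.

(** An iterated difference of order n is a signed sum of 2^n values; the choice of
    such a value is made for all k simultaneously, which keeps the sum over k as a
    pure sum along a line. *)
Lemma sum_mdiff_affine (c : nat -> R) (N : nat) f (M : R) (L : seq (V * V)) x b0 :
  (forall z w, `|z - x| <= \sum_(ab <- L) `|ab.1| ->
    `|w| <= `|b0| + \sum_(ab <- L) `|ab.2| ->
    `|\sum_(k < N) c k *: f (z + k%:R *: w)| <= M) ->
  `|\sum_(k < N) c k *: mdiff [seq ab.1 + k%:R *: ab.2 | ab <- L] f (x + k%:R *: b0)|
    <= 2 ^+ size L * M.
Proof.
elim: L x b0 => [|[a b] L IH] x b0 H.
  by rewrite expr0 mul1r; apply: H; rewrite big_nil ?subrr ?normr0 ?addr0.
under eq_bigr => k _ do rewrite [map _ _]/= mdiff_consE scalerBr.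
rewrite sumrB exprS -mulrA mulr_natl mulr2n.
apply: le_trans (ler_normB _ _) _; apply: lerD.
  under eq_bigr => k _.
    rewrite (_ : x + k%:R *: b0 + (a + k%:R *: b) =
      (x + a) + k%:R *: (b0 + b)); last first.
      by rewrite scalerDr addrACA.
    over.
  apply: IH => z w zx wb; apply: H; rewrite big_cons/=.
    rewrite -(subrK (x + a) z) -addrA; apply: le_trans (ler_normD _ _) _.
    have -> : x + a - x = a by rewrite addrC addKr.
    by rewrite addrC lerD.
  by rewrite addrA; apply: le_trans wb _; rewrite lerD2r; exact: ler_normD.
apply: IH => z w zx wb; apply: H; rewrite big_cons/=.
  by apply: le_trans zx _; rewrite lerDr.
by apply: le_trans wb _; rewrite lerD2l lerDr.
Qed.

(** Djokovic's polarization identity: up to sign, mdiff l f x is the alternating sum over k of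
    binomial (p, k) times the differences with increments (1 - k / (i + 1)) l_i at x.
    For k = 0 these are the l_i themselves, and for 1 <= k <= p the increment with
    i = k - 1 is zero. Each of the 2^p signed values of these differences is a pure
    difference of order p. *)
Lemma mdiff_polarization f (M r : R) l x : 0 <= r -> (forall a, a \in l -> `|a| <= r) ->
  (forall z w, `|z - x| <= (size l)%:R * r -> `|w| <= (size l)%:R * r ->
    `|mdiff (nseq (size l) w) f z| <= M) ->
  `|mdiff l f x| <= 2 ^+ size l * M.
Proof.
move=> r0 lr HM; set p := size l in HM *.
pose L := mkseq (fun i => (nth 0 l i, - (i.+1)%:R^-1 *: nth 0 l i)) p.
have -> : `|mdiff l f x| = `|\sum_(k < p.+1) pcoef p k *:
    mdiff [seq ab.1 + k%:R *: ab.2 | ab <- L] f (x + k%:R *: 0)|.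
  rewrite big_ord_recl big1 ?addr0 => [|i _].
    rewrite normrZ scale0r addr0 /pcoef bin0 mulr1 normrX normrN1 expr1n mul1r.
    congr (`|mdiff _ f x|); rewrite /L /mkseq -map_comp.
    rewrite -[LHS](mkseq_nth 0) /mkseq; apply: eq_map => j /=.
    by rewrite scale0r addr0.
  rewrite mdiff0 ?scaler0// /L; apply/mapP; exists (nth (0, 0) L i).
    by rewrite mem_nth// size_mkseq.
  rewrite (nth_mkseq _ _ (ltn_ord i)) lift0 /= scalerA mulrN mulfV ?pnatr_eq0//.
  by rewrite scaleN1r subrr.
have -> : p = size L by rewrite size_mkseq.
have i1 i : `|((i.+1)%:R : R)^-1| <= 1.
  by rewrite normfV invf_le1 ?normr_gt0 ?pnatr_eq0// ger0_norm// ler1n.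
have nl i : `|nth 0 l i| <= r.
  have [il|il] := ltnP i (size l); first by apply: lr; exact: mem_nth.
  by rewrite nth_default// normr0.
have sumL (F : V * V -> R) : (forall i, F (nth 0 l i, - (i.+1)%:R^-1 *: nth 0 l i) <= r) ->
    \sum_(ab <- L) F ab <= p%:R * r.
  move=> Fr; rewrite big_map -[p%:R]/(p%:R) -{2}[p](size_iota 0) mulr_natl -iter_addr_0.
  elim: (iota 0 p) => [|i s IH]; first by rewrite big_nil.
  by rewrite big_cons/= lerD.
apply: sum_mdiff_affine => z w zx wb; rewrite size_mkseq -mdiff_nseq; apply: HM.
  apply: le_trans zx _; exact: sumL.
apply: le_trans wb _; rewrite normr0 add0r; apply: sumL => i /=.
by rewrite normrZ normrN -[r]mul1r ler_pM.
Qed.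

(** A difference with increment N b is a sum of N differences with increment b. *)
Lemma mdiff_subdivision f (M : R) (L : seq (nat * V)) x :
  (forall z, `|z - x| <= \sum_(nb <- L) nb.1%:R * `|nb.2| ->
    `|mdiff [seq nb.2 | nb <- L] f z| <= M) ->
  `|mdiff [seq nb.1%:R *: nb.2 | nb <- L] f x| <= (\prod_(nb <- L) nb.1%:R) * M.
Proof.
elim: L f M x => [|[N b] L IH] f M x H.
  by rewrite !big_nil mul1r in H *; apply: H; rewrite subrr normr0.
rewrite big_cons /=.
have -> : mdiff (N%:R *: b :: [seq nb.1%:R *: nb.2 | nb <- L]) f x =
    \sum_(j < N) mdiff [seq nb.1%:R *: nb.2 | nb <- L] (fdiff b f) (x + j%:R *: b).
  rewrite mdiff_consE; set g := mdiff _ f.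
  under eq_bigr => j _ do rewrite -fdiff_mdiff -/g /fdiff.
  elim: (N) => [|n IHn]; first by rewrite big_ord0 scale0r addr0 subrr.
  rewrite big_ord_recr/= -IHn -addrA -[x + n%:R *: b + b]addrA.
  have -> : n%:R *: b + b = n.+1%:R *: b by rewrite -natr1 scalerDl scale1r.
  by ring.
apply: le_trans (ler_norm_sum _ _ _) _.
rewrite -mulrA mulr_natl -[X in _ *+ X]card_ord -sumr_const.
apply: ler_sum => j _; apply: IH => z zx; rewrite -mdiff_cons; apply: H.
rewrite big_cons/=.
have -> : z - x = (z - (x + j%:R *: b)) + j%:R *: b by rewrite opprD addrA subrK.
apply: le_trans (ler_normD _ _) _; rewrite addrC; apply: lerD => //.
rewrite normrZ ger0_norm// ler_wpM2r// ler_nat ltnW//.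
Qed.

End differences.

(** * Functions with bounded difference quotients *)

Section bounded_differences.
Variables (R : realType) (V : normedModType R).
Local Notation C := (Rcomplex R).
Implicit Types (f g : V -> C) (l : seq V).

(** The class of smooth functions in a form that mentions neither derivatives nor
    multilinear maps: locally, differences of order p are bounded by a multiple of
    the product of the p increments. *)
Definition diff_bounded (U : set V) f := forall x, U x -> forall p,
  exists d K : R, [/\ 0 < d, 0 <= K & forall y l, `|y - x| <= d -> size l = p ->
    (forall a, a \in l -> `|a| <= d) -> `|mdiff l f y| <= K * \prod_(a <- l) `|a|].

Lemma hasd_along f y v t k : hasd f (t *: v + y) v k ->
  hasd (fun t : R => f (t *: v + y)) t 1 k.
Proof.
move=> fk; rewrite /hasd; under eq_fun => h do rewrite [h%:A]mulr1 scalerDl -addrA.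
exact: fk.
Qed.

Lemma line_bound f f' y v c B :
  (forall t, `|t| <= `|c| -> hasd f (t *: v + y) v (f' (t *: v + y))) ->
  (forall t, `|t| <= `|c| -> `|f' (t *: v + y)| <= B) ->
  `|f (c *: v + y) - f y| <= 2 * B * `|c|.
Proof.
move=> ff' fB; have [c0|c0] := leP 0 c.
  have := @mean_value R (fun t => f (t *: v + y)) (fun t => f' (t *: v + y)) 0 c B c0.
  rewrite scale0r add0r subr0 [`|c|]ger0_norm//; apply => t /andP[t0 tc].
    by apply: hasd_along; apply: ff'; rewrite !ger0_norm.
  by apply: fB; rewrite !ger0_norm.
have := @mean_value R (fun t => f (t *: v + y)) (fun t => f' (t *: v + y)) c 0 B (ltW c0).
rewrite scale0r add0r sub0r distrC [`|c|]ltr0_norm//; apply => t /andP[tc t0].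
  by apply: hasd_along; apply: ff'; rewrite [`|c|]ltr0_norm// [`|t|]ler0_norm// lerN2.
by apply: fB; rewrite [`|c|]ltr0_norm// [`|t|]ler0_norm// lerN2.
Qed.

Lemma hasd_mdiff f f' v l : (forall y, hasd f y v (f' y)) ->
  forall y, hasd (mdiff l f) y v (mdiff l f' y).
Proof.
elim: l f f' => [//|a l IH] f f' ff' y; rewrite !mdiff_cons; apply: IH => {}y.
apply: hasdD; last by apply: hasdN.
have := ff' (y + a); rewrite /hasd; by under eq_fun => h do rewrite addrA.
Qed.

(** A basis with its coordinate functions, normalized so that the mean value
    inequality can be applied one basis vector at a time. *)
Definition is_frame (m : nat) (e : 'I_m -> V) (c : 'I_m -> V -> R) :=
  [/\ forall a, a = \sum_i c i a *: e i, forall i, linear (c i : V -> R^o),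
      forall i a, `|c i a| <= `|a| & forall i, `|e i| <= 1].

Lemma common_radius_bound (m : nat) (P : 'I_m -> R -> R -> Prop) :
  (forall i d d' K K', d' <= d -> K <= K' -> P i d K -> P i d' K') ->
  (forall i, exists d K, [/\ 0 < d, 0 <= K & P i d K]) ->
  exists d K, [/\ 0 < d, 0 <= K & forall i, P i d K].
Proof.
move=> mono /choice[dd /choice[KK H]].
exists (\big[Num.min/1]_i dd i), (\sum_i KK i); split.
- by apply: lt_bigmin => // i _; case: (H i).
- by apply: sumr_ge0 => i _; case: (H i).
move=> i; have [_ _] := H i; apply: mono; first exact: bigmin_le_cond.
by rewrite (bigD1 i)//= lerDl sumr_ge0// => j _; case: (H j).
Qed.

(** Induction on the order p: the difference with increment a of a difference of
    order p - 1 is bounded by moving along the basis vectors one after another and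
    applying the mean value inequality to the partial derivatives, which belong to
    the same class G. *)
Lemma frame_diff_bounded (m : nat) e c (G : set (V -> C)) :
  is_frame (m := m) e c ->
  (forall f, G f -> forall i, exists2 f', G f' & forall y, hasd f y (e i) (f' y)) ->
  (forall f, G f -> forall x, exists d K : R, [/\ 0 < d, 0 <= K &
     forall y, `|y - x| <= d -> `|f y| <= K]) ->
  forall f, G f -> diff_bounded setT f.
Proof.
move=> [ae _ ce e1] Gd Gb f Gf x _ p; elim: p f Gf => [|p IH] f Gf.
  have [d [K [d0 K0 fK]]] := Gb f Gf x; exists d, K; split=> // y l yx.
  by move/size0nil => -> _; rewrite big_nil mulr1; exact: fK.
have /choice[f' Gf'] : forall i, exists f', G f' /\ forall y, hasd f y (e i) (f' y).
  by move=> i; have [f' ? ?] := Gd f Gf i; exists f'.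
have [d [K [d0 K0 fK]]] := @common_radius_bound m (fun i d K => forall y l,
    `|y - x| <= d -> size l = p -> (forall a, a \in l -> `|a| <= d) ->
    `|mdiff l (f' i) y| <= K * \prod_(a <- l) `|a|)
  (fun i d d' K K' dd KK H y l yx sl ld => le_trans (H y l (le_trans yx dd) sl
     (fun a al => le_trans (ld a al) dd))
     (ler_wpM2r (@prodr_ge0 _ _ l xpredT _ (fun=> fun=> normr_ge0 _)) KK))
  (fun i => IH (f' i) (Gf' i).1).
have m0 : 0 < m.+2%:R :> R by rewrite ltr0n.
exists (d / m.+2%:R), (2 * K *+ m); split.
- exact: divr_gt0.
- by rewrite mulrn_wge0// mulr_ge0.
move=> y [//|a l] yx [sl] ld; rewrite big_cons mdiff_consE.
set B := K * \prod_(b <- l) `|b|.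
have B0 : 0 <= B by rewrite mulr_ge0// prodr_ge0.
have dm : d / m.+2%:R <= d.
  by rewrite ler_pdivrMr//; apply: ler_peMr; [exact: ltW|rewrite ler1n].
have ad : `|a| <= d / m.+2%:R by apply: ld; rewrite mem_head.
have HB i z : `|z - x| <= d -> `|mdiff l (f' i) z| <= B.
  move=> zx; apply: fK => // b bl; apply: le_trans dm.
  by apply: ld; rewrite in_cons bl orbT.
(* the bound accumulated after moving along the basis vectors in r *)
have tel (r : seq 'I_m) : (size r <= m)%N ->
   `|y + \sum_(i <- r) c i a *: e i - x| <= (size r).+1%:R * (d / m.+2%:R) /\
   `|mdiff l f (y + \sum_(i <- r) c i a *: e i) - mdiff l f y| <= (2 * B * `|a|) *+ size r.
  elim: r => [_|i r IHr rm].
    by rewrite big_nil addr0 subrr normr0 mulr0n mul1r.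
  have [H1 H2] := IHr (ltnW rm); rewrite big_cons.
  set z := y + _ in H1 H2.
  have -> : y + (c i a *: e i + \sum_(j <- r) c j a *: e j) = c i a *: e i + z.
    by rewrite addrCA.
  have step t : `|t| <= `|c i a| ->
     `|t *: e i + z - x| <= (size r).+2%:R * (d / m.+2%:R).
    move=> tc; rewrite -addrA; apply: le_trans (ler_normD _ _) _.
    rewrite -[(size r).+2%:R]nat1r mulrDl mul1r; apply: lerD => //.
    rewrite normrZ; apply: le_trans ad; rewrite -[leRHS]mulr1.
    by apply: ler_pM => //; exact: le_trans tc (ce i a).
  split; first exact: step.
  rewrite -(subrK (mdiff l f z) (mdiff l f _)) -addrA mulrS.
  apply: le_trans (ler_normD _ _) _; apply: lerD => //.
  apply: le_trans (line_bound (f' := mdiff l (f' i)) (B := B) _ _) _.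
  - by move=> t _; apply: hasd_mdiff; exact: (Gf' i).2.
  - move=> t tc; apply: HB; apply: le_trans (step t tc) _.
    rewrite mulrCA -ler_pdivlMl// mulVf ?gt_eqF// ler_pdivrMr// mul1r ler_nat.
    by rewrite ltnS; exact: leqW rm.
  by rewrite ler_wpM2l// mulr_ge0.
have [_] := tel (enum 'I_m) (eq_leq (size_enum_ord m)).
rewrite -[\sum_(i <- _) _]/(\sum_(i <- enum 'I_m) _) big_enum/= -ae size_enum_ord.
move/le_trans; apply; rewrite le_eqVlt; apply/orP; left; apply/eqP.
rewrite /B -(mulr_natr (2 * _ * _)) -(mulr_natr (2 * K)) -!mulrA; congr (2 * (K * _)).
by rewrite mulrC [_ * m%:R]mulrC mulrA.
Qed.

(** Almost additive functions are almost homogeneous: phi h / h and phi k / k are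
    both compared with phi s / s for a small step s = h / (m + 1), where k is n s up
    to a remainder smaller than s; then m tends to infinity. *)
Lemma quasi_additive_pos (phi : R -> C) (d K K1 : R) : 0 < d -> 0 <= K -> 0 <= K1 ->
  (forall s t, `|s| <= d -> `|t| <= d ->
    `|phi (s + t) - phi s - phi t| <= K * `|s| * `|t|) ->
  (forall s, `|s| <= d -> `|phi s| <= K1 * `|s|) ->
  forall h k : R, 0 < h <= d -> 0 < k <= d ->
    `|h^-1 *: phi h - k^-1 *: phi k| <= K * (h + k).
Proof.
move=> d0 K0 K10 qa lip h k /andP[h0 hd] /andP[k0 kd].
have mult n s : 0 <= s -> n%:R * s <= d ->
    `|phi (n%:R * s) - n%:R *: phi s| <= K * (n%:R * s) ^+ 2.
  move=> s0; elim: n => [|n IH] nsd.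
    have : `|phi 0| <= K1 * `|0 : R| by apply: lip; rewrite normr0 ltW.
    by rewrite normr0 mulr0 mul0r scale0r subr0 expr0n mulr0.
  have nsd' : n%:R * s <= d by apply: le_trans nsd; rewrite ler_wpM2r// ler_nat.
  have sd : s <= d.
    by apply: le_trans nsd; rewrite -{1}[s]mul1r ler_wpM2r// ler1n.
  have ns0 : 0 <= n%:R * s by rewrite mulr_ge0.
  have -> : n.+1%:R * s = n%:R * s + s by rewrite -natr1 mulrDl mul1r.
  have -> : phi (n%:R * s + s) - n.+1%:R *: phi s =
      (phi (n%:R * s + s) - phi (n%:R * s) - phi s) + (phi (n%:R * s) - n%:R *: phi s).
    by rewrite -natr1 scalerDl scale1r; ring.
  apply: le_trans (ler_normD _ _) _.
  apply: le_trans (lerD (qa _ _ _ _) (IH nsd')) _; rewrite ?ger0_norm//.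
  rewrite -!mulrA -mulrDr ler_wpM2l//.
  have : 0 <= n%:R * s * s by rewrite mulr_ge0.
  have : 0 <= s * s by rewrite mulr_ge0.
  by rewrite mulrA; move: (n%:R * s) => u ? ?; rewrite !expr2; nra.
have key m : `|h^-1 *: phi h - k^-1 *: phi k| <=
    K * (h + k) + (h * (K + 2 * K1 / k)) / m.+1%:R.
  pose s := h / m.+1%:R; have m0 : 0 < m.+1%:R :> R by rewrite ltr0n.
  have s0 : 0 < s by rewrite divr_gt0.
  have sh : m.+1%:R * s = h by rewrite mulrCA mulfV ?mulr1// gt_eqF.
  pose n := Num.trunc (k / s).
  have ks0 : 0 <= k / s by rewrite divr_ge0// ltW.
  have /andP[n1 n2] := truncn_itv ks0.
  have {}n1 : n%:R * s <= k by rewrite -ler_pdivlMr.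
  have {}n2 : k < n.+1%:R * s by rewrite -ltr_pdivrMr.
  have ns0 : 0 <= n%:R * s by rewrite mulr_ge0// ltW.
  pose r := k - n%:R * s.
  have r0 : 0 <= r by rewrite subr_ge0.
  have rs : r <= s by rewrite lerBlDr -nat1r mulrDl mul1r addrC in n2 *; exact: ltW.
  have sd : s <= d.
    by apply: le_trans hd; rewrite -sh -{1}[s]mul1r ler_wpM2r ?ler1n// ltW.
  have rd := le_trans rs sd.
  have nsd := le_trans n1 kd.
  have E1 := mult m.+1 s (ltW s0); rewrite sh in E1; have {}E1 := E1 hd.
  have E2 := mult n s (ltW s0) nsd.
  have E3 : `|phi k - phi (n%:R * s) - phi r| <= K * `|n%:R * s| * `|r|.
    have nsr : n%:R * s + r = k by rewrite /r addrC subrK.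
    by have := qa (n%:R * s) r; rewrite nsr; apply; rewrite ger0_norm.
  have E4 : `|phi r| <= K1 * `|r| by apply: lip; rewrite ger0_norm.
  have E5 : `|phi s| <= K1 * `|s| by apply: lip; rewrite ger0_norm// ltW.
  rewrite !ger0_norm// in E3 E4 E5; last by rewrite ltW.
  have D1 : `|h^-1 *: phi h - s^-1 *: phi s| <= K * h.
    have -> : s^-1 *: phi s = h^-1 *: (m.+1%:R *: phi s).
      by rewrite scalerA -sh [(_ * s)^-1]invfM mulrAC mulVf ?mul1r// gt_eqF.
    rewrite -scalerBr normrZ gtr0_norm ?invr_gt0// mulrC ler_pdivrMr//.
    by rewrite -mulrA -expr2.
  have D2 : `|k^-1 *: phi k - s^-1 *: phi s| <= K * k + s * (K + 2 * K1 / k).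
    have -> : s^-1 *: phi s = k^-1 *: ((k / s) *: phi s).
      by rewrite scalerA mulrA mulVf ?mul1r// gt_eqF.
    rewrite -scalerBr normrZ gtr0_norm ?invr_gt0// mulrC ler_pdivrMr//.
    have -> : phi k - (k / s) *: phi s = (phi k - phi (n%:R * s) - phi r) + phi r +
        (phi (n%:R * s) - n%:R *: phi s) - (k / s - n%:R) *: phi s.
      by rewrite scalerBl; ring.
    have E6 : `|(k / s - n%:R) *: phi s| <= K1 * s.
      rewrite normrZ -[leRHS]mul1r ler_pM// ger0_norm.
        by rewrite lerBlDl natr1 ltW// ltr_pdivrMr.
      by rewrite subr_ge0 ler_pdivlMr.
    apply: le_trans (ler_normB _ _) _.
    apply: le_trans (lerD (le_trans (ler_normD _ _) (lerD (le_trans (ler_normD _ _) (lerD E3 E4)) E2)) E6) _.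
    have kk : 2 * K1 / k * k = 2 * K1 by rewrite mulfVK ?gt_eqF.
    rewrite mulrDl -[s * _ * k]mulrA [(K + _) * k]mulrDl kk.
    have F1 : K * (n%:R * s) * r <= K * k * s.
      by rewrite -mulrA -[leRHS]mulrA; apply: ler_wpM2l => //; apply: ler_pM.
    have F2 : K1 * r <= K1 * s by rewrite ler_wpM2l.
    have F3 : K * (n%:R * s) ^+ 2 <= K * k * k.
      by rewrite -mulrA ler_wpM2l// expr2 ler_pM.
    lra.
  have -> : h^-1 *: phi h - k^-1 *: phi k = (h^-1 *: phi h - s^-1 *: phi s) -
      (k^-1 *: phi k - s^-1 *: phi s) by ring.
  apply: le_trans (ler_normB _ _) _.
  apply: le_trans (lerD D1 D2) _.
  by rewrite [K * (h + k)]mulrDr addrA lerD2l /s mulrAC.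
apply/ler_addgt0Pr => e e0.
set Z := h * _ in key.
have Z0 : 0 <= Z.
  apply: mulr_ge0; first exact: ltW.
  by apply: addr_ge0 => //; apply: divr_ge0; [rewrite mulr_ge0|exact: ltW].
apply: le_trans (key (Num.bound (Z / e))) _; rewrite lerD2l.
rewrite ler_pdivrMr ?ltr0n// mulrC -ler_pdivrMr//.
apply: le_trans (ltW (archi_boundP _)) _; first by apply: divr_ge0; last exact: ltW.
by rewrite ler_nat.
Qed.

(** Negative arguments are reduced to positive ones by additivity on x and - x. *)
Lemma quasi_additive (phi : R -> C) (d K K1 : R) : 0 < d -> 0 <= K -> 0 <= K1 ->
  (forall s t, `|s| <= d -> `|t| <= d ->
    `|phi (s + t) - phi s - phi t| <= K * `|s| * `|t|) ->
  (forall s, `|s| <= d -> `|phi s| <= K1 * `|s|) ->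
  forall h k, 0 < `|h| <= d -> 0 < `|k| <= d ->
    `|h^-1 *: phi h - k^-1 *: phi k| <= 2 * K * (`|h| + `|k|).
Proof.
move=> d0 K0 K10 qa lip h k hd kd.
have phi0 : phi 0 = 0.
  have : `|phi 0| <= K1 * `|0 : R| by apply: lip; rewrite normr0 ltW.
  by rewrite normr0 mulr0 normr_le0 => /eqP.
have sgn x : 0 < `|x| <= d -> `|x^-1 *: phi x - `|x|^-1 *: phi `|x| | <= K * `|x|.
  move=> /andP[x0 xd]; have [xx|xx] := leP 0 x.
    by rewrite ger0_norm// subrr normr0 mulr_ge0.
  rewrite {1 2}(ltr0_norm xx).
  rewrite invrN scaleNr opprK -scalerDr normrZ normfV mulrC ler_pdivrMr//.
  have := qa x (- x); rewrite subrr phi0 normrN => /(_ xd xd).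
  by rewrite sub0r -opprD normrN.
have hk := quasi_additive_pos d0 K0 K10 qa lip hd kd.
have -> : h^-1 *: phi h - k^-1 *: phi k = (h^-1 *: phi h - `|h|^-1 *: phi `|h|) +
   (`|h|^-1 *: phi `|h| - `|k|^-1 *: phi `|k|) - (k^-1 *: phi k - `|k|^-1 *: phi `|k|).
  by ring.
apply: le_trans (ler_normB _ _) _.
apply: le_trans (lerD (le_trans (ler_normD _ _) (lerD (sgn h hd) hk)) (sgn k kd)) _.
by lra.
Qed.

End bounded_differences.

(** * From smooth curves to bounded difference quotients *)

Section boman.
Variable R : realType.
Local Notation C := (Rcomplex R).

Lemma nbhs_closed_ball (V : normedModType R) (x : V) (A : set V) : nbhs x A ->
  exists2 d : R, 0 < d & forall y, `|y - x| <= d -> A y.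
Proof.
move=> /nbhs_normP[e /= e0 eA]; exists (e / 2); first exact: divr_gt0.
move=> y yx; apply: eA => /=; rewrite distrC; apply: le_lt_trans yx _.
by rewrite ltr_pdivrMr// ltr_pMr// ltrDl.
Qed.

Lemma hasd_continuous (V : normedModType R) (F : R -> V) (t : R) (l : V) :
  hasd F t 1 l -> {for t, continuous F}.
Proof. by move=> /hasdE[/derivable1_diffP/differentiable_continuous]. Qed.

(** In dimension one the class of smooth functions is closed under derivation. *)
Lemma smooth_curve_diff_bounded (F : R -> C) : smooth_curve F ->
  diff_bounded (V := R) setT F.
Proof.
move=> sF; have hC : hausdorff_space C by exact: norm_hausdorff.
apply: (@frame_diff_bounded R R 1 (fun=> 1) (fun=> id) [set F | smooth_curve F]) => //.
- split=> //.
  + by move=> a; rewrite big_ord1 [RHS]mulr1.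
  + by move=> _; rewrite normr1.
- move=> f /= sf _; have ff' y : hasd f y 1 (tderive f y 1).
    by apply: hasd_tderive; exact: (sf 0%N).
  by exists (fun y => tderive f y 1) => //; exact: smooth_curve_deriv ff' sf.
move=> f /= sf x; have /hasd_continuous cf : hasd f x 1 (tderive f x 1).
  by apply: hasd_tderive; exact: (sf 0%N).
have [d d0 fd] : exists2 d : R, 0 < d & forall y, `|y - x| <= d -> `|f x - f y| < 1.
  by apply: nbhs_closed_ball; move/cvgrPdist_lt : cf; apply.
exists d, (`|f x| + 1); split=> //.
move=> y yx.
rewrite -lerBlDl; apply: le_trans (ltW (fd _ yx)); rewrite distrC.
by apply: le_trans (ler_norm _) _; exact: ler_dist_dist.
Qed.

Variable V : normedModType R.
Implicit Types (f : V -> C) (U : set V).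

(** It tends to 0 faster than all the powers 2^(- m n). *)
Definition rho (eta : R) (n : nat) : R := eta * 2 ^- (n ^ 2).

Lemma rho_gt0 eta n : 0 < eta -> 0 < rho eta n.
Proof. by move=> e0; rewrite mulr_gt0// invr_gt0 exprn_gt0. Qed.

Lemma rho_le eta n : 0 < eta -> rho eta n <= eta * 2 ^- n.
Proof.
move=> e0; rewrite ler_pM2l// lef_pV2 ?posrE ?exprn_gt0// ler_weXn2l// ?ler1n//.
by case: n => // n; rewrite expnS expn1 leq_pmulr.
Qed.

Lemma rho_rapid eta (w : nat -> V) : 0 < eta -> (forall n, `|w n| <= rho eta n) ->
  rapid (fun n => 2 ^+ n) w.
Proof.
move=> e0 wr m; exists (eta * 2 ^+ (m.+1 ^ 2)).
  by rewrite mulr_ge0// ?ltW// exprn_gt0.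
move=> n; rewrite -exprM.
apply: (@le_trans _ _ (2 ^+ (n * m) * rho eta n)).
  by rewrite ler_wpM2l// exprn_ge0.
rewrite /rho ler_pdivlMr ?exprn_gt0// -mulrA mulrCA -mulrA ler_pM2l//.
rewrite mulrC ler_pdivrMr ?exprn_gt0// -!exprD ler_weXn2l ?ler1n//.
have [nm|/ltnW mn] := leqP n m.+1.
  by rewrite -mulnSr (leq_trans _ (leq_addr _ _))// -mulnn leq_mul2r nm orbT.
by rewrite -mulnSr (leq_trans _ (leq_addl _ _))// -[(n ^ 2)%N]mulnn leq_mul2l mn orbT.
Qed.

Definition bump_slope (u : R) : R := (u - 1) * bump u.

Lemma bump_supp_bump : bump_supp (@bump R).
Proof.
move=> u; rewrite negb_and -!ltNge => uu; apply: bump0.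
by rewrite negb_and -!leNgt; case/orP : uu => /ltW ->; rewrite ?orbT.
Qed.

Lemma bump_supp_slope : bump_supp bump_slope.
Proof. by move=> u uu; rewrite /bump_slope bump_supp_bump// mulr0. Qed.

Lemma nder_bump_slope n : nder n bump_slope.
Proof.
apply: nderM; last exact: nder_bump.
by apply: nderB; [exact: nder_id|exact: nder_cst].
Qed.

Lemma bump_slope_le1 u : `|bump_slope u| <= 1.
Proof.
have [uu|uu] := boolP (3 / 4 <= u <= 5 / 4); last by rewrite bump_supp_slope// normr0.
rewrite /bump_slope normrM -[leRHS]mulr1 ler_pM//.
  by rewrite ler_norml; move: uu; lra.
by rewrite ger0_norm ?bump_ge0// bump_le1.
Qed.

Lemma bump_norm_le1 (u : R) : `|bump u| <= 1.
Proof. by rewrite ger0_norm ?bump_ge0// bump_le1. Qed.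

(** The curve runs through countably many prescribed short line segments: near 2^-n
    it is the line through x0 + a n with velocity b n. If a n and b n decay rapidly,
    it is smooth, since it is then flat at 0. *)
Definition special_curve (x0 : V) (a b : nat -> V) (t : R) : V :=
  x0 + bseries (@bump R) (fun n => 2 ^+ n) a t +
  bseries bump_slope (fun n => 2 ^+ n) (fun n => 2 ^- n *: b n) t.

Section special.
Variables (x0 : V) (a b : nat -> V) (eta : R).
Hypotheses (eta0 : 0 < eta) (ar : forall n, `|a n| <= rho eta n)
  (br : forall n, `|b n| <= rho eta n).

Lemma scaled_velocity_le n : `|2 ^- n *: b n| <= rho eta n.
Proof.
rewrite normrZ -[leRHS]mul1r ler_pM// normfV invf_le1 ?normr_gt0 ?expf_neq0//.
by rewrite normrX ger0_norm// exprn_ege1// ler1n.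
Qed.

Lemma smooth_special_curve : smooth_curve (special_curve x0 a b).
Proof.
apply/smooth_curveP; first exact: norm_hausdorff.
move=> n; apply: nderD; first apply: nderD.
- exact: nder_cst.
- by apply: nder_bseries => //; [exact: bump_supp_bump|exact: nder_bump|exact: rho_rapid ar].
- by apply: nder_bseries => //; [exact: bump_supp_slope|exact: nder_bump_slope|
    exact: rho_rapid scaled_velocity_le].
Qed.

Lemma special_curve_near t : `|special_curve x0 a b t - x0| <= 4 * eta.
Proof.
rewrite /special_curve.
set A := bseries _ _ a _; set B := bseries _ _ _ _.
have -> : x0 + A + B - x0 = A + B by rewrite addrAC [x0 + A]addrC addrK.
apply: le_trans (ler_normD _ _) _.
have -> : 4 * eta = 2 * eta + 2 * eta by rewrite -mulrDl -natrD.
apply: lerD; apply: bseries_le => n; apply: le_trans (rho_le _ eta0);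
  rewrite -[leRHS]mul1r; apply: ler_pM => //.
  exact: bump_norm_le1.
  exact: bump_slope_le1.
exact: scaled_velocity_le.
Qed.

Lemma special_curve_line n s : `|s| <= 2 ^- n / 16 ->
  special_curve x0 a b (2 ^- n + s) = x0 + a n + s *: b n.
Proof.
move=> sn; have n0 : 0 < 2 ^+ n :> R by rewrite exprn_gt0.
have tn : 2 ^+ n * (2 ^- n + s) = 1 + 2 ^+ n * s.
  by rewrite mulrDr mulfV// gt_eqF.
have {}sn : `|2 ^+ n * s| <= 1 / 16.
  by rewrite normrM gtr0_norm// mulrC -ler_pdivlMr// mulrC mulrA mulr1.
have tau2 k : 2 ^+ k <= 2 ^+ k :> R by [].
have tauS k : 2 * 2 ^+ k <= 2 ^+ k.+1 :> R by rewrite exprS.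
have t1 : 3 / 4 <= 2 ^+ n * (2 ^- n + s) <= 5 / 4.
  by rewrite tn; move: sn; rewrite ler_norml; move: (_ * s) => y; lra.
rewrite /special_curve !(bseries_block (n := n) tau2 _ tauS) //; last 2 first.
  exact: bump_supp_slope.
  exact: bump_supp_bump.
have b1 : bump (2 ^+ n * (2 ^- n + s)) = 1.
  by apply: bump1; rewrite tn addrC addKr (le_trans sn)//; lra.
rewrite /bump_slope b1 scale1r mulr1 tn [1 + _]addrC addrK scalerA.
by rewrite mulrAC mulfV ?mul1r// gt_eqF.
Qed.

End special.

(** If the bound failed for every ball and every constant, there would be points
    and increments tending to their limits so fast that a single smooth curve passes
    through all of the arithmetic progressions concerned. The composition of f with
    this curve would have unbounded difference quotients of order p, although it is
    a smooth function of a real variable. *)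
Lemma boman_pure U f : open U ->
  (forall c, smooth_curve c -> (forall t, U (c t)) -> smooth_curve (fun t => f (c t))) ->
  forall x0, U x0 -> forall p, exists d K : R, [/\ 0 < d, 0 <= K & forall y w,
    `|y - x0| <= d -> `|w| <= d -> `|mdiff (nseq p w) f y| <= K * `|w| ^+ p].
Proof.
move=> oU fU x0 Ux0 p; apply: contrapT => H.
have {}H (d K : R) : 0 < d -> 0 <= K -> exists yw : V * V,
    [/\ `|yw.1 - x0| <= d, `|yw.2| <= d & K * `|yw.2| ^+ p < `|mdiff (nseq p yw.2) f yw.1|].
  move=> d0 K0; apply: contrapT => H'; apply: H; exists d, K; split=> // y w yx wd.
  by rewrite leNgt; apply/negP => Hlt; apply: H'; exists (y, w).
have [e e0 eU] : exists2 e : R, 0 < e & forall y, `|y - x0| <= e -> U y.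
  by apply: nbhs_closed_ball; exact: open_nbhs_nbhs.
pose eta := e / 4; have eta0 : 0 < eta by rewrite divr_gt0.
pose rr := rho eta; have r0 n : 0 < rr n by exact: rho_gt0.
(* radius and increments so small that the p + 1 points of the n-th progression
   lie on the straight part of the curve, traversed with velocity of size rr n *)
pose dd n := rr n * Num.min 1 (2 ^- n / 16 / p.+1%:R).
have m0 n : 0 < Num.min 1 (2 ^- n / 16 / p.+1%:R) :> R.
  by rewrite lt_min ltr01/= !divr_gt0// invr_gt0 exprn_gt0.
have dd0 n : 0 < dd n by rewrite mulr_gt0.
have /choice[yw ywP] : forall n, exists yw : V * V,
    [/\ `|yw.1 - x0| <= dd n, `|yw.2| <= dd n &
      (n%:R / rr n ^+ p) * `|yw.2| ^+ p < `|mdiff (nseq p yw.2) f yw.1|].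
  by move=> n; apply: H => //; rewrite divr_ge0// exprn_ge0// ltW.
pose a n := (yw n).1 - x0; pose w n := (yw n).2.
pose b n := (rr n / `|w n|) *: w n.
have ar n : `|a n| <= rr n.
  have [H1 _ _] := ywP n; apply: le_trans H1 _.
  by apply: ler_piMr; [exact: ltW|rewrite ge_min lexx].
have br n : `|b n| <= rr n.
  rewrite /b normrZ normrM normfV normr_id (gtr0_norm (r0 n)).
  have [->|w0] := eqVneq (w n) 0; first by rewrite normr0 mulr0 ltW.
  by rewrite mulfVK// normr_eq0.
pose s n := `|w n| / rr n.
have s0 n : 0 <= s n by rewrite divr_ge0// ltW.
have sb n : s n *: b n = w n.
  rewrite /b scalerA /s; have [->|w0] := eqVneq (w n) 0; first by rewrite scaler0.
  rewrite mulrA mulfVK ?gt_eqF//; by rewrite mulfV ?scale1r// normr_eq0.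
have sl n : s n <= Num.min 1 (2 ^- n / 16 / p.+1%:R).
  by rewrite ler_pdivrMr// mulrC; case: (ywP n).
pose c := special_curve x0 a b.
have sF : smooth_curve (fun t => f (c t)).
  apply: fU; first exact: smooth_special_curve ar br.
  move=> t; apply: eU; apply: le_trans (special_curve_near _ eta0 ar br t) _.
  by rewrite /eta mulrC mulfVK.
have key n : n%:R * s n ^+ p < `|mdiff (nseq p (s n)) (fun t => f (c t)) (2 ^- n)|.
  have [_ _ Hn] := ywP n.
  have -> : mdiff (nseq p (s n)) (fun t => f (c t)) (2 ^- n) =
      mdiff (nseq p (w n)) f (yw n).1.
    rewrite !mdiff_nseq; apply: eq_bigr => k _; congr (_ *: f _).
    rewrite /c [_%:R *: s n]/(_ * _) special_curve_line//.
      by rewrite /a [x0 + _]addrC subrK -scalerA sb.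
    rewrite normrM ger0_norm// ger0_norm//.
    apply: (@le_trans _ _ (p.+1%:R * (2 ^- n / 16 / p.+1%:R))).
      apply: ler_pM => //; first by rewrite ler_nat ltnW// ltn_ord.
      by apply: le_trans (sl n) _; rewrite ge_min lexx orbT.
    by rewrite mulrC mulfVK// pnatr_eq0.
  have -> // : n%:R * s n ^+ p = n%:R / rr n ^+ p * `|w n| ^+ p.
  by rewrite /s expr_div_n mulrA mulrAC.
have [d [K [d0 K0 FK]]] := smooth_curve_diff_bounded sF (x := 0) I p.
pose n := maxn (Num.bound K) (Num.bound d^-1).
have nd : 2 ^- n <= d.
  rewrite -[leRHS]invrK lef_pV2 ?posrE ?invr_gt0 ?exprn_gt0//.
  by apply/ltW/upper_nthrootP; rewrite leq_max leqnn orbT.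
have nK : K <= n%:R.
  apply: le_trans (ltW (archi_boundP K0)) _; rewrite ler_nat leq_max leqnn//.
have := key n; rewrite ltNge => /negP; apply.
apply: le_trans (FK _ _ _ (size_nseq _ _) _) _.
- by rewrite subr0 ger0_norm// invr_ge0 exprn_ge0.
- move=> _ /nseqP[-> _]; rewrite ger0_norm//; apply: le_trans nd.
  apply: le_trans (sl n) _; rewrite ge_min; apply/orP; right.
  rewrite -mulrA ler_piMr// ?invr_ge0 ?exprn_ge0// mulr_ile1// ?invr_ge0//.
    by rewrite invf_le1// ler1n.
  by rewrite invf_le1// ler1n.
- rewrite big_nseq iter_mulr mulr1 ger0_norm// ler_wpM2r// exprn_ge0//.
Qed.

(** Boman's theorem. Polarization turns the bound for pure differences into a bound
    by r^p for increments of size at most r. To obtain the product of the sizes, every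
    increment is divided into pieces of size comparable to the smallest one. *)
Lemma boman U f : open U ->
  (forall c, smooth_curve c -> (forall t, U (c t)) -> smooth_curve (fun t => f (c t))) ->
  diff_bounded U f.
Proof.
move=> oU fU x0 Ux0 p; have [d [K [d0 K0 H]]] := boman_pure oU fU Ux0 p.
pose dp := d / (2 * p.+1)%:R.
have dp0 : 0 < dp by rewrite divr_gt0// ltr0n.
have dpE : (2 * p.+1)%:R * dp = d by rewrite mulrC mulfVK// pnatr_eq0.
have same r y l : 0 < r <= dp -> `|y - x0| <= p.+1%:R * dp -> size l = p ->
    (forall a, a \in l -> `|a| <= r) ->
    `|mdiff l f y| <= 2 ^+ p * (K * (p%:R * r) ^+ p).
  move=> /andP[r0 rd] yx sl lr.
  have pr : p%:R * r <= p%:R * dp by rewrite ler_wpM2l.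
  have pd : p.+1%:R * dp + p%:R * dp <= d.
    by rewrite -dpE -mulrDl -natrD ler_wpM2r ?ler_nat ?(ltW dp0)// mul2n -addnn leq_add.
  have pd' : p%:R * dp <= d by apply: le_trans pd; rewrite lerDr mulr_ge0// ltW.
  rewrite -{1}sl; apply: (mdiff_polarization (ltW r0) lr) => z w; rewrite sl => zy wr.
  apply: le_trans (H _ _ _ _) _.
  - have -> : z - x0 = (y - x0) + (z - y) by rewrite [RHS]addrC addrA subrK.
    apply: le_trans (ler_normD _ _) (le_trans _ pd); apply: lerD => //.
    exact: le_trans zy pr.
  - exact: le_trans wr (le_trans pr pd').
  - by rewrite ler_wpM2l// lerXn2r// ?nnegrE// (le_trans _ wr).
exists dp, (4 ^+ p * (p%:R ^+ p * K)); split=> //.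
  by rewrite mulr_ge0 ?exprn_ge0// mulr_ge0 ?exprn_ge0.
move=> y l yx sl ld.
have B0 : 0 <= 4 ^+ p * (p%:R ^+ p * K) * \prod_(a <- l) `|a|.
  by rewrite mulr_ge0 ?prodr_ge0// mulr_ge0 ?exprn_ge0// mulr_ge0 ?exprn_ge0.
have [l0|l0] := boolP (0 \in l); first by rewrite mdiff0// normr0.
have [r /andP[r0 rd] rl] : exists2 r : R, 0 < r <= dp & forall a, a \in l -> r <= `|a|.
  elim: (l) l0 => [_|a l' IH]; first by exists dp; rewrite ?dp0/=.
  rewrite in_cons negb_or eq_sym => /andP[a0 /IH[r /andP[r0 rd] rl]].
  exists (Num.min r `|a|).
    by rewrite lt_min r0 normr_gt0 a0/= ge_min rd.
  move=> b; rewrite in_cons => /orP[/eqP ->|/rl rb]; first by rewrite ge_min lexx orbT.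
  by rewrite ge_min rb.
(* a / N a has size between r / 2 and r *)
pose N (a : V) := (Num.truncn (`|a| / r)).+1.
have N0 a : 0 < (N a)%:R :> R by rewrite ltr0n.
pose L := [seq (N a, (N a)%:R^-1 *: a) | a <- l].
have lL : l = [seq nb.1%:R *: nb.2 | nb <- L].
  rewrite /L -map_comp -[LHS]map_id; apply: eq_map => a /=.
  by rewrite scalerA mulfV ?scale1r// gt_eqF.
have ar0 (a : V) : 0 <= `|a| / r :> R by rewrite divr_ge0// ltW.
have Nr a : `|(N a)%:R^-1 *: a| <= r.
  rewrite normrZ normfV ger0_norm// mulrC ler_pdivrMr// mulrC -ler_pdivrMr//.
  by have /andP[_ /ltW] := truncn_itv (ar0 a).
have Na a : a \in l -> (N a)%:R <= 2 * (`|a| / r).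
  move=> /rl ra; have /andP[H1 _] := truncn_itv (ar0 a).
  rewrite /N -natr1 mulr_natl mulr2n; apply: lerD => //.
  by rewrite ler_pdivlMr// mul1r.
have sz : size [seq nb.2 | nb <- L] = p by rewrite !size_map.
rewrite [X in mdiff X]lL.
apply: le_trans (@mdiff_subdivision _ _ f (2 ^+ p * (K * (p%:R * r) ^+ p)) L y _) _.
  move=> z zy; apply: (same r) => //; first by rewrite r0.
    have -> : z - x0 = (y - x0) + (z - y) by rewrite [RHS]addrC addrA subrK.
    apply: le_trans (ler_normD _ _) _; rewrite -nat1r mulrDl mul1r; apply: lerD => //.
    apply: le_trans zy _; rewrite -sl big_map.
    have -> : \sum_(a <- l) (N a)%:R * `|(N a)%:R^-1 *: a| = \sum_(a <- l) `|a|.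
      apply: eq_bigr => a _; rewrite normrZ normfV ger0_norm// mulrA mulfV ?mul1r//.
      by rewrite gt_eqF.
    elim: (l) ld => [_|a l' IH ld]; first by rewrite big_nil mul0r.
    rewrite big_cons /= -nat1r mulrDl mul1r; apply: lerD; first by apply: ld; rewrite mem_head.
    by apply: IH => b bl; apply: ld; rewrite in_cons bl orbT.
  by move=> _ /mapP[_ /mapP[a al ->] ->]; exact: Nr.
rewrite big_map.
apply: (@le_trans _ _ ((\prod_(a <- l) (2 * (`|a| / r))) * (2 ^+ p * (K * (p%:R * r) ^+ p)))).
  rewrite ler_wpM2r//.
    rewrite mulr_ge0 ?exprn_ge0// mulr_ge0// exprn_ge0// mulr_ge0// ltW//.
  by rewrite !big_seq; apply: ler_prod => a al; rewrite ler0n Na.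
rewrite le_eqVlt; apply/orP; left; apply/eqP.
have -> : \prod_(a <- l) (2 * (`|a| / r)) = (2 / r) ^+ p * \prod_(a <- l) `|a|.
  rewrite -sl; elim: (l) => [|a l' IH]; first by rewrite !big_nil expr0 mulr1.
  by rewrite !big_cons IH /= exprS; ring.
have -> : 4 ^+ p = 2 ^+ p * 2 ^+ p :> R by rewrite -exprMn -natrM.
have rp : r ^+ p != 0 by rewrite expf_neq0// gt_eqF.
by rewrite !exprMn exprVn; field.
Qed.

End boman.

(** * Differential calculus for bounded difference quotients *)

Section calculus_bounded_differences.
Variables (R : realType) (V : normedModType R).
Local Notation C := (Rcomplex R).
Implicit Types (f g : V -> C) (U : set V) (l : seq V).

Lemma eq_ler (x y : R) : x = y -> x <= y.
Proof. by move=> ->. Qed.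

Lemma hausdorffC : hausdorff_space C.
Proof. exact: norm_hausdorff. Qed.

Lemma cvg_norm_le (q : R -> C) (a : C) (B : R) :
  q h @[h --> (0 : R)^'] --> a -> (\forall h \near (0 : R)^', `|q h| <= B) ->
  `|a| <= B.
Proof.
move=> qa qB; apply/ler_addgt0Pr => e e0; move/cvgrPdist_lt/(_ e e0) : qa => qa.
near (0 : R)^' => h; rewrite -(subrK (q h) a) addrC.
apply: le_trans (ler_normD _ _) _; apply: lerD; first by near: h.
by apply/ltW; near: h.
Unshelve. all: by end_near. Qed.

Lemma mdiff2 a b f y : mdiff [:: a; b] f y = f (y + b + a) - f (y + b) - (f (y + a) - f y).
Proof. by []. Qed.

(** The increment of f along v is almost additive, so that its difference quotients
    form a Cauchy family. *)
Lemma second_diff_hasd f y v (d K K1 : R) : 0 < d -> 0 <= K -> 0 <= K1 ->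
  (forall s t, `|s| <= d -> `|t| <= d ->
    `|mdiff [:: s *: v; t *: v] f y| <= K * `|s| * `|t|) ->
  (forall s, `|s| <= d -> `|f (s *: v + y) - f y| <= K1 * `|s|) ->
  exists2 l : C, hasd f y v l & forall h, 0 < `|h| <= d ->
    `|h^-1 *: (f (h *: v + y) - f y) - l| <= 2 * K * `|h|.
Proof.
move=> d0 K0 K10 H2 H1; pose phi s := f (s *: v + y) - f y.
have qa := @quasi_additive R phi d K K1 d0 K0 K10.
have {}qa h k : 0 < `|h| <= d -> 0 < `|k| <= d ->
    `|h^-1 *: phi h - k^-1 *: phi k| <= 2 * K * (`|h| + `|k|).
  apply: qa => // s t sd td.
  have := H2 s t sd td; rewrite mdiff2; congr (`|_| <= _).
  have -> : y + t *: v + s *: v = (s + t) *: v + y.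
    by rewrite scalerDl addrC [y + _]addrC addrA.
  by rewrite /phi [y + t *: v]addrC [y + s *: v]addrC; ring.
have [l ql] : exists l : C, h^-1 *: phi h @[h --> (0 : R)^'] --> l.
  apply: (@cauchy_complex R _ d (2 * K) d0); first exact: mulr_ge0.
  by move=> h k /andP[h0 /ltW hd] /andP[k0 /ltW kd]; apply: qa; rewrite ?h0 ?k0.
exists l => // h hd; apply/ler_addgt0Pr => e e0.
rewrite -/(phi h).
have e20 : 0 < e / 2 by rewrite divr_gt0.
move/cvgrPdist_lt/(_ _ e20) : ql => ql.
have K1p : 0 < 2 * K + 1 by rewrite ltr_wpDl// mulr_ge0.
near (0 : R)^' => k.
have k0 : 0 < `|k| by rewrite normr_gt0; near: k; exact: nbhs_dnbhs_neq.
have kd : `|k| <= d by apply/ltW; near: k; exact: dnbhs0_lt.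
have ke : `|k| < e / 2 / (2 * K + 1) by near: k; apply: dnbhs0_lt; rewrite divr_gt0.
have qk : `|l - k^-1 *: phi k| < e / 2 by near: k.
have -> : h^-1 *: phi h - l = (h^-1 *: phi h - k^-1 *: phi k) - (l - k^-1 *: phi k) by ring.
apply: le_trans (ler_normB _ _) _.
have := qa h k hd; rewrite k0 kd => /(_ isT) H.
apply: le_trans (lerD H (ltW qk)) _.
rewrite mulrDr -addrA lerD2l [leRHS](splitr e) lerD2r.
rewrite ltr_pdivlMr// in ke; apply/ltW; apply: le_lt_trans ke.
by rewrite mulrC ler_wpM2l// lerDl.
Unshelve. all: by end_near. Qed.

Section open_domain.
Variable U : set V.
Hypothesis oU : open U.

Lemma diff_bounded_upto f x p : diff_bounded U f -> U x ->
  exists d K : R, [/\ 0 < d, 0 <= K, forall y, `|y - x| <= d -> U y &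
    forall y l, `|y - x| <= d -> (size l <= p)%N ->
      (forall a, a \in l -> `|a| <= d) -> `|mdiff l f y| <= K * \prod_(a <- l) `|a|].
Proof.
move=> bf Ux; have [r r0 rU] : exists2 d : R, 0 < d & forall y, `|y - x| <= d -> U y.
  by apply: nbhs_closed_ball; exact: open_nbhs_nbhs.
elim: p => [|p [d [K [d0 K0 dU IH]]]].
  have [d [K [d0 K0 H]]] := bf x Ux 0%N.
  exists (Num.min d r), K; split=> //; first by rewrite lt_min d0.
    by move=> y; rewrite le_min => /andP[_ /rU].
  move=> y l; rewrite le_min leqn0 => /andP[yd _] /eqP sl ld; apply: H => // a al.
  by apply: le_trans (ld a al) _; rewrite ge_min lexx.
have [d' [K' [d'0 K'0 H]]] := bf x Ux p.+1.
exists (Num.min d d'), (K + K'); split=> //; first by rewrite lt_min d0.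
- exact: addr_ge0.
- by move=> y; rewrite le_min => /andP[/dU].
move=> y l; rewrite le_min leq_eqVlt ltnS => /andP[yd yd'] sl ld.
have ldd a : a \in l -> `|a| <= d.
  by move=> /ld /le_trans; apply; rewrite ge_min lexx.
have ldd' a : a \in l -> `|a| <= d'.
  by move=> /ld /le_trans; apply; rewrite ge_min lexx orbT.
have P0 : 0 <= \prod_(a <- l) `|a| by rewrite prodr_ge0.
case/orP: sl => [/eqP sl|sl].
  by apply: le_trans (H y l yd' sl ldd') _; rewrite ler_wpM2r// lerDr.
by apply: le_trans (IH y l yd sl ldd) _; rewrite ler_wpM2r// lerDl.
Qed.

Lemma first_order_hasd f x : diff_bounded U f -> U x ->
  exists d K : R, [/\ 0 < d, 0 <= K, forall y, `|y - x| <= d -> U y &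
    forall y v, `|y - x| <= d -> `|v| <= d -> exists l : C,
      [/\ hasd f y v l, `|f (y + v) - f y - l| <= K * `|v| ^+ 2 & `|l| <= K * `|v|]].
Proof.
move=> bf Ux; have [d [K [d0 K0 dU H]]] := diff_bounded_upto 2 bf Ux.
exists d, (2 * K + 2 * K * d + K); split=> //.
  by rewrite !addr_ge0// !mulr_ge0// ltW.
move=> y v yx vd.
have sv s : `|s| <= 1 -> `|s *: v| <= d.
  by move=> s1; rewrite normrZ; apply: le_trans vd; rewrite ler_piMl.
have lip s : `|s| <= 1 -> `|f (s *: v + y) - f y| <= K * `|v| * `|s|.
  move=> s1; have := H y [:: s *: v] yx isT.
  rewrite big_seq1 /mdiff/= /fdiff [y + _]addrC normrZ -mulrA [`|v| * _]mulrC; apply.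
  by move=> a; rewrite inE => /eqP ->; exact: sv.
have [| | |s t s1 t1||l fl fe] := @second_diff_hasd f y v 1 (K * `|v| ^+ 2) (K * `|v|).
- by [].
- by rewrite mulr_ge0// exprn_ge0.
- exact: mulr_ge0.
- have := H y [:: s *: v; t *: v] yx isT; rewrite big_cons big_seq1 !normrZ.
  have -> : K * `|v| ^+ 2 * `|s| * `|t| = K * (`|s| * `|v| * (`|t| * `|v|)) by ring.
  by apply=> a; rewrite !inE => /orP[] /eqP ->; exact: sv.
- exact: lip.
have e1 : `|f (y + v) - f y - l| <= 2 * (K * `|v| ^+ 2).
  have := fe 1; rewrite normr1 ltr01 lexx => /(_ isT).
  by rewrite invr1 !scale1r mulr1 [v + y]addrC.
exists l; split=> //.
  apply: le_trans e1 _; rewrite mulrA ler_wpM2r ?exprn_ge0//.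
  by rewrite -addrA lerDl addr_ge0// !mulr_ge0// ltW.
have -> : l = (f (y + v) - f y) - (f (y + v) - f y - l) by ring.
apply: le_trans (ler_normB _ _) _.
have := lip 1; rewrite normr1 mulr1 scale1r [v + y]addrC => /(_ (lexx _)) e2.
apply: le_trans (lerD e2 e1) _.
have F : `|v| ^+ 2 <= d * `|v| by rewrite expr2 ler_wpM2r.
have {}F : 2 * K * `|v| ^+ 2 <= 2 * K * (d * `|v|) by rewrite ler_wpM2l// mulr_ge0.
have : 0 <= 2 * K * `|v| by rewrite !mulr_ge0.
by lra.
Qed.

Lemma diff_bounded_hasd f x v : diff_bounded U f -> U x ->
  hasd f x v (tderive f x v).
Proof.
move=> bf Ux; apply: hasd_tderive.
have [d [K [d0 _ _ H]]] := first_order_hasd bf Ux.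
have v1 : 0 < `|v| + 1 by rewrite ltr_wpDl.
pose c := d / (`|v| + 1); have c0 : 0 < c by rewrite divr_gt0.
have [||l [fl _ _]] := H x (c *: v).
- by rewrite subrr normr0 ltW.
- by rewrite normrZ gtr0_norm// /c mulrAC ler_pdivrMr// ler_pM2l// lerDl.
exists (c^-1 *: l); have := hasd_dirZ (c := c^-1) fl.
by rewrite scalerA mulVf ?scale1r// gt_eqF.
Qed.

Lemma first_order f x : diff_bounded U f -> U x ->
  exists d K : R, [/\ 0 < d, 0 <= K, forall y, `|y - x| <= d -> U y &
    forall y v, `|y - x| <= d -> `|v| <= d ->
      `|f (y + v) - f y - tderive f y v| <= K * `|v| ^+ 2 /\
      `|tderive f y v| <= K * `|v|].
Proof.
move=> bf Ux; have [d [K [d0 K0 dU H]]] := first_order_hasd bf Ux.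
exists d, K; split=> // y v yd vd; have [l [fl l1 l2]] := H y v yd vd.
by rewrite (tderive_hasd hausdorffC fl).
Qed.

Lemma mdiff_cvg (F : R -> V -> C) f l y :
  (forall z, `|z - y| <= \sum_(a <- l) `|a| -> F h z @[h --> (0 : R)^'] --> f z) ->
  mdiff l (F h) y @[h --> (0 : R)^'] --> mdiff l f y.
Proof.
elim: l y => [|a l IH] y H.
  by apply: H; rewrite subrr normr0 big_nil.
under eq_fun do rewrite mdiff_consE; rewrite mdiff_consE.
apply: cvgB; apply: IH => z zy; apply: H; rewrite big_cons.
  have -> : z - y = a + (z - (y + a)) by rewrite [RHS]addrC opprD addrA subrK.
  by apply: le_trans (ler_normD _ _) _; rewrite lerD2l.
by apply: le_trans zy _; rewrite lerDr.
Qed.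

(** A difference of order p of the difference quotients of f is a difference of
    order p + 1 of f, divided by the increment. *)
Lemma diff_bounded_tderive f v : diff_bounded U f ->
  diff_bounded U (fun x => tderive f x v).
Proof.
move=> bf x Ux p; have [d [K [d0 K0 dU H]]] := diff_bounded_upto p.+1 bf Ux.
have p0 : 0 < p.+1%:R :> R by [].
exists (d / p.+1%:R), (K * `|v|); split; [exact: divr_gt0|exact: mulr_ge0|].
move=> y l yx sl ld.
have dp : d / p.+1%:R <= d.
  by rewrite ler_pdivrMr//; apply: ler_peMr; [exact: ltW|rewrite ler1n].
have suml : \sum_(a <- l) `|a| <= p%:R * (d / p.+1%:R).
  rewrite -{1}sl; move: (d / _) ld => r.
  elim: (l) => [_|a l' IH ld]; first by rewrite big_nil mul0r.
  rewrite big_cons /= -nat1r mulrDl mul1r; apply: lerD; first by apply: ld; rewrite mem_head.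
  by apply: IH => b bl; apply: ld; rewrite in_cons bl orbT.
apply: (@cvg_norm_le (fun h => mdiff l (fun z => h^-1 *: (f (h *: v + z) - f z)) y)).
  apply: mdiff_cvg => z zy; apply: diff_bounded_hasd => //; apply: dU.
  have -> : z - x = (y - x) + (z - y) by rewrite [RHS]addrC addrA subrK.
  apply: le_trans (ler_normD _ _) (le_trans (lerD yx (le_trans zy suml)) _).
  by rewrite -{1}[d / _]mul1r -mulrDl nat1r mulrC mulfVK// gt_eqF.
near=> h; have h0 : h != 0 by near: h; exact: nbhs_dnbhs_neq.
have hv : `|h *: v| <= d.
  have : `|h| <= d / (`|v| + 1).
    by apply/ltW; near: h; apply: dnbhs0_lt; rewrite divr_gt0// ltr_wpDl.
  rewrite ler_pdivlMr ?ltr_wpDl// normrZ; apply: le_trans.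
  by rewrite ler_wpM2l// lerDl.
rewrite mdiffZ normrZ normfV ler_pdivrMl ?normr_gt0//.
have -> : (fun z => f (h *: v + z) - f z) = fdiff (h *: v) f.
  by apply/funext => z; rewrite /fdiff [z + _]addrC.
rewrite -mdiff_cons; apply: le_trans (H _ _ _ _ _) _.
- exact: le_trans yx dp.
- by rewrite /= sl.
- move=> a; rewrite in_cons => /orP[/eqP -> //|/ld]; move/le_trans; exact.
by rewrite big_cons normrZ; apply: eq_ler; rewrite -!mulrA mulrCA.
Unshelve. all: by end_near. Qed.

Lemma near_scaled_le (v : V) (d : R) : 0 < d -> \forall h \near (0 : R)^', `|h *: v| <= d.
Proof.
move=> d0; near=> h; have : `|h| <= d / (`|v| + 1).
  by apply/ltW; near: h; apply: dnbhs0_lt; rewrite divr_gt0// ltr_wpDl.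
rewrite ler_pdivlMr ?ltr_wpDl// normrZ; apply: le_trans.
by rewrite ler_wpM2l// lerDl.
Unshelve. all: by end_near. Qed.

Lemma cvg0_bound (q : R -> C) (K : R) :
  (\forall h \near (0 : R)^', `|q h| <= K * `|h|) -> q h @[h --> (0 : R)^'] --> (0 : C).
Proof.
move=> qK; apply/cvgrPdist_lt => e e0; near=> h; rewrite sub0r normrN.
have K1 : 0 < `|K| + 1 by rewrite ltr_wpDl.
have he : `|h| < e / (`|K| + 1) by near: h; apply: dnbhs0_lt; rewrite divr_gt0.
rewrite ltr_pdivlMr// in he; apply: le_lt_trans he.
have : `|q h| <= K * `|h| by near: h.
move/le_trans; apply; rewrite mulrC ler_wpM2l//.
by apply: le_trans (ler_norm K) _; rewrite lerDl.
Unshelve. all: by end_near. Qed.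

(** The defect of additivity of the increments is a second difference. *)
Lemma tderiveD f x v w : diff_bounded U f -> U x ->
  tderive f x (v + w) = tderive f x v + tderive f x w.
Proof.
move=> bf Ux; apply: tderive_hasd; first exact: hausdorffC.
have Dv := diff_bounded_hasd (v := v) bf Ux; have Dw := diff_bounded_hasd (v := w) bf Ux.
have [d [K [d0 K0 dU H]]] := diff_bounded_upto 2 bf Ux.
have E : h^-1 *: mdiff [:: h *: v; h *: w] f x @[h --> (0 : R)^'] --> (0 : C).
  apply: (@cvg0_bound _ (K * `|v| * `|w|)).
  near=> h; have h0 : h != 0 by near: h; exact: nbhs_dnbhs_neq.
  rewrite normrZ normfV ler_pdivrMl ?normr_gt0//.
  apply: le_trans (H x [:: h *: v; h *: w] _ isT _) _.
  - by rewrite subrr normr0 ltW.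
  - move=> a; rewrite !inE => /orP[] /eqP ->.
      by near: h; exact: near_scaled_le.
    by near: h; exact: near_scaled_le.
  by rewrite big_cons big_seq1 !normrZ; apply: eq_ler; ring.
rewrite -[X in hasd _ _ _ X]addr0.
apply: (cvg_trans _ (cvgD (cvgD Dv Dw) E)); apply: near_eq_cvg; apply: nearW => h /=.
rewrite !fctE -!scalerDr; congr (_ *: _); rewrite /fdiff.
have -> : x + h *: w + h *: v = h *: (v + w) + x.
  by rewrite scalerDr addrC [x + _]addrC addrA.
by rewrite [x + h *: w]addrC [x + h *: v]addrC; ring.
Unshelve. all: by end_near. Qed.

Lemma tderiveZ f x (a : R) v : diff_bounded U f -> U x ->
  tderive f x (a *: v) = a *: tderive f x v.
Proof.
move=> bf Ux; apply: tderive_hasd; first exact: hausdorffC.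
by apply: hasd_dirZ; exact: diff_bounded_hasd.
Qed.

(** Only second differences, symmetric in v and w, enter on the left, whence the
    symmetry of second derivatives. *)
Lemma mixed_derivative_lim f x v w : diff_bounded U f -> U x ->
  (h^-1 * h^-1) *: mdiff [:: h *: w; h *: v] f x @[h --> (0 : R)^'] -->
    tderive (fun y => tderive f y v) x w.
Proof.
move=> bf Ux; have bg := diff_bounded_tderive v bf.
have [d [K [d0 K0 dU H]]] := diff_bounded_upto 3 bf Ux.
have Dw := diff_bounded_hasd (v := w) bg Ux.
rewrite -[X in _ --> X]addr0.
have v1 : 0 < `|v| + 1 by rewrite ltr_wpDl.
pose dd := d / (`|v| + 1); have dd0 : 0 < dd by rewrite divr_gt0.
have sv s : `|s| <= dd -> `|s *: v| <= d.
  rewrite ler_pdivlMr// normrZ; apply: le_trans.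
  by rewrite ler_wpM2l// lerDl.
have xx : `|x - x| <= d by rewrite subrr normr0 ltW.
have E : (h^-1 * h^-1) *: mdiff [:: h *: w; h *: v] f x -
    h^-1 *: (tderive f (h *: w + x) v - tderive f x v) @[h --> (0 : R)^'] --> (0 : C).
  apply: (@cvg0_bound _ (2 * (K * `|w| * `|v| ^+ 2))); near=> h.
  have h0 : h != 0 by near: h; exact: nbhs_dnbhs_neq.
  have hd : `|h| <= dd by apply/ltW; near: h; exact: dnbhs0_lt.
  have hw : `|h *: w| <= d by near: h; exact: near_scaled_le.
  have Uh : U (h *: w + x) by apply: dU; rewrite addrK.
  pose G := fdiff (h *: w) f.
  have [| |s t sd td|s sd|l Gl Ge] := @second_diff_hasd G x v dd
      (K * `|h *: w| * `|v| ^+ 2) (K * `|h *: w| * `|v|) dd0.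
  - by rewrite !mulr_ge0.
  - by rewrite mulr_ge0// mulr_ge0.
  - rewrite -mdiff_cons.
    apply: le_trans (H x [:: h *: w; s *: v; t *: v] xx isT _) _.
      by move=> a; rewrite !inE => /or3P[] /eqP -> //; exact: sv.
    by rewrite !big_cons big_nil !(normrZ _ v); apply: eq_ler; ring.
  - have := H x [:: h *: w; s *: v] xx isT.
    rewrite big_cons big_seq1 (normrZ _ v).
    rewrite mdiff_cons -/G /mdiff/= /fdiff [x + _]addrC.
    have -> : K * (`|h *: w| * (`|s| * `|v|)) = K * `|h *: w| * `|v| * `|s| by ring.
    by apply=> a; rewrite !inE => /orP[] /eqP -> //; exact: sv.
  have lE : l = tderive f (h *: w + x) v - tderive f x v.
    rewrite -(tderive_hasd hausdorffC Gl); apply: tderive_hasd; first exact: hausdorffC.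
    rewrite /G /fdiff; apply: hasdD; last by apply/hasdN/diff_bounded_hasd.
    have := diff_bounded_hasd (v := v) bf Uh; rewrite /hasd [h *: w + x]addrC.
    by under eq_fun => k do rewrite addrA.
  rewrite -lE -scalerA -scalerBr normrZ normfV ler_pdivrMl ?normr_gt0//.
  have -> : mdiff [:: h *: w; h *: v] f x = G (h *: v + x) - G x.
    by rewrite mdiff_cons -/G /mdiff/= {1}/fdiff [x + _]addrC.
  have := Ge h; rewrite normr_gt0 h0 hd => /(_ isT) /le_trans; apply.
  by rewrite normrZ; apply: eq_ler; ring.
apply: (cvg_trans _ (cvgD Dw E)); apply: near_eq_cvg; apply: nearW => h /=.
by rewrite addrC subrK.
Unshelve. all: by end_near. Qed.

Lemma tderiveC f x v w : diff_bounded U f -> U x ->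
  tderive (fun y => tderive f y v) x w = tderive (fun y => tderive f y w) x v.
Proof.
move=> bf Ux; have H1 := mixed_derivative_lim (v := v) (w := w) bf Ux.
have := mixed_derivative_lim (v := w) (w := v) bf Ux.
rewrite (_ : (fun h => _) = (fun h => (h^-1 * h^-1) *: mdiff [:: h *: w; h *: v] f x)).
  by move=> H2; apply: cvg_unique H1 H2; exact: hausdorffC.
by apply/funext => h; rewrite !mdiff2 [x + _ + h *: v]addrAC; congr (_ *: _); ring.
Qed.

End open_domain.
End calculus_bounded_differences.

Section iterated_derivatives.
Variables (R : realType) (V : normedModType R).
Local Notation C := (Rcomplex R).
Implicit Types (f g : V -> C) (l : seq V).

Definition dlist (W : lmodType R) (l : seq W) (f : W -> C) : W -> C :=
  foldr (fun v k x => tderive k x v) f l.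

(** An affine map, here j with linear part J, carries difference quotients to difference
    quotients. *)
Lemma dlist_affine (W W' : lmodType R) (j : W -> W') (J : W -> W') (f : W' -> C)
    (l : seq W) x :
  (forall (h : R) v x, j (h *: v + x) = h *: J v + j x) ->
  dlist l (fun x => f (j x)) x = dlist (map J l) f (j x).
Proof.
move=> jJ; elim: l x => //= v l IH x; apply: tderive_quot => h.
by rewrite IH jJ.
Qed.

Lemma dlist_cat l1 l2 f : dlist (l1 ++ l2) f = dlist l1 (dlist l2 f).
Proof. by rewrite /dlist foldr_cat. Qed.

Section open_domain.
Variable U : set V.
Hypothesis oU : open U.

Lemma near_open x (P : V -> Prop) : U x -> (forall y, U y -> P y) -> \forall y \near x, P y.
Proof. by move=> Ux UP; apply: filterS UP _; exact: open_nbhs_nbhs. Qed.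

Lemma dlist_bounded l f : diff_bounded U f -> diff_bounded U (dlist l f).
Proof. by move=> bf; elim: l => //= v l IH; exact: diff_bounded_tderive. Qed.

Lemma dlist_eq_on l f g : (forall x, U x -> f x = g x) ->
  forall x, U x -> dlist l f x = dlist l g x.
Proof.
move=> fg; elim: l => //= v l IH x Ux; apply: tderive_local; exact: near_open.
Qed.

Lemma dlist_lin l f g (a : R) x : diff_bounded U f -> diff_bounded U g -> U x ->
  dlist l (fun x => f x + a *: g x) x = dlist l f x + a *: dlist l g x.
Proof.
move=> bf bg; elim: l x => //= v l IH x Ux.
rewrite (tderive_local (g := fun x => dlist l f x + a *: dlist l g x)); last exact: near_open.
apply: tderive_hasd; first exact: hausdorffC.
apply: hasdD; first by apply: diff_bounded_hasd Ux => //; exact: dlist_bounded.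
apply: hasdZ; apply: (diff_bounded_hasd (U := U)) => //; exact: dlist_bounded.
Qed.

Lemma dlist_swap v l f x : diff_bounded U f -> U x ->
  dlist (v :: l) f x = dlist (rcons l v) f x.
Proof.
move=> bf; elim: l x => //= w l IH x Ux.
rewrite (tderiveC oU w v (dlist_bounded l bf) Ux).
by apply: tderive_local; exact: near_open.
Qed.

Lemma dlist_mid v l1 l2 f x : diff_bounded U f -> U x ->
  dlist (v :: l1 ++ l2) f x = dlist (l1 ++ v :: l2) f x.
Proof.
move=> bf Ux; rewrite -cat_cons dlist_cat dlist_swap//; last exact: dlist_bounded.
by rewrite -dlist_cat cat_rcons.
Qed.

Lemma dlist_perm l l' f x : perm_eq l l' -> diff_bounded U f -> U x ->
  dlist l f x = dlist l' f x.
Proof.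
move=> + bf; elim: l l' x => [|v l IH] l' x pl Ux.
  by have /perm_nilP -> : perm_eq l' [::] by rewrite perm_sym.
have vl' : v \in l' by rewrite -(perm_mem pl) mem_head.
case/splitPr: vl' pl => l1 l2; rewrite perm_sym perm_catC /= perm_cons perm_catC perm_sym => pl.
rewrite -dlist_mid//=; apply: tderive_local; apply: near_open Ux _ => y Uy; exact: IH.
Qed.

(** The derivative of f is continuous in the direction by the bound of first order,
    and the remainder is quadratic. *)
Lemma hasd_chain f (c : R -> V) t (c' : V) : diff_bounded U f -> U (c t) ->
  hasd c t 1 c' -> hasd (fun u => f (c u)) t 1 (tderive f (c t) c').
Proof.
move=> bf Uc cc'; have [d [K [d0 K0 dU H]]] := first_order oU bf Uc.
pose D v := tderive f (c t) v.
have xx : `|c t - c t| <= d by rewrite subrr normr0 ltW.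
have DK v : `|D v| <= K * `|v|.
  have v1 : 0 < `|v| + 1 by rewrite ltr_wpDl.
  pose a := d / (`|v| + 1); have a0 : 0 < a by rewrite divr_gt0.
  have av : `|a *: v| <= d by rewrite normrZ gtr0_norm// /a mulrAC ler_pdivrMr// ler_pM2l// lerDl.
  have [_] := H (c t) (a *: v) xx av.
  have E : `|a *: D v| = a * `|D v| by rewrite normrZ gtr0_norm.
  have E' : `|a *: v| = a * `|v| by rewrite normrZ gtr0_norm.
  by rewrite (tderiveZ oU)// E E' mulrCA ler_pM2l.
have Dlin v w a : D (a *: v - w) = a *: D v - D w.
  by rewrite /D (tderiveD oU)// (tderiveZ oU)// -scaleN1r (tderiveZ oU)// scaleN1r.
pose q h := h^-1 *: (c (h *: 1 + t) - c t).
have qc : q h @[h --> (0 : R)^'] --> c' by exact: cc'.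
have E1 : D (q h - c') @[h --> (0 : R)^'] --> (0 : C).
  apply/cvgrPdist_lt => e e0; rewrite /=.
  have K1 : 0 < K + 1 by rewrite ltr_wpDl.
  have eK : 0 < e / (K + 1) by rewrite divr_gt0.
  move/cvgrPdist_lt/(_ _ eK) : qc; apply: filterS => h.
  rewrite sub0r normrN distrC ltr_pdivlMr// => qe; apply: le_lt_trans (DK _) _.
  by apply: le_lt_trans qe; rewrite mulrC ler_wpM2l// lerDl.
have cd : \forall h \near (0 : R)^', `|c (h *: 1 + t) - c t| <= d.
  have := hasd_cvg cc' => /cvgrPdist_lt/(_ d d0); apply: filterS => h.
  by rewrite distrC => /ltW.
have qb : \forall h \near (0 : R)^', `|q h| <= `|c'| + 1.
  move/cvgrPdist_lt/(_ _ ltr01) : qc; apply: filterS => h /ltW.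
  rewrite distrC => qh; rewrite -(subrK c' (q h)) addrC.
  by apply: le_trans (ler_normD _ _) _; rewrite lerD2l.
have E2 : h^-1 *: (f (c (h *: 1 + t)) - f (c t) - D (c (h *: 1 + t) - c t))
    @[h --> (0 : R)^'] --> (0 : C).
  apply: (@cvg0_bound _ _ (K * (`|c'| + 1) ^+ 2)); near=> h.
  have h0 : h != 0 by near: h; exact: nbhs_dnbhs_neq.
  have hd : `|c (h *: 1 + t) - c t| <= d by near: h.
  have [+ _] := H (c t) _ xx hd; rewrite [c t + _]addrC subrK => Hh.
  rewrite normrZ normfV ler_pdivrMl ?normr_gt0//; apply: le_trans Hh _.
  have -> : c (h *: 1 + t) - c t = h *: q h by rewrite scalerA mulfV// scale1r.
  have qh : `|q h| <= `|c'| + 1 by near: h.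
  move: (q h) qh => z qz.
  have zz : `|z| ^+ 2 <= (`|c'| + 1) ^+ 2 by rewrite !expr2 ler_pM.
  rewrite normrZ exprMn.
  have : K * (`|h| ^+ 2 * `|z| ^+ 2) <= K * (`|h| ^+ 2 * (`|c'| + 1) ^+ 2).
    by apply: ler_wpM2l => //; apply: ler_wpM2l zz; exact: exprn_ge0.
  by move/le_trans; apply; apply: eq_ler; ring.
rewrite -[X in hasd _ _ _ X]addr0 -[X in hasd _ _ _ (_ + X)]addr0.
apply: (cvg_trans _ (cvgD (cvg_cst (D c')) (cvgD E1 E2))).
apply: near_eq_cvg; apply: nearW => h /=.
rewrite !fctE.
have -> : D (q h - c') = h^-1 *: D (c (h *: 1 + t) - c t) - D c' by rewrite Dlin.
by rewrite [RHS](_ : _ = h^-1 *: (f (c (h *: 1 + t)) - f (c t)))//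
  [h^-1 *: (_ - D _)]scalerBr; ring.
Unshelve. all: by end_near. Qed.

(** Landau's inequality: a small function with bounded second derivative has a small
    first derivative. The mean value inequality is applied to the first derivative
    and to f(x + t v) - t D_v f(x). *)
Lemma landau f v x (A B h : R) : diff_bounded U f -> 0 < h ->
  (forall t, 0 <= t <= h -> U (t *: v + x)) ->
  (forall t, 0 <= t <= h -> `|f (t *: v + x)| <= A) ->
  (forall t, 0 <= t <= h -> `|dlist [:: v; v] f (t *: v + x)| <= B) ->
  `|tderive f x v| <= 2 * A / h + 4 * B * h.
Proof.
move=> bf h0 sU fA fB; have hh : 0 <= h <= h by rewrite ltW/=.
have h00 : 0 <= (0 : R) <= h by rewrite lexx ltW.
have bD := diff_bounded_tderive oU v bf.
pose g t := f (t *: v + x); pose g' t := tderive f (t *: v + x) v.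
have gd t : 0 <= t <= h -> hasd g t 1 (g' t).
  by move=> /sU Ut; rewrite /g'; apply: (hasd_along (f := f)); exact: (diff_bounded_hasd oU).
have gd' t : 0 <= t <= h -> hasd g' t 1 (dlist [:: v; v] f (t *: v + x)).
  by move=> /sU Ut; apply: (hasd_along (f := fun y => tderive f y v)); exact: (diff_bounded_hasd oU).
have g0 : g' 0 = tderive f x v by rewrite /g' scale0r add0r.
have B0 : 0 <= B by apply: le_trans (fB 0 h00).
have H1 t : 0 <= t <= h -> `|g' t - g' 0| <= 2 * B * h.
  move=> /andP[t0 th]; apply: le_trans (mean_value t0 _ _) _.
  - by move=> u /andP[u0 ut]; apply: gd'; rewrite u0 (le_trans ut).
  - by move=> u /andP[u0 ut]; apply: fB; rewrite u0 (le_trans ut).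
  by rewrite subr0 ler_wpM2l// mulr_ge0.
pose k t := g t - t *: g' 0; pose k' t := g' t - g' 0.
have : `|k h - k 0| <= 2 * (2 * B * h) * (h - 0).
  apply: (mean_value (g' := k')) (ltW h0) _ H1 => t th.
  apply: hasdD; first exact: gd.
  have := hasdN (hasdM (hasd_id t) (hasd_cst (g' 0) t 1)).
  by rewrite scale1r scaler0 addr0.
rewrite /k scale0r !subr0 => H2; rewrite -g0.
have : `|h *: g' 0| <= A + A + 2 * (2 * B * h) * h.
  have -> : h *: g' 0 = g h - g 0 - (g h - h *: g' 0 - g 0) by ring.
  apply: le_trans (ler_normB _ _) _; apply: lerD => //.
  by apply: le_trans (ler_normB _ _) _; apply: lerD; exact: fA.
rewrite normrZ gtr0_norm// => H3.
rewrite -(ler_pM2l h0) mulrDr; apply: le_trans H3 _.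
by apply: eq_ler; field; rewrite gt_eqF.
Qed.

(** w = v + a1 t1 + ... + ak tk for some ai in [0, 1]. *)
Fixpoint reach (v : V) (ts : seq V) (w : V) : Prop :=
  if ts is t :: ts' then exists2 a : R, 0 <= a <= 1 & reach (v + a *: t) ts' w
  else w = v.

(** The m-th derivative in the direction v + a t is a polynomial in a, whose linear
    coefficient contains the mixed derivative in t and m - 1 times v. *)
Lemma dlist_poly m f v t x : diff_bounded U f -> U x -> exists c : nat -> C,
  [/\ forall a : R, dlist (nseq m (v + a *: t)) f x = \sum_(j < m.+1) a ^+ j *: c j,
      c 0%N = dlist (nseq m v) f x &
      (0 < m)%N -> c 1%N = m%:R *: dlist (nseq m.-1 v) (fun y => tderive f y t) x].
Proof.
elim: m f => [|m IH] f bf Ux.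
  by exists (fun=> f x); split=> // a; rewrite big_ord1 expr0 scale1r.
have bv := diff_bounded_tderive oU v bf; have bt := diff_bounded_tderive oU t bf.
have [c [cE c0 c1]] := IH _ bv Ux; have [b [bE b0 b1]] := IH _ bt Ux.
pose e j : C := (if (j <= m)%N then c j else 0) + (if j is j'.+1 then b j' else 0).
have rc w : dlist (nseq m.+1 w) f = dlist (nseq m w) (fun y => tderive f y w).
  by rewrite -[m.+1]addn1 nseqD dlist_cat.
exists e; split=> [a||_].
- rewrite rc.
  rewrite (@dlist_eq_on _ _ (fun y => tderive f y v + a *: tderive f y t))//; last first.
    by move=> y Uy; rewrite (tderiveD oU)// (tderiveZ oU).
  rewrite dlist_lin// cE bE.
  under [RHS]eq_bigr do rewrite scalerDr.
  rewrite big_split/=; congr (_ + _).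
    rewrite [RHS]big_ord_recr/= ltnn scaler0 addr0; apply: eq_bigr => j _.
    by rewrite -ltnS ltn_ord.
  rewrite [RHS]big_ord_recl scaler0 add0r scaler_sumr; apply: eq_bigr => j _ /=.
  by rewrite scalerA exprS.
- by rewrite rc -c0 /e addr0.
rewrite /e b0 /=; case: (m) c1 IH b0 rc {cE c0 bE b1 e} => [|n] c1 _ b0 rc.
  by rewrite add0r scale1r.
rewrite c1//= -[n.+2%:R]natr1 scalerDl scale1r; congr (_ *: _ + _).
transitivity (dlist (nseq n v) (fun y => tderive (fun y => tderive f y t) y v) x).
  by apply: dlist_eq_on Ux => y Uy; exact: (tderiveC oU _ _ bf Uy).
transitivity (dlist (nseq n.+1 v) (fun y => tderive f y t) x) => //.
by rewrite -[n.+1]addn1 nseqD dlist_cat.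
Qed.

End open_domain.
End iterated_derivatives.

(** * Extracting mixed derivatives from pure ones *)

Section extraction.
Variable R : realType.
Local Notation C := (Rcomplex R).

(** The difference c(a) - 2^m c(a / 2) eliminates the leading coefficient and
    preserves the linear one up to a factor of absolute value at least 1. *)
Lemma poly_coef1_bound (m : nat) : (0 < m)%N -> exists2 K : R, 0 <= K &
  forall (c : nat -> C) (M : R),
    (forall a : R, 0 <= a <= 1 -> `|\sum_(j < m.+1) a ^+ j *: c j| <= M) ->
    `|c 1%N| <= K * M.
Proof.
elim: m => // -[_ _|m IH _].
  exists 2 => // c M H.
  have -> : c 1%N = \sum_(j < 2) 1 ^+ j *: c j - \sum_(j < 2) 0 ^+ j *: c j.
    by rewrite !big_ord_recr !big_ord0 /= !expr1n !expr0 !expr1 scale0r !scale1r; ring.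
  apply: le_trans (ler_normB _ _) _; rewrite mulr_natl mulr2n.
  by apply: lerD; apply: H; rewrite ?lexx ?ler01.
have [//|K K0 H] := IH; exists (K * (1 + 2 ^+ m.+2)).
  by rewrite mulr_ge0// addr_ge0// exprn_ge0.
move=> c M cM.
pose b j : C := (1 - 2 ^+ (m.+2 - j)) *: c j.
have : `|b 1%N| <= K * ((1 + 2 ^+ m.+2) * M).
  apply: H => a /andP[a0 a1].
  have -> : \sum_(j < m.+2) a ^+ j *: b j = \sum_(j < m.+3) a ^+ j *: c j -
      2 ^+ m.+2 *: \sum_(j < m.+3) (a / 2) ^+ j *: c j.
    rewrite scaler_sumr -sumrB [RHS]big_ord_recr/=.
    have -> : a ^+ m.+2 *: c m.+2 - 2 ^+ m.+2 *: ((a / 2) ^+ m.+2 *: c m.+2) = 0.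
      have p2 : 2 ^+ m.+2 != 0 :> R by rewrite expf_neq0// pnatr_eq0.
      by rewrite scalerA exprMn exprVn mulrCA mulfV// mulr1 subrr.
    rewrite addr0; apply: eq_bigr => j _; rewrite /b !scalerA -scalerBl; congr (_ *: _).
    rewrite exprMn mulrBr mulr1; congr (_ - _); rewrite mulrCA; congr (_ * _).
    by rewrite exprB ?unitfE// 1?ltnW// exprVn.
  apply: le_trans (ler_normB _ _) _; rewrite mulrDl mul1r; apply: lerD.
    by apply: cM; rewrite a0.
  rewrite normrZ ger0_norm ?exprn_ge0// ler_wpM2l ?exprn_ge0//; apply: cM.
  by rewrite divr_ge0//= ler_pdivrMr// mul1r (le_trans a1)// ler1n.
rewrite mulrA; apply: le_trans; rewrite normrZ ler_peMl//.
rewrite subn1 /= distrC ger0_norm; last first.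
  by rewrite subr_ge0 exprn_ege1// ler1n.
rewrite lerBrDr exprS; apply: (@le_trans _ _ (2 * 1)); first by rewrite mulr1.
by rewrite ler_pM2l// exprn_ege1// ler1n.
Qed.

(** By induction on the number of directions: derivatives in t_1, ..., t_k are
    linear coefficients of pure derivatives in the directions v + sum a_i t_i. *)
Lemma mixed_derivative_bound (k m : nat) : exists2 K : R, 0 <= K &
  forall (V : normedModType R) (U : set V) (f : V -> C) (x v : V) (ts : seq V) (M : R),
    open U -> diff_bounded U f -> U x -> size ts = k ->
    (forall w, reach v ts w -> `|dlist (nseq (m + k) w) f x| <= M) ->
    `|dlist (nseq m v ++ ts) f x| <= K * M.
Proof.
elim: k m => [|k IH] m.
  exists 1 => // V U f x v ts M _ _ _ /size0nil -> H.
  by rewrite cats0 mul1r; have := H v erefl; rewrite addn0.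
have [K K0 HK] := IH m.+1; have [K' K'0 HK'] := @poly_coef1_bound m.+1 isT.
exists (K' * K); first exact: mulr_ge0.
move=> V U f x v [//|t ts] M oU bf Ux [sts] H.
have bg : diff_bounded U (dlist ts f) by exact: dlist_bounded.
have [c [cE c0 c1]] := dlist_poly oU m.+1 v t bg Ux.
rewrite -cat_rcons dlist_cat.
have -> : dlist (rcons (nseq m v) t) (dlist ts f) x =
    dlist (nseq m v) (fun y => tderive (dlist ts f) y t) x.
  by rewrite -cats1 dlist_cat.
apply: (@le_trans _ _ `|c 1%N|).
  by rewrite c1//= normrZ ler_peMl// ger0_norm// ler1n.
rewrite -mulrA; apply: HK' => a a01; rewrite -cE -dlist_cat.
apply: (HK V U) => // w vw; rewrite addSnnS; apply: H.
by exists a.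
Qed.

End extraction.

(** * Partial derivatives on R^s and on R x R^s *)

Section frames.
Variable R : realType.
Local Notation C := (Rcomplex R).

(** The chain rule in coordinates: the derivative of the composition is a combination
    of partial derivatives, composed with the same curve. *)
Lemma frame_curve (V : normedModType R) (m : nat) (e : 'I_m -> V) (c : 'I_m -> V -> R)
    (f : V -> C) : is_frame e c -> diff_bounded setT f ->
  forall n (xi : R -> V), nder n xi -> nder n (fun t => f (xi t)).
Proof.
move=> [ae lc cle _] + n; elim: n f => [//|n IH] f bf xi nxi.
have [xi' xx' nx'] := nxi.
exists (fun t => \sum_i c i (xi' t) *: tderive f (xi t) (e i)); last first.
  apply: nder_sum => i; apply: nderM.
    apply: (nder_lin (f := c i : V -> R)) nx'; first exact: lc.
    by apply: lin_contraction; [exact: lc|exact: cle].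
  apply: (IH (fun x => tderive f x (e i))); last exact: nderW.
  by apply: diff_bounded_tderive; [exact: openT|].
move=> t; have := hasd_chain openT bf I (xx' t).
suff -> : tderive f (xi t) (xi' t) = \sum_i c i (xi' t) *: tderive f (xi t) (e i) by [].
rewrite [in LHS](ae (xi' t)).
elim/big_ind2 : _ => [|x1 x2 y1 y2 <- <-|i _].
- by have := tderiveZ openT 0 0 bf (I : setT (xi t)); rewrite !scale0r.
- by rewrite (tderiveD openT _ _ bf).
- by rewrite (tderiveZ openT _ _ bf).
Qed.

Lemma diff_bounded_continuous (V : normedModType R) (U : set V) (f : V -> C) x :
  open U -> diff_bounded U f -> U x -> {for x, continuous f}.
Proof.
move=> oU bf Ux; have [d [K [d0 K0 dU H]]] := diff_bounded_upto oU 1 bf Ux.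
apply/cvgrPdist_lt => e e0.
have K1 : 0 < K + 1 by rewrite ltr_wpDl.
pose r := Num.min d (e / (K + 1)).
have r0 : 0 < r by rewrite lt_min d0 divr_gt0.
have : \forall y \near x, `|x - y| < r by apply: cvgr_dist_lt => //; exact: cvg_id.
apply: filterS => y; rewrite distrC lt_min => /andP[yd ye].
have := H x [:: y - x]; rewrite subrr normr0 (ltW d0) => /(_ isT isT).
rewrite big_seq1 /mdiff/= /fdiff [x + _]addrC subrK distrC => Hx.
apply: le_lt_trans (Hx _) _; first by move=> a; rewrite inE => /eqP ->; exact: ltW.
rewrite ltr_pdivlMr// in ye; apply: le_lt_trans ye; rewrite mulrC ler_wpM2l//.
by rewrite lerDl.
Qed.

Variable s : nat.
Local Notation "'Rs'" := 'rV[R]_s.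

Lemma coord_le (x : Rs) i : `|x 0 i| <= `|x|.
Proof.
rewrite [leRHS]/Num.norm/= mx_normrE.
exact: (le_bigmax _ (fun ij => `|x ij.1 ij.2|) (0, i)).
Qed.

Lemma delta_le1 i : `|delta_mx 0 i : Rs| <= 1.
Proof.
rewrite [leLHS]/Num.norm/= mx_normrE; apply: bigmax_le => // -[j k] _.
by rewrite mxE; case: (_ && _); rewrite ?normr1 ?normr0.
Qed.

Definition rv_e (i : 'I_s) : Rs := delta_mx 0 i.
Definition rv_c (i : 'I_s) (x : Rs) : R := x 0 i.

Lemma rv_frame : is_frame rv_e rv_c.
Proof.
split; [exact: row_sum_delta|by move=> i a x y; rewrite /rv_c !mxE| |].
- by move=> i a; exact: coord_le.
- exact: delta_le1.
Qed.

Definition tx_e (i : 'I_s.+1) : R * Rs :=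
  if unlift ord0 i is Some j then (0, delta_mx 0 j) else (1, 0).
Definition tx_c (i : 'I_s.+1) (p : R * Rs) : R :=
  if unlift ord0 i is Some j then p.2 0 j else p.1.

Lemma tx_frame : is_frame tx_e tx_c.
Proof.
split.
- move=> [t x]; rewrite big_ord_recl /tx_c /tx_e unlift_none.
  under eq_bigr do rewrite liftK.
  rewrite [X in _ + X](_ : _ = (0, x)); last first.
    rewrite {2}[x]row_sum_delta; elim/big_ind2 : _ => //= [a1 a2 b1 b2 -> ->|i _].
      by congr pair; rewrite /= addr0.
    by congr pair; rewrite scaler0.
  by congr pair; rewrite /= ?addr0 ?scaler0 ?add0r// [_ *: _]mulr1.
- move=> i a p q; rewrite /tx_c; case: (unlift ord0 i) => //= j.
  by rewrite !mxE.
- move=> i p; rewrite /tx_c prod_normE; case: (unlift ord0 i) => [j|].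
    by rewrite le_max (coord_le p.2 j) orbT.
  by rewrite le_max lexx.
- move=> i; rewrite /tx_e prod_normE; case: (unlift ord0 i) => [j|] /=.
    by rewrite normr0 max_r// delta_le1.
  by rewrite normr0 normr1 max_l.
Qed.

Lemma partials_dlist l (f : Rs -> C) :
  partials l f = dlist [seq delta_mx 0 i | i <- l] f.
Proof. by elim: l => //= i l ->. Qed.

Lemma smooth_diff_bounded (f : Rs -> C) : smooth f -> diff_bounded setT f.
Proof.
move=> sf; apply: (frame_diff_bounded (G := [set partials l f | l in setT]) rv_frame).
- move=> _ [l _ <-] i; exists (partials (i :: l) f); first by exists (i :: l).
  move=> y; apply: hasd_tderive; apply/tderivableE.
  by have [_ /(_ i)] := sf l y.
- move=> _ [l _ <-] x; have [cl _] := sf l x.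
  have [d d0 fd] : exists2 d : R, 0 < d &
      forall y, `|y - x| <= d -> `|partials l f x - partials l f y| < 1.
    by apply: nbhs_closed_ball; move/cvgrPdist_lt : cl; apply.
  exists d, (`|partials l f x| + 1); split=> // y yx.
  rewrite -lerBlDl; apply: le_trans (ltW (fd _ yx)); rewrite distrC.
  by apply: le_trans (ler_norm _) _; exact: ler_dist_dist.
- by exists [::].
Qed.

Lemma diff_bounded_smooth (f : Rs -> C) : diff_bounded setT f -> smooth f.
Proof.
move=> bf l x; rewrite partials_dlist.
have bl : diff_bounded setT (dlist [seq delta_mx 0 i | i <- l] f).
  by apply: dlist_bounded; first exact: openT.
split; first exact: (diff_bounded_continuous openT bl).
move=> i; apply/tderivableE; eexists; exact: (diff_bounded_hasd openT bl).
Qed.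

Definition word (al : multi s) : seq 'I_s := flatten [seq nseq (al i) i | i <- enum 'I_s].

Lemma pderiv_dlist al (f : Rs -> C) : pderiv al f = dlist [seq delta_mx 0 i | i <- word al] f.
Proof. exact: partials_dlist. Qed.

Lemma count_word al j : count_mem j (word al) = al j.
Proof.
rewrite /word count_flatten -map_comp.
rewrite (eq_map (g := fun i => (i == j) * al i)%N); last first.
  by move=> i /=; rewrite count_nseq /= eq_sym.
rewrite sumnE big_map big_enum /= (bigD1 j)//= eqxx mul1n big1 ?addn0// => i /negbTE ->.
by rewrite mul0n.
Qed.

Lemma size_word al : size (word al) = mdegree al.
Proof.
rewrite /word size_flatten /shape -map_comp sumnE big_map big_enum /=.
by apply: eq_bigr => i _; rewrite /= size_nseq.
Qed.

Definition multi_of (l : seq 'I_s) : multi s := [ffun i => count_mem i l].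

Lemma perm_word l : perm_eq (word (multi_of l)) l.
Proof. by apply/allP => j _ /=; rewrite count_word ffunE. Qed.

Lemma mdegree_multi_of l : mdegree (multi_of l) = size l.
Proof. by rewrite -size_word (perm_size (perm_word l)). Qed.

Lemma dlist_pderiv l (f : Rs -> C) x : diff_bounded setT f ->
  dlist [seq delta_mx 0 i | i <- l] f x = pderiv (multi_of l) f x.
Proof.
move=> bf; rewrite pderiv_dlist; apply: (dlist_perm openT) bf I.
by apply: perm_map; rewrite perm_sym perm_word.
Qed.

End frames.

(** * The topology of the space of test functions *)

Section testfun_topology.
Variables (R : realType) (s : nat) (Om : set 'rV[R]_s).
Local Notation C := (Rcomplex R).
Local Notation "'Rs'" := 'rV[R]_s.
Local Notation D := (testfun Om).
Implicit Types (f g : D) (p : D -> R).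

Lemma testfun_inj f g : (forall x, f x = g x) -> f = g.
Proof. by move=> fg; apply: val_inj; apply/funext. Qed.

Lemma testfunD f g x : (f + g) x = f x + g x.
Proof. by []. Qed.

Lemma testfunZ (a : R) f x : (a *: f) x = a *: f x.
Proof. by []. Qed.

Lemma testfunB f g x : (f - g) x = f x - g x.
Proof. by []. Qed.

Lemma testfun_smooth f : smooth f.
Proof. by have /asboolP[] := testfunP f. Qed.

Lemma testfun_diff_bounded f : diff_bounded setT f.
Proof. exact: smooth_diff_bounded (testfun_smooth f). Qed.

Lemma testfun_compact f : compact (tsupp f).
Proof. by have /asboolP[] := testfunP f. Qed.

Lemma testfun_supp f : tsupp f `<=` Om.
Proof. by have /asboolP[] := testfunP f. Qed.

Lemma tsuppN (f : Rs -> C) x : ~ tsupp f x -> f x = 0.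
Proof.
move=> fx; apply/eqP; apply: contra_notT fx => fx.
by apply: subset_closure.
Qed.

Lemma testfun_bounded f : exists2 M : R, 0 <= M & forall x, `|f x| <= M.
Proof.
have [/eqP t0|/set0P t0] := boolP (tsupp f == set0).
  by exists 0 => // x; rewrite tsuppN ?normr0// t0.
have cf : {within tsupp f, continuous (fun x => `|f x|)}.
  apply: continuous_subspaceT => x; apply: continuous_comp; last exact: norm_continuous.
  exact: (diff_bounded_continuous openT (testfun_diff_bounded f)).
have [c _ cM] := EVT_max_rV t0 (testfun_compact (f := f)) cf.
exists `|f c| => // x; have [fx|fx] := pselect (tsupp f x).
  by apply: cM; rewrite inE.
by rewrite tsuppN// normr0.
Qed.

(** A point w of W carries the weight w.1 at the point w.2; if the weights are bounded
    over compact subsets of Om, this is one of the seminorms of the LF topology, even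
    if they are unbounded near the boundary. *)
Definition wsup (W : set (R * Rs)) (f : D) : R :=
  sup ([set 0] `|` [set w.1 * `|f w.2| | w in W]).

Section wsup_theory.
Variable W : set (R * Rs).
Hypothesis W0 : forall w, W w -> 0 <= w.1.
Hypothesis WK : forall K, compact K -> K `<=` Om ->
  exists2 c : R, 0 <= c & forall w, W w -> K w.2 -> w.1 <= c.

Lemma wsup_has_sup f : has_sup ([set 0] `|` [set w.1 * `|f w.2| | w in W]).
Proof.
split; first by exists 0; left.
have [M M0 fM] := testfun_bounded f.
have [c c0 Wc] := WK (testfun_compact (f := f)) (@testfun_supp f).
exists (c * M) => _ [->|[w Ww <-]]; first exact: mulr_ge0.
have [fw|fw] := pselect (tsupp f w.2).
  by apply: ler_pM => //; [exact: W0|exact: Wc].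
by rewrite tsuppN// normr0 mulr0 mulr_ge0.
Qed.

Lemma wsup_ge f w : W w -> w.1 * `|f w.2| <= wsup W f.
Proof. by move=> Ww; apply: ub_le_sup; [case: (wsup_has_sup f)|right; exists w]. Qed.

Lemma wsup_le f M : 0 <= M -> (forall w, W w -> w.1 * `|f w.2| <= M) -> wsup W f <= M.
Proof.
move=> M0 H; apply: ge_sup; first by exists 0; left.
by move=> _ [->//|[w Ww <-]]; exact: H.
Qed.

Lemma wsup_ge0 f : 0 <= wsup W f.
Proof. by apply: ub_le_sup; [case: (wsup_has_sup f)|left]. Qed.

Lemma wsup_lf : lf_seminorm (wsup W).
Proof.
have Zle (a : R) f : wsup W (a *: f) <= `|a| * wsup W f.
  apply: wsup_le => [|w Ww]; first by rewrite mulr_ge0// wsup_ge0.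
  by rewrite testfunZ normrZ mulrCA ler_wpM2l// wsup_ge.
split; first split.
- move=> f g; apply: wsup_le => [|w Ww]; first by rewrite addr_ge0// wsup_ge0.
  rewrite testfunD; apply: (@le_trans _ _ (w.1 * (`|f w.2| + `|g w.2|))).
    by rewrite ler_wpM2l ?W0// ler_normD.
  by rewrite mulrDr lerD// wsup_ge.
- move=> a f; apply/eqP; rewrite eq_le Zle/=.
  have [->|a0] := eqVneq a 0; first by rewrite normr0 mul0r wsup_ge0.
  have := Zle a^-1 (a *: f); rewrite scalerA mulVf// scale1r normfV.
  by rewrite ler_pdivlMl// normr_gt0.
move=> K cK KO; have [c c0 Wc] := WK cK KO; exists 0%N, c => f M fK fM.
have {}fM x : `|f x| <= M.
  have := fM [ffun=> 0%N] x; rewrite pderiv_dlist /word.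
  rewrite (_ : flatten _ = [::]); last first.
    by elim: (enum _) => //= i l ->; rewrite ffunE.
  by apply; rewrite /mdegree big1// => i _; rewrite ffunE.
have M0 : 0 <= M by apply: le_trans (fM 0).
apply: wsup_le => [|w Ww]; first exact: mulr_ge0.
have [fw|fw] := pselect (tsupp f w.2).
  by apply: ler_pM => //; [exact: W0|apply: Wc => //; exact: fK].
by rewrite tsuppN// normr0 mulr0 mulr_ge0.
Qed.

End wsup_theory.

Lemma unit_weights (A : set Rs) K : compact K -> K `<=` Om ->
  exists2 c : R, 0 <= c & forall w, ([set 1] `*` A) w -> K w.2 -> w.1 <= c.
Proof. by move=> _ _; exists 1 => // w [-> _] _. Qed.

Lemma unit_weights_ge0 (A : set Rs) w : ([set (1:R)] `*` A) w -> 0 <= w.1.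
Proof. by move=> [-> _]. Qed.

Definition supnorm : D -> R := wsup ([set 1] `*` setT).

Lemma supnorm_lf : lf_seminorm supnorm.
Proof. exact: wsup_lf (@unit_weights_ge0 setT) (unit_weights setT). Qed.

Lemma supnorm_ge f x : `|f x| <= supnorm f.
Proof.
have := @wsup_ge _ (@unit_weights_ge0 setT) (unit_weights setT) f (1, x).
by rewrite mul1r; apply.
Qed.

Lemma cvg_testfun (I : Type) (F : set_system I) (FF : Filter F) (u : I -> D) f :
  (forall p, lf_seminorm p -> \forall i \near F, p (u i - f) < 1) -> u @ F --> f.
Proof.
by move=> H A [p lp pA]; rewrite nbhs_simpl; apply: filterS (H p lp) => i /pA.
Qed.

Lemma testfun_cvg (I : Type) (F : set_system I) (FF : Filter F) (u : I -> D) f p e :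
  u @ F --> f -> lf_seminorm p -> 0 < e -> \forall i \near F, p (u i - f) < e.
Proof.
move=> uf lp e0; have ei : 0 <= e^-1 by rewrite invr_ge0 ltW.
have H : nbhs f [set g | e^-1 * p (g - f) < 1].
  by exists (fun g => e^-1 * p g) => //; exact: lf_seminormZ.
have := uf _ H; rewrite nbhs_simpl.
move=> uH; apply: (@filterS _ F FF _ _ _ uH) => i /=.
by rewrite ltr_pdivrMl// mulr1.
Qed.

Lemma testfun_hausdorff : hausdorff_space D.
Proof.
move=> f g fg; apply: testfun_inj => x; apply/eqP; rewrite -subr_eq0 -normr_le0.
apply/ler_addgt0Pr => e e0; rewrite add0r.
have e20 : 0 < e / 2 by rewrite divr_gt0.
have N h : nbhs h [set k | (e / 2)^-1 * supnorm (k - h) < 1].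
  exists (fun k => (e / 2)^-1 * supnorm k) => //.
  by apply: lf_seminormZ supnorm_lf; rewrite invr_ge0 ltW.
have [k [/= kf kg]] := fg _ _ (N f) (N g).
rewrite ltr_pdivrMl// mulr1 in kf; rewrite ltr_pdivrMl// mulr1 in kg.
have -> : f x - g x = (k - g) x - (k - f) x by rewrite !testfunB; ring.
apply: le_trans (ler_normB _ _) _; rewrite (splitr e); apply: lerD.
  by apply: le_trans (supnorm_ge _ _) (ltW kg).
by apply: le_trans (supnorm_ge _ _) (ltW kf).
Qed.

Lemma tvs_bounded_seminorm (B : set D) p : tvs_bounded B -> lf_seminorm p ->
  exists M : R, forall f, B f -> p f <= M.
Proof.
move=> bB lp; have := bB [set f | p f < 1].
have H : nbhs (0 : D) [set f | p f < 1] by exists p => // f /=; rewrite subr0.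
move=> /(_ H) Br; near +oo_R => r; exists r => f Bf.
have r0 : 0 < r by near: r; exact: nbhs_pinfty_gt.
have /(_ f Bf)[g /= pg <-] : B `<=` [set (r : R) *: u | u in [set f | p f < 1]] by near: r.
by rewrite lp.1.2 gtr0_norm// ler_piMr// ltW.
Unshelve. all: by end_near. Qed.

Lemma seminorm_tvs_bounded (B : set D) :
  (forall p, lf_seminorm p -> exists M : R, forall f, B f -> p f <= M) -> tvs_bounded B.
Proof.
move=> H U [p lp pU]; have [M BM] := H p lp; near=> r => f Bf.
have r0 : 0 < r by near: r; exact: nbhs_pinfty_gt.
have rM : M < r by near: r; apply: nbhs_pinfty_gt; exact: num_real.
exists (r^-1 *: f); last by rewrite scalerA mulfV ?scale1r// gt_eqF.
apply: pU => /=; rewrite subr0 lp.1.2 gtr0_norm ?invr_gt0// ltr_pdivrMl// mulr1.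
exact: le_lt_trans (BM f Bf) rM.
Unshelve. all: by end_near. Qed.

End testfun_topology.

(** * Smooth curves of test functions *)

Section testfun_curves.
Variables (R : realType) (s : nat).
Local Notation C := (Rcomplex R).
Local Notation "'Rs'" := 'rV[R]_s.

Section on_Om.
Variable Om : set Rs.
Local Notation D := (testfun Om).
Implicit Types (f g : D) (p : D -> R).

(** Otherwise there are f_n in B and points x_n of norm larger than n with f_n(x_n)
    nonzero; the weights n / |f_n(x_n)| at the points x_n define a continuous seminorm
    which is unbounded on B. *)
Lemma bounded_supp (B : set D) : tvs_bounded B ->
  exists2 rad : R, 0 < rad & forall f, B f -> forall x, rad < `|x| -> f x = 0.
Proof.
move=> bB; apply: contrapT => H.
have /choice[fx fxP] : forall n : nat, exists fx : D * Rs,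
    [/\ B fx.1, n%:R < `|fx.2| & fx.1 fx.2 != 0].
  move=> n; apply: contrapT => Hn; apply: H; exists n.+1%:R; first by rewrite ltr0n.
  move=> f Bf x nx; apply/eqP; apply: contra_notT Hn => fx0; exists (f, x); split=> //=.
  by apply: lt_trans nx; rewrite ltr_nat.
pose a n := (fx n).1 (fx n).2.
have a0 n : 0 < `|a n| by rewrite normr_gt0; case: (fxP n).
pose W := [set w : R * Rs | exists n : nat, w = (n%:R / `|a n|, (fx n).2)].
have W0 w : W w -> 0 <= w.1 by move=> [n ->] /=; rewrite divr_ge0// ltW.
have WK K : compact K -> K `<=` Om -> exists2 c : R, 0 <= c & forall w, W w -> K w.2 -> w.1 <= c.
  move=> /compact_bounded[M [_ KM]] _.
  pose N := Num.bound (`|M| + 1).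
  exists (\sum_(n < N) n%:R / `|a n|).
    by apply: sumr_ge0 => n _; rewrite divr_ge0// ltW.
  move=> _ [n ->] /= Kx; have [_ nx _] := fxP n.
  have nN : (n < N)%N.
    rewrite -(ltr_nat R); apply: lt_trans nx _.
    have MM : M < `|M| + 1 by rewrite ltr_pwDr// ler_norm.
    by apply: le_lt_trans (KM _ MM _ Kx) _; apply: archi_boundP; rewrite addr_ge0.
  rewrite (bigD1 (Ordinal nN))//= lerDl; apply: sumr_ge0 => i _.
  by rewrite divr_ge0// ltW.
have [M BM] := tvs_bounded_seminorm bB (wsup_lf W0 WK).
pose n := Num.bound `|M|.
have [Bf _ _] := fxP n; have := BM _ Bf; apply/negP; rewrite -ltNge.
apply: lt_le_trans (wsup_ge W0 WK (fx n).1 (w := (n%:R / `|a n|, (fx n).2)) _); last by exists n.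
rewrite /= -/(a n) mulfVK ?gt_eqF//; apply: le_lt_trans (ler_norm _) _.
exact: archi_boundP.
Qed.

Lemma pderiv_supp (F : Rs -> C) (K : set Rs) l : closed K ->
  (forall x, ~ K x -> F x = 0) -> forall x, ~ K x -> dlist l F x = 0.
Proof.
move=> cK F0; have oK : open (~` K) by rewrite openC.
elim: l => //= v l IH x Kx.
rewrite (tderive_local (g := fun=> 0)); last first.
  by apply: (near_open oK) => //; exact: IH.
by apply: tderive_hasd (hasd_cst _ _ _); exact: hausdorffC.
Qed.

Lemma tsupp_sub (F : Rs -> C) (K : set Rs) : closed K ->
  (forall x, ~ K x -> F x = 0) -> tsupp F `<=` K.
Proof.
move=> cK F0; rewrite [X in _ `<=` X](_ : K = closure K).
  by apply: closureS => x /= Fx; apply: contrapT => /F0 /eqP; apply/negP.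
by apply/closure_id.
Qed.

Lemma compact_closedRs (K : set Rs) : compact K -> closed K.
Proof. by apply: compact_closed; exact: norm_hausdorff. Qed.

Lemma test_funP (F : Rs -> C) (K : set Rs) : diff_bounded setT F -> compact K -> K `<=` Om ->
  (forall x, ~ K x -> F x = 0) -> F \in test_fun Om.
Proof.
move=> bF cK KO F0; have sub := tsupp_sub (compact_closedRs cK) F0.
apply/asboolP; split; first exact: diff_bounded_smooth.
  exact: subclosed_compact (@closed_closure _ _) cK sub.
exact: subset_trans sub KO.
Qed.

Lemma linear_quot (M : lmodType R) (L : D -> M) :
  (forall (a : R) f g, L (a *: f + g) = a *: L f + L g) ->
  forall (a : R) f g h, L (a *: (f - g) - h) = a *: (L f - L g) - L h.
Proof.
move=> lL; have L0 : L 0 = 0.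
  by have := lL (-1) 0 0; rewrite scaler0 addr0 scaleN1r addNr.
have LN k : L (- k) = - L k by have := lL (-1) k 0; rewrite L0 !addr0 !scaleN1r.
move=> a f g h; rewrite lL LN; congr (_ *: _ - _).
by have := lL 1 f (- g); rewrite LN !scale1r.
Qed.

Lemma dtest_subproof (i : 'I_s) f : (fun x => tderive f x (delta_mx 0 i)) \in test_fun Om.
Proof.
apply: (test_funP _ (testfun_compact (f := f)) (@testfun_supp _ _ _ f)).
  exact: (diff_bounded_tderive openT _ (testfun_diff_bounded f)).
move=> x fx; apply: (pderiv_supp [:: delta_mx 0 i] _ _ fx).
  exact: closed_closure.
exact: tsuppN.
Qed.

Definition dtest (i : 'I_s) f : D := TestFun (dtest_subproof i f).

Lemma dtestE i f x : dtest i f x = tderive f x (delta_mx 0 i).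
Proof. by []. Qed.

Lemma dtest_lin i (a : R) f g : dtest i (a *: f + g) = a *: dtest i f + dtest i g.
Proof.
apply: testfun_inj => x; rewrite testfunD testfunZ !dtestE.
have hd k := diff_bounded_hasd openT (testfun_diff_bounded k) (I : setT x)
  (v := delta_mx 0 i).
have -> : (a *: f + g : D) = (fun y => a *: f y + g y) :> (Rs -> C).
  by apply/funext => y; rewrite testfunD testfunZ.
apply: tderive_hasd; first exact: hausdorffC.
by have := hasdD (hasdZ (c := a) (hd _ f)) (hd _ g); exact.
Qed.

Lemma dtest0 i : dtest i 0 = 0.
Proof. by have := dtest_lin i (-1) 0 0; rewrite scaler0 addr0 scaleN1r addNr. Qed.

Lemma dtest_lf i p : lf_seminorm p -> lf_seminorm (fun f => p (dtest i f)).
Proof.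
move=> [[pD pZ] pK]; split; first split.
- move=> f g; have := dtest_lin i 1 f g; rewrite !scale1r => ->; exact: pD.
- by move=> a f; have := dtest_lin i a f 0; rewrite dtest0 !addr0 => ->; exact: pZ.
move=> K cK KO; have [m [c H]] := pK K cK KO; exists m.+1, c => f M fK fM.
apply: H => [|al x alm].
  apply: subset_trans fK; apply: tsupp_sub; first exact: closed_closure.
  apply: (pderiv_supp [:: delta_mx 0 i]); first exact: closed_closure.
  exact: tsuppN.
rewrite pderiv_dlist.
have -> : dlist [seq delta_mx 0 i | i <- word al] (dtest i f) x =
    pderiv (multi_of (rcons (word al) i)) f x.
  rewrite -dlist_pderiv; last exact: testfun_diff_bounded.
  by rewrite map_rcons -cats1 dlist_cat.
by apply: fM; rewrite mdegree_multi_of size_rcons size_word ltnS.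
Qed.

Lemma nder_dtest i n (g : R -> D) : nder n g -> nder n (fun t => dtest i (g t)).
Proof.
elim: n g => [//|n IH] g [g' gg' ng']; exists (fun t => dtest i (g' t)); last exact: IH.
move=> t; apply: cvg_testfun => p lp.
have := testfun_cvg (dnbhs_filter _) (gg' t) (dtest_lf i lp) ltr01.
by apply: filterS => h; rewrite (linear_quot (dtest_lin i)).
Qed.

Lemma eval_cvg (I : Type) (F : set_system I) (FF : Filter F) (u : I -> D) f x :
  u @ F --> f -> (fun i => u i x) @ F --> f x.
Proof.
move=> uf; apply/cvgrPdist_lt => e e0.
have := testfun_cvg FF uf (supnorm_lf Om) e0; apply: filterS => i.
by apply: le_lt_trans; rewrite distrC -testfunB; exact: supnorm_ge.
Qed.

Lemma hasd_seminorm_bounded (g : R -> D) t l p : hasd g t 1 l -> lf_seminorm p ->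
  exists d K : R, [/\ 0 < d, 0 <= K & forall u, `|u - t| <= d -> p (g u) <= K].
Proof.
move=> gl lp; have sp := lp.1.
have := testfun_cvg (dnbhs_filter _) gl lp ltr01; rewrite /dnbhs near_withinE => H.
have [d d0 dH] := nbhs_closed_ball H.
have K0 : 0 <= p (g t) + d * (1 + p l).
  apply: addr_ge0; first exact: seminorm_ge0.
  by apply: mulr_ge0; [exact: ltW|apply: addr_ge0 => //; exact: seminorm_ge0].
exists d, (p (g t) + d * (1 + p l)); split=> // u ut.
have [->|u0] := eqVneq u t.
  rewrite lerDl; apply: mulr_ge0; first exact: ltW.
  by apply: addr_ge0 => //; exact: seminorm_ge0.
have h0 : u - t != 0 by rewrite subr_eq0.
have := dH (u - t); rewrite subr0 => /(_ ut h0).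
have -> : (u - t) *: 1 + t = u by rewrite [_ *: _]mulr1 subrK.
set q := _ *: (g u - g t) => pq.
have -> : g u = g t + (u - t) *: q by rewrite scalerA mulfV// scale1r addrC subrK.
apply: le_trans (sp.1 _ _) _; rewrite lerD2l sp.2.
apply: ler_pM => //; first exact: seminorm_ge0.
rewrite -(subrK l q); apply: le_trans (sp.1 _ _) _; rewrite lerD2r.
exact: ltW.
Qed.

(** The functions (t, x) |-> g t x for smooth curves g form a class that is closed
    under partial derivatives, as these act continuously on test functions, and its
    members are locally bounded. *)
Lemma smooth_curve_joint (g : R -> D) : smooth_curve g ->
  diff_bounded (V := (R * Rs)%type) setT (fun z => g z.1 z.2).
Proof.
move=> sg; apply: (frame_diff_bounded (G := [set F | exists2 g : R -> D, smooth_curve g &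
  F = fun z => g z.1 z.2]) (tx_frame R s)); last by exists g.
- move=> _ [{sg}g sg ->] i; rewrite /tx_e; case: (unlift ord0 i) => [j|].
    exists (fun z => dtest j (g z.1) z.2).
      exists (fun t => dtest j (g t)) => //; apply/smooth_curveP.
        exact: testfun_hausdorff.
      move=> n; apply: nder_dtest; move: n; apply/smooth_curveP => //.
      exact: testfun_hausdorff.
    move=> [t x] /=.
    have := diff_bounded_hasd openT (testfun_diff_bounded (g t)) (I : setT x)
      (v := delta_mx 0 j).
    rewrite /hasd; apply: cvg_trans; apply: near_eq_cvg; apply: nearW => h /=.
    by rewrite scaler0 add0r.
  have gg' t : hasd g t 1 (tderive g t 1) by apply: hasd_tderive; exact: (sg 0%N).
  exists (fun z => tderive g z.1 1 z.2).
    exists (fun t => tderive g t 1) => //.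
    by apply: smooth_curve_deriv gg' sg; exact: testfun_hausdorff.
  move=> [t x] /=; have := eval_cvg (x := x) (dnbhs_filter _) (gg' t).
  rewrite /hasd; apply: cvg_trans; apply: near_eq_cvg; apply: nearW => h /=.
  by rewrite scaler0 add0r.
- move=> _ [{sg}g sg ->] [t x].
  have gg' : hasd g t 1 (tderive g t 1) by apply: hasd_tderive; exact: (sg 0%N).
  have [d [K [d0 K0 H]]] := hasd_seminorm_bounded gg' (supnorm_lf Om).
  exists d, K; split=> // -[u y]; rewrite prod_normE ge_max => /andP[/= ut _].
  by apply: le_trans (supnorm_ge _ _) (H u ut).
Qed.

Lemma slice_mdiff (F : R * Rs -> C) l t x :
  mdiff l (fun x => F (t, x)) x = mdiff [seq (0, a) | a <- l] F (t, x).
Proof.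
elim: l x => // a l IH x; rewrite [map _ _]/= !mdiff_consE !IH.
by congr (mdiff _ _ _ - _); congr pair; rewrite /= addr0.
Qed.

Lemma slice_diff_bounded (F : R * Rs -> C) t :
  diff_bounded setT F -> diff_bounded setT (fun x => F (t, x)).
Proof.
move=> bF x _ p; have [d [K [d0 K0 H]]] := bF (t, x) I p; exists d, K; split=> // y l yx sl ld.
have n0 (a : Rs) : `|(0 : R, a)| = `|a| by rewrite prod_normE /= normr0 max_r.
rewrite slice_mdiff; apply: le_trans (H _ _ _ _ _) _.
- by rewrite /= [_ - _](_ : _ = (0, y - x)) ?n0//; congr pair; rewrite /= subrr.
- by rewrite size_map.
- by move=> _ /mapP[a al ->]; rewrite n0 ld.
rewrite big_map ler_wpM2l//; apply: eq_ler; apply: eq_bigr => a _; exact: n0.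
Qed.

Lemma slice_dlist (F : R * Rs -> C) l t x :
  dlist l (fun x => F (t, x)) x = dlist [seq (0, a) | a <- l] F (t, x).
Proof.
apply: (dlist_affine (j := fun x => (t, x)) (J := fun a => (0, a))) => h v y.
by congr pair; rewrite /= scaler0 add0r.
Qed.

(** The local expansions of first order are uniform on compact sets. *)
Lemma uniform_first_order (F : R * Rs -> C) t (K : set Rs) : diff_bounded setT F ->
  compact K -> exists2 c : R, 0 < c & forall x h, K x -> `|h| <= c^-1 ->
    `|F (h + t, x) - F (t, x) - h *: tderive F (t, x) (1, 0)| <= c * h ^+ 2.
Proof.
move=> bF /compact_near_coveringP cK.
pose P (c : R) x := forall h, `|h| <= c^-1 ->
  `|F (h + t, x) - F (t, x) - h *: tderive F (t, x) (1, 0)| <= c * h ^+ 2.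
have [|c0 [_ H]] := cK R (pinfty_nbhs R) P _.
  move=> x Kx; have [d [M [d0 M0 _ H]]] := first_order openT bF (I : setT (t, x)).
  near=> y c => h hc.
  have c0 : 0 < c by near: c; exact: nbhs_pinfty_gt.
  have Mc : M <= c by apply: ltW; near: c; apply: nbhs_pinfty_gt; exact: num_real.
  have dc : d^-1 <= c by apply: ltW; near: c; apply: nbhs_pinfty_gt; exact: num_real.
  have hd : `|h| <= d.
    by apply: le_trans hc _; rewrite -[leRHS]invrK lef_pV2 ?posrE ?invr_gt0.
  have yd : `|y - x| <= d.
    rewrite distrC; apply: ltW; near: y; apply: cvgr_dist_lt => //; exact: cvg_id.
  have h1 : `|h *: ((1 : R), (0 : Rs))| = `|h|.
    by rewrite normrZ prod_normE /= normr1 normr0 max_l// mulr1.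
  have := H (t, y) (h *: (1, 0)).
  rewrite h1 (tderiveZ openT _ _ bF)// => -[||+ _] //.
    by rewrite prod_normE /= subrr normr0 ge_max yd ltW.
  have -> : (t, y) + h *: (1, 0) = (h + t, y).
    by congr pair; rewrite /= ?scaler0 ?addr0// [h *: _]mulr1 addrC.
  by move/le_trans; apply; rewrite real_normK ?num_real// ler_wpM2r// sqr_ge0.
exists (Num.max c0 1 + 1).
  by rewrite ltr_pwDr// le_max ler01 orbT.
move=> x h Kx; apply: H => //=.
by rewrite ltr_pwDr// le_max lexx.
Unshelve. all: by end_near. Qed.

Lemma pderiv_lin al x (a : R) f g :
  pderiv al (a *: f + g : D) x = a *: pderiv al f x + pderiv al g x.
Proof.
have -> : (a *: f + g : D) = a *: (f : Rs -> C) + (g : Rs -> C) :> (Rs -> C) by [].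
by rewrite /pderiv smoothP //; exact: testfun_smooth.
Qed.

Lemma bounded_order (m : nat) (c : multi s -> R) : exists2 M : R, 0 < M &
  forall al : multi s, (mdegree al <= m)%N -> c al <= M.
Proof.
pose of_ b : multi s := [ffun i => nat_of_ord ((b : {ffun 'I_s -> 'I_m.+1}) i)].
exists (1 + \sum_b `|c (of_ b)|); first by rewrite ltr_pwDl// sumr_ge0.
move=> al alm; pose b : {ffun 'I_s -> 'I_m.+1} := [ffun i => inord (al i)].
have -> : al = of_ b.
  apply/ffunP => i; rewrite !ffunE inordK// ltnS; apply: leq_trans alm.
  by rewrite /mdegree (bigD1 i)//= leq_addr.
rewrite (bigD1 b)//= addrCA; apply: le_trans (ler_norm _) _.
by rewrite lerDl addr_ge0// sumr_ge0.
Qed.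

Definition locally_supported (F : R * Rs -> C) := forall t, exists2 K, compact_in K Om &
  exists2 d : R, 0 < d & forall u x, `|u - t| <= d -> ~ K x -> F (u, x) = 0.

(** All difference quotients have their support in a common compact set, where their
    derivatives of order at most m converge uniformly. *)
Lemma joint_hasd (g g' : R -> D) t : diff_bounded setT (fun z : R * Rs => g z.1 z.2) ->
  locally_supported (fun z => g z.1 z.2) ->
  (forall x, g' t x = tderive (fun z : R * Rs => g z.1 z.2) (t, x) (1, 0)) ->
  hasd g t 1 (g' t).
Proof.
set F := (fun z : R * Rs => _) => bF sF g'E.
apply: cvg_testfun => p [_ lp].
have [K [cK KO] [d d0 FK]] := sF t; have [m [c pm]] := lp K cK KO.
pose G al := dlist [seq (0, delta_mx 0 i) | i <- word al] F : R * Rs -> C.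
have bG al : diff_bounded setT (G al) by exact: (dlist_bounded openT).
have pG al u x : pderiv al (g u) x = G al (u, x).
  by rewrite pderiv_dlist (slice_dlist F) -map_comp.
have pG' al x : pderiv al (g' t) x = tderive (G al) (t, x) (1, 0).
  rewrite pderiv_dlist (_ : (g' t : Rs -> C) = fun x => tderive F (t, x) (1, 0)); last first.
    exact/funext.
  rewrite (slice_dlist (fun z => tderive F z (1, 0))) -map_comp; have := dlist_swap openT ((1, 0) : R * Rs)
    [seq (0, delta_mx 0 i) | i <- word al] bF (I : setT (t, x)).
  by rewrite -cats1 dlist_cat.
have /choice[a aP] : forall al, exists c : R, 0 < c /\ forall x h, K x -> `|h| <= c^-1 ->
    `|G al (h + t, x) - G al (t, x) - h *: tderive (G al) (t, x) (1, 0)| <= c * h ^+ 2.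
  by move=> al; have [b b0 bH] := uniform_first_order t (bG al) cK; exists b.
have [M M0 aM] := bounded_order m a.
have g't x : ~ K x -> g' t x = 0.
  move=> Kx; rewrite g'E; apply: tderive_hasd; first exact: hausdorffC.
  apply: (@hasd_near _ _ _ (fun=> 0)); last exact: hasd_cst.
    by rewrite FK// subrr normr0 ltW.
  near=> h; rewrite (_ : _ + _ = (h *: 1 + t, x)); last first.
    by congr pair; rewrite /= scaler0 add0r.
  by rewrite FK// [h *: 1]mulr1 addrK; near: h; exact: dnbhs0_le d0.
have cM0 : 0 < `|c| * M + 1 by rewrite ltr_wpDl// mulr_ge0// ltW.
near=> h.
have h0 : h != 0 by near: h; exact: nbhs_dnbhs_neq.
have hM : `|h| <= M^-1 by near: h; apply: dnbhs0_le; rewrite invr_gt0.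
have hd : `|h| <= d by near: h; exact: dnbhs0_le.
have cM : `|c * (M * h)| < 1.
  apply: (@lt_le_trans _ _ (`|h| * (`|c| * M + 1))).
    by rewrite 2!normrM (gtr0_norm M0) mulrDr mulr1 mulrA mulrC ltrDl normr_gt0.
  by rewrite -ler_pdivlMr// div1r; near: h; apply: dnbhs0_le; rewrite invr_gt0.
apply: le_lt_trans cM; rewrite normrM.
have qK x : ~ K x -> (h^-1 *: (g (h *: 1 + t) - g t) - g' t) x = 0.
  move=> Kx; rewrite testfunB testfunZ testfunB g't//.
  have -> : g (h *: 1 + t) x = 0 by apply: FK; rewrite // [h *: 1]mulr1 addrK.
  have -> : g t x = 0 by apply: FK; rewrite // subrr normr0 ltW.
  by rewrite subrr scaler0 subrr.
apply: le_trans (pm _ (M * `|h|) _ _) _.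
- exact: (tsupp_sub (compact_closedRs cK)).
- move=> al x alm; have [Kx|Kx] := pselect (K x); last first.
    rewrite pderiv_dlist (pderiv_supp _ (compact_closedRs cK) qK Kx) normr0.
    by rewrite mulr_ge0// ltW.
  rewrite (linear_quot (pderiv_lin al x)) !pG pG' [h *: 1]mulr1.
  have [a0 aH] := aP al.
  have -> : h^-1 *: (G al (h + t, x) - G al (t, x)) - tderive (G al) (t, x) (1, 0) =
      h^-1 *: (G al (h + t, x) - G al (t, x) - h *: tderive (G al) (t, x) (1, 0)).
    by rewrite [in RHS]scalerBr scalerA mulVf// scale1r.
  rewrite normrZ normfV ler_pdivrMl ?normr_gt0//.
  apply: le_trans (aH _ _ Kx _) _.
    apply: le_trans hM _; rewrite lef_pV2 ?posrE//; exact: aM.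
  rewrite -real_normK ?num_real// expr2 mulrCA ler_wpM2l// ler_wpM2r//; exact: aM.
rewrite normrM [`|M|]gtr0_norm// ler_wpM2r ?mulr_ge0 ?ler_norm//; exact: ltW.
Unshelve. all: by end_near. Qed.

(** A converse of [smooth_curve_joint], by induction on the order of differentiability:
    the partial derivative in t satisfies the hypotheses again. *)
Lemma joint_curve (g : R -> D) : diff_bounded setT (fun z : R * Rs => g z.1 z.2) ->
  locally_supported (fun z => g z.1 z.2) -> smooth_curve g.
Proof.
move=> bF sF; apply/smooth_curveP; first exact: testfun_hausdorff.
move=> n.
elim: n g bF sF => [//|n IH] g bF sF.
pose F' := fun z : R * Rs => tderive (fun z : R * Rs => g z.1 z.2) z (1, 0).
have bF' : diff_bounded setT F' by exact: (diff_bounded_tderive openT).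
have sF' : locally_supported F'.
  move=> t; have [K KO [d d0 FK]] := sF t; exists K => //.
  exists (d / 2); first by rewrite divr_gt0.
  move=> u x ut Kx; apply: tderive_hasd; first exact: hausdorffC.
  have d2 : d / 2 <= d by lra.
  apply: (@hasd_near _ _ _ (fun=> 0)); last exact: hasd_cst.
    by rewrite (FK u x)//; apply: le_trans d2.
  near=> h; rewrite /= scaler0 add0r (FK _ x)// [h *: 1]mulr1 -addrA.
  apply: le_trans (ler_normD _ _) _; rewrite [leRHS]splitr lerD//.
  by near: h; apply: dnbhs0_le; rewrite divr_gt0.
have /choice[g' g'E] t : exists f : D, forall x, f x = F' (t, x).
  have [K [cK KO] [d d0 FK]] := sF' t.
  have tP : (fun x => F' (t, x)) \in test_fun Om.
    apply: (test_funP (slice_diff_bounded t bF') cK KO) => x.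
    by apply: FK; rewrite subrr normr0 ltW.
  by exists (TestFun tP).
have gE : (fun z : R * Rs => g' z.1 z.2) = F' by apply/funext => -[t x]; exact: g'E.
exists g'; first by move=> t; apply: joint_hasd.
by apply: IH; rewrite gE.
Unshelve. all: by end_near. Qed.

End on_Om.
End testfun_curves.

(** * The iterated integral and the moment conditions *)

Section integrals.
Variable R : realType.
Local Notation C := (Rcomplex R).

Lemma rv_norm_le n (x : 'rV[R]_n) (M : R) : 0 <= M -> (forall i, `|x 0 i| <= M) -> `|x| <= M.
Proof.
move=> M0 xM; rewrite [leLHS]/Num.norm/= mx_normrE; apply: bigmax_le => // -[j k] _ /=.
by rewrite ord1.
Qed.

Lemma contraction_continuous (E F : normedModType R) (f : E -> F) :
  (forall x y, `|f x - f y| <= `|x - y|) -> continuous f.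
Proof.
move=> fle x; apply/cvgrPdist_lt => e e0; near=> y.
apply: le_lt_trans (fle _ _) _; near: y; apply: cvgr_dist_lt => //; exact: cvg_id.
Unshelve. all: by end_near. Qed.

Lemma closed_ball_compact n (x0 : 'rV[R]_n) (L : R) : compact [set x | `|x - x0| <= L].
Proof.
apply: bounded_closed_compact.
  exists (L + `|x0|); split; first exact: num_real.
  move=> M LM x /= xL; apply: ltW; apply: le_lt_trans LM.
  by rewrite -[x in leLHS](subrK x0); apply: le_trans (ler_normD _ _) _; rewrite lerD2r.
apply: (@closed_comp _ _ (fun x : 'rV[R]_n => `|x - x0|) [set t : R | t <= L]).
  move=> x _; apply: (contraction_continuous (f := fun x : 'rV[R]_n => `|x - x0| : R)).
  move=> y z; apply: le_trans (ler_dist_dist _ _) _.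
  by rewrite opprB addrA subrK.
exact: closed_le.
Qed.

Section one_dim.
Variables (F : R -> R) (a b : R).
Hypotheses (cF : continuous F) (ab : a <= b)
  (F0 : forall t, ~~ (a <= t <= b) -> F t = 0).

Let FE : F = F \_ `[a, b].
Proof.
apply/funext => t; rewrite patchE; case: ifPn => // tab; apply: F0.
by apply: contra tab => tab; rewrite inE /= in_itv.
Qed.

Let integrable_itv : (@lebesgue_measure R).-integrable `[a, b] (EFin \o F).
Proof.
apply: continuous_compact_integrable; first exact: segment_compact.
exact: continuous_subspaceT.
Qed.

Lemma csupp_integrable : (@lebesgue_measure R).-integrable setT (EFin \o F).
Proof.
have /integrable_mkcond := integrable_itv; rewrite restrict_EFin -FE; apply.
exact: measurable_itv.
Qed.

Lemma csupp_integralE :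
  \int[@lebesgue_measure R]_t F t = \int[@lebesgue_measure R]_(t in `[a, b]) F t.
Proof. by rewrite [RHS]Rintegral_mkcond -FE. Qed.

Lemma csupp_integral_le (M : R) : (forall t, `|F t| <= M) ->
  `|\int[@lebesgue_measure R]_t F t| <= M * (b - a).
Proof.
move=> FM; rewrite csupp_integralE.
apply: le_trans (le_normr_Rintegral _ integrable_itv) _; first exact: measurable_itv.
have -> : M * (b - a) = \int[@lebesgue_measure R]_(t in `[a, b]) M.
  rewrite Rintegral_cst; last exact: measurable_itv.
  rewrite /= lebesgue_measure_itv /= lte_fin; case: ltgtP ab => //= -> _.
  by rewrite subrr.
apply: le_Rintegral; first exact: measurable_itv.
- have /integrable_norm := integrable_itv; exact.
- apply: continuous_compact_integrable; first exact: segment_compact.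
  by apply: continuous_subspaceT => t; exact: cst_continuous.
- by [].
Qed.

End one_dim.

Lemma csupp_integral_affine (F : R -> R) (L a b : R) : continuous F -> 0 <= L -> 0 < a ->
  (forall t, L < `|t| -> F t = 0) ->
  \int[@lebesgue_measure R]_t F (a * t + b) = a^-1 * \int[@lebesgue_measure R]_t F t.
Proof.
move=> cF L0 a0 FL.
pose G t := a * t + b.
have cG : continuous G.
  by move=> t; apply: cvgD; [apply: cvgMr; exact: cvg_id|exact: cvg_cst].
have GE t : G ((t - b) / a) = t by rewrite /G mulrC divfK ?gt_eqF// subrK.
have dG (t : R) : is_derive t 1 G a.
  rewrite -[a in X in is_derive _ _ _ X]addr0; apply: is_deriveD.
  by have := is_deriveZ a (is_derive_id t (1 : R)); rewrite [_ *: 1]mulr1.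
have G' : derive1 G = fun=> a by apply/funext => t; rewrite derive1E derive_val.
have LL : - L <= L by lra.
have le1 : (- L - b) / a <= (L - b) / a by rewrite ler_pM2r ?invr_gt0// lerB.
have F0 t : ~~ (- L <= t <= L) -> F t = 0.
  by rewrite -ler_norml -ltNge => /FL.
have FG0 t : ~~ ((- L - b) / a <= t <= (L - b) / a) -> F (G t) = 0.
  rewrite ler_pdivrMr// ler_pdivlMr// lerBlDr lerBrDr mulrC; exact: F0.
rewrite (csupp_integralE F0) (csupp_integralE FG0).
have := @integration_by_substitution_increasing R G F _ _ le1.
rewrite !GE G' => H.
have -> : \int[lebesgue_measure]_(t in `[- L, L]) F t =
    \int[lebesgue_measure]_(t in `[(- L - b) / a, (L - b) / a]) (a * F (G t)).
  rewrite /Rintegral; congr fine; rewrite H.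
  - by apply: eq_integral => t _; rewrite /= mulrC.
  - by move=> x y _ _ xy; rewrite /G ltrD2r ltr_pM2l.
  - by move=> x _; exact: cst_continuous.
  - exact: is_cvg_cst.
  - exact: is_cvg_cst.
  - split; first by move=> t _; have [] := dG t.
      by apply: cvg_at_right_filter; exact: cG.
    by apply: cvg_at_left_filter; exact: cG.
  - exact: continuous_subspaceT.
rewrite RintegralZl//; first by rewrite mulKf// gt_eqF.
apply: continuous_compact_integrable; first exact: segment_compact.
apply: continuous_subspaceT => t; exact: (continuous_comp (cG t) (cF (G t))).
Qed.

Definition csupp n (L : R) (f : 'rV[R]_n -> R) :=
  continuous f /\ forall x, L < `|x| -> f x = 0.

Definition slice n (f : 'rV[R]_n.+1 -> R) (t : R) : 'rV[R]_n -> R :=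
  fun y => f (row_mx (t%:M : 'rV[R]_1) y).

Lemma row_mx_norm n t (y : 'rV[R]_n) : `|row_mx (t%:M : 'rV[R]_1) y| = Num.max `|t| `|y|.
Proof.
apply/eqP; rewrite eq_le; apply/andP; split.
  apply: rv_norm_le => [|i]; first by rewrite le_max normr_ge0.
  case: (splitP i) => j ij.
    rewrite (_ : i = lshift n j); last exact: val_inj.
    by rewrite row_mxEl ord1 mxE eqxx mulr1n le_max lexx.
  rewrite (_ : i = rshift 1 j); last exact: val_inj.
  by rewrite row_mxEr le_max coord_le orbT.
rewrite ge_max; apply/andP; split.
  have := coord_le (row_mx (t%:M : 'rV[R]_1) y) (lshift n ord0).
  by rewrite row_mxEl mxE eqxx mulr1n.
apply: rv_norm_le => // i; have := coord_le (row_mx (t%:M : 'rV[R]_1) y) (rshift 1 i).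
by rewrite row_mxEr.
Qed.

Lemma row_mx_continuous n :
  continuous (fun z : R * 'rV[R]_n => row_mx (z.1%:M : 'rV[R]_1) z.2).
Proof.
apply: lin_contraction => [c z w|z]; last by rewrite row_mx_norm prod_normE.
rewrite scale_row_mx add_row_mx; congr (row_mx _ _).
by apply/matrixP => i j; rewrite !ord1 !mxE eqxx !mulr1n.
Qed.

Lemma slice_csupp n L (f : 'rV[R]_n.+1 -> R) t : csupp L f -> csupp L (slice f t).
Proof.
move=> [cf fL]; split=> [y|y Ly]; last by apply: fL; rewrite row_mx_norm lt_max Ly orbT.
apply: (continuous_comp (f := fun y => row_mx (t%:M : 'rV[R]_1) y) (g := f)); last exact: cf.
apply: contraction_continuous => {}y z.
have -> : row_mx (t%:M : 'rV[R]_1) y - row_mx t%:M z = row_mx (0%:M : 'rV[R]_1) (y - z).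
  by rewrite opp_row_mx add_row_mx subrr raddf0.
by rewrite row_mx_norm normr0 max_r.
Qed.

Lemma csupp_lin n L (f g : 'rV[R]_n -> R) (a : R) : csupp L f -> csupp L g ->
  csupp L (fun x => f x + a * g x).
Proof.
move=> [cf fL] [cg gL]; split=> [x|x Lx]; last by rewrite fL// gL// mulr0 addr0.
apply: (@continuousD _ _ _ f (fun x => a * g x)); first exact: cf.
by apply: (@continuousM _ _ (fun=> a) g); [exact: cst_continuous|exact: cg].
Qed.

(** The two properties support each other in the induction: the inner integral is
    continuous in the outer variable because a uniformly small difference of slices
    has a small integral. *)
Definition integral_facts n := forall L, 0 <= L ->
  (forall (f g : 'rV[R]_n -> R) (a : R), csupp L f -> csupp L g ->
     integral_rV (fun x => f x + a * g x) = integral_rV f + a * integral_rV g) /\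
  (forall (f : 'rV[R]_n -> R) (M : R), csupp L f -> (forall x, `|f x| <= M) ->
     `|integral_rV f| <= M * (2 * L) ^+ n).

Lemma slice_integral n L (f : 'rV[R]_n.+1 -> R) : integral_facts n -> 0 <= L -> csupp L f ->
  continuous (fun t => integral_rV (slice f t)) /\
  forall t, L < `|t| -> integral_rV (slice f t) = 0.
Proof.
move=> IH L0 sf; have [lin bnd] := IH L L0; split; last first.
  move=> t Lt; apply/eqP; rewrite -normr_le0.
  apply: le_trans (bnd _ 0 (slice_csupp t sf) _) _; last by rewrite mul0r.
  move=> y; rewrite normr_le0; apply/eqP; apply: sf.2.
  by rewrite row_mx_norm lt_max Lt.
move=> t0; apply/cvgrPdist_lt => e e0.
pose e' := e / ((2 * L) ^+ n + 1).
have L2 : 0 <= (2 * L) ^+ n by rewrite exprn_ge0// mulr_ge0.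
have e'0 : 0 < e' by rewrite divr_gt0// ltr_wpDl.
have /compact_near_coveringP cK := @closed_ball_compact n 0 L.
pose P t y : Prop := `|slice f t0 y - slice f t y| <= e'.
have near_t0 : \forall t \near nbhs t0, [set y : 'rV[R]_n | `|y - 0| <= L] `<=` P t.
  apply: (cK R (nbhs t0) P) => y Ly.
  have cg : continuous (fun z : R * 'rV[R]_n => slice f z.1 z.2).
    move=> z; apply: (continuous_comp
      (f := fun z : R * 'rV[R]_n => row_mx (z.1%:M : 'rV[R]_1) z.2) (g := f)).
      exact: row_mx_continuous.
    exact: sf.1.
  have e2 : 0 < e' / 2 by rewrite divr_gt0.
  have /cvgrPdist_lt/(_ _ e2)/nbhs_closed_ball[d d0 dP] := cg (t0, y).
  have dle z t : `|z - y| <= d -> `|t - t0| <= d ->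
      `|slice f t0 y - slice f t z| < e' / 2.
    by move=> zd td; apply: (dP (t, z)); rewrite prod_normE ge_max /= td zd.
  near=> z t; rewrite /P.
  have zd : `|z - y| <= d.
    by rewrite distrC; apply: ltW; near: z; apply: cvgr_dist_lt => //; exact: cvg_id.
  have td : `|t - t0| <= d.
    by rewrite distrC; apply: ltW; near: t; apply: cvgr_dist_lt => //; exact: cvg_id.
  rewrite -(subrKA (slice f t0 y)); apply: le_trans (ler_normD _ _) _.
  rewrite [leRHS]splitr lerD//; last by apply/ltW/dle.
  by rewrite distrC; apply/ltW/dle => //; rewrite subrr normr0 ltW.
near=> t; have tP : [set y : 'rV[R]_n | `|y - 0| <= L] `<=` P t by near: t.
have st u := slice_csupp u sf.
have := lin _ _ (-1) (st t0) (st t); rewrite mulN1r => <-.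
have sd := csupp_lin (-1) (st t0) (st t).
apply: (@le_lt_trans _ _ (e' * (2 * L) ^+ n)).
  apply: (bnd _ _ sd) => y; rewrite mulN1r.
  have [yL|Ly] := leP `|y| L; first by apply: tP; rewrite /= subr0.
  by rewrite !(st _).2// subrr normr0 ltW.
rewrite /e' mulrAC ltr_pdivrMr ?ltr_wpDl//.
by rewrite mulrDr mulr1 ltrDl.
Unshelve. all: by end_near. Qed.

Lemma integral_factsP n : integral_facts n.
Proof.
elim: n => [|n IH] L L0.
  split=> [f g a _ _ //|f M _ fM]; by rewrite /= expr0 mulr1.
have [lin bnd] := IH L L0.
have LL : - L <= L by lra.
have sl f := slice_integral IH L0 (f := f).
have off (f : 'rV[R]_n.+1 -> R) : csupp L f -> forall t, ~~ (- L <= t <= L) -> integral_rV (slice f t) = 0.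
  by move=> sf t; rewrite -ler_norml -ltNge => /(sl f sf).2.
split=> [f g a sf sg|f M sf fM] /=.
  have fi := csupp_integrable (sl _ sf).1 (off _ sf).
  have gi := csupp_integrable (sl _ sg).1 (off _ sg).
  have agi : (@lebesgue_measure R).-integrable setT
      (EFin \o (fun t => a * integral_rV (slice g t))).
    apply: (csupp_integrable (a := - L) (b := L)) => [t|t /(off _ sg) ->].
      apply: (@continuousM _ _ (fun=> a) (fun t => integral_rV (slice g t))).
        exact: cst_continuous.
      exact: (sl _ sg).1.
    by rewrite mulr0.
  rewrite -[X in _ = _ + X](RintegralZl _ measurableT gi)// -[RHS](RintegralD measurableT fi agi)//.
  by apply: eq_Rintegral => t _; rewrite -lin//; exact: slice_csupp.
apply: le_trans (csupp_integral_le (sl _ sf).1 LL (off _ sf) (M := M * (2 * L) ^+ n) _) _.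
  by move=> t; apply: (bnd _ _ (slice_csupp t sf)) => y; exact: fM.
by apply: eq_ler; rewrite exprSr; ring.
Qed.

Lemma integral_rV_lin n L (f g : 'rV[R]_n -> R) (a : R) : 0 <= L -> csupp L f -> csupp L g ->
  integral_rV (fun x => f x + a * g x) = integral_rV f + a * integral_rV g.
Proof. by move=> L0; have [lin _] := integral_factsP n L0; exact: lin. Qed.

Lemma integral_rV_affine n L (f : 'rV[R]_n -> R) (a : R) (b : 'rV[R]_n) :
  0 <= L -> 0 < a -> csupp L f ->
  integral_rV (fun y => f (a *: y + b)) = a ^- n * integral_rV f.
Proof.
move=> L0 a0; elim: n f b => [|n IH] f b sf.
  by rewrite /= expr0 invr1 mul1r; congr f; apply/matrixP => i [].
have [cF F0] := slice_integral (@integral_factsP n) L0 sf.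
have off t : ~~ (- L <= t <= L) -> integral_rV (slice f t) = 0.
  by rewrite -ler_norml -ltNge => /F0.
rewrite /= exprS invfM -mulrA -[X in _ * X](RintegralZl _ measurableT (csupp_integrable cF off))//.
rewrite -(csupp_integral_affine (b 0 0) _ L0 a0); first last.
- by move=> t /F0 ->; rewrite mulr0.
- move=> t; apply: (@continuousM _ _ (fun=> a ^- n) (fun t => integral_rV (slice f t))).
    exact: cst_continuous.
  exact: cF.
apply: eq_Rintegral => t _.
rewrite -(IH _ (rsubmx (b : 'rV[R]_(1 + n))) (slice_csupp _ sf)); congr integral_rV.
apply/funext => y; rewrite /slice; congr f.
apply/matrixP => i j; rewrite !mxE; case: (@splitP 1 n j) => k kj; rewrite !mxE.
  by rewrite !ord1 !mulr1n; congr (_ + b _ _); apply/val_inj; rewrite /= kj ord1.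
by rewrite !ord1; congr (_ + b _ _); apply/val_inj; rewrite /= kj.
Qed.

Section complex_integrals.
Variable s : nat.
Local Notation "'Rs'" := 'rV[R]_s.
Local Notation DRs := (testfun [set: Rs]).
Local Notation I f := (integral_complex f).

Definition csuppC (L : R) (f : Rs -> C) := continuous f /\ forall x, L < `|x| -> f x = 0.

Lemma csuppC_Re L f : csuppC L f -> csupp L (fun x => complex.Re (f x)).
Proof.
move=> [cf fL]; split=> [x|x /fL -> //].
exact: (continuous_comp (cf x) (@ReC_continuous R (f x))).
Qed.

Lemma csuppC_Im L f : csuppC L f -> csupp L (fun x => complex.Im (f x)).
Proof.
move=> [cf fL]; split=> [x|x /fL -> //].
exact: (continuous_comp (cf x) (@ImC_continuous R (f x))).
Qed.

Lemma integral_complex_lin L (f g : Rs -> C) (a : R) : 0 <= L -> csuppC L f -> csuppC L g ->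
  I (fun x => f x + a *: g x) = I f + a *: I g.
Proof.
move=> L0 sf sg; rewrite /integral_complex.
have -> : (fun x => complex.Re (f x + a *: g x)) =
    (fun x => complex.Re (f x) + a * complex.Re (g x)).
  by apply/funext => x; rewrite [_ + _]addrC ReC_linear addrC.
have -> : (fun x => complex.Im (f x + a *: g x)) =
    (fun x => complex.Im (f x) + a * complex.Im (g x)).
  by apply/funext => x; rewrite [_ + _]addrC ImC_linear addrC.
rewrite (integral_rV_lin _ L0 (csuppC_Re sf) (csuppC_Re sg)).
by rewrite (integral_rV_lin _ L0 (csuppC_Im sf) (csuppC_Im sg)).
Qed.

(** Substitution in one variable at a time; the Jacobian is a power of a because the
    change of variables is a dilation followed by a translation. *)
Lemma integral_complex_affine L (f : Rs -> C) (a : R) b : 0 <= L -> 0 < a -> csuppC L f ->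
  I (fun x => a ^+ s *: f (a *: x + b)) = I f.
Proof.
move=> L0 a0 sf; have as0 : a ^+ s != 0 by rewrite expf_neq0// gt_eqF.
rewrite /integral_complex.
have lin (g : Rs -> R) : csupp L g ->
    integral_rV (fun x => a ^+ s * g (a *: x + b)) = integral_rV g.
  move=> sg; rewrite (integral_rV_affine b L0 a0 (f := fun x => a ^+ s * g x)); last first.
    split=> [x|x /sg.2 ->]; last by rewrite mulr0.
    by apply: (@continuousM _ _ (fun=> a ^+ s) g); [exact: cst_continuous|exact: sg.1].
  have s0 : csupp L (fun _ : Rs => 0 : R) by split=> [x|//]; exact: cst_continuous.
  have := integral_rV_lin (a ^+ s) L0 s0 sg.
  have -> : integral_rV (fun _ : Rs => 0 : R) = 0.
    have := integral_rV_lin (-1) L0 s0 s0; under eq_fun do rewrite mulr0 addr0.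
    by rewrite mulN1r subrr.
  under eq_fun do rewrite add0r.
  by rewrite add0r => ->; rewrite mulKf.
rewrite -(lin _ (csuppC_Re sf)) -(lin _ (csuppC_Im sf)).
have ReZ (z : C) : complex.Re (a ^+ s *: z) = a ^+ s * complex.Re z by case: z.
have ImZ (z : C) : complex.Im (a ^+ s *: z) = a ^+ s * complex.Im z by case: z.
under eq_fun do rewrite ReZ.
by under [X in (_ +i* integral_rV X)%C]eq_fun do rewrite ImZ.
Qed.

Lemma monomial_continuous (al : multi s) : continuous (@monomial R s al).
Proof.
rewrite /monomial; elim: (index_enum _) => [|i r IH] x.
  under eq_fun do rewrite big_nil; exact: cst_continuous.
under eq_fun do rewrite big_cons.
apply: (@continuousM _ _ (fun x : Rs => x 0 i ^+ al i) (fun x : Rs => \prod_(i <- r) x 0 i ^+ al i)).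
  apply: (continuous_comp (f := fun x : Rs => x 0 i) (g := fun t => t ^+ al i)).
    apply: contraction_continuous => {}x y; have := coord_le (x - y) i.
    by rewrite !mxE.
  exact: exprn_continuous.
exact: IH.
Qed.

Lemma testfun_csupp (Om : set Rs) (f : testfun Om) : exists2 L : R, 0 <= L & csuppC L f.
Proof.
have /compact_bounded[M [_ KM]] := testfun_compact (f := f).
exists (`|M| + 1); first by rewrite addr_ge0.
split=> [x|x Mx].
  exact: (diff_bounded_continuous openT (testfun_diff_bounded f)).
apply: tsuppN => fx; move: Mx; rewrite ltNge => /negP; apply; apply: KM fx.
by rewrite ltr_pwDr// ler_norm.
Qed.

Lemma monomial_csuppC al L (f : Rs -> C) : csuppC L f ->
  csuppC L (fun x => monomial al x *: f x).
Proof.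
move=> [cf fL]; split=> [x|x /fL ->]; last by rewrite scaler0.
exact: (cvgZ (@monomial_continuous al x) (cf x)).
Qed.

Lemma csuppCW L L' f : L <= L' -> csuppC L f -> csuppC L' f.
Proof. by move=> LL [cf fL]; split=> // x L'x; apply: fL; exact: le_lt_trans L'x. Qed.

Section moments.
Variable Om : set Rs.
Implicit Types f g : testfun Om.

Lemma moment_lin al f g (a : R) : moment al (f + a *: g : testfun Om) =
  moment al f + a *: moment al g.
Proof.
have [L L0 sf] := testfun_csupp f; have [M M0 sg] := testfun_csupp g.
have LM : L <= Num.max L M by rewrite le_max lexx.
have ML : M <= Num.max L M by rewrite le_max lexx orbT.
rewrite /moment -(integral_complex_lin _ (le_trans L0 LM)
  (monomial_csuppC al (csuppCW LM sf)) (monomial_csuppC al (csuppCW ML sg))).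
congr integral_complex; apply/funext => x.
by rewrite testfunD testfunZ scalerDr !scalerA mulrC.
Qed.

Lemma moment0E f : moment [ffun=> 0%N] f = I f.
Proof.
rewrite /moment; congr integral_complex; apply/funext => x.
by rewrite /monomial big1 ?scale1r// => i _; rewrite ffunE expr0.
Qed.

Lemma mdegree0 (al : multi s) : mdegree al = 0%N -> al = [ffun=> 0%N].
Proof.
move/eqP; rewrite /mdegree sum_nat_eq0 => /forallP al0; apply/ffunP => i.
by rewrite ffunE; apply/eqP/al0.
Qed.

Lemma calAP q f : calA Om q f <->
  forall al, (mdegree al <= q)%N -> moment al f = (mdegree al == 0%N)%:R.
Proof.
split=> [[f1 fq] al alq|H].
  have [/mdegree0 ->|al0] := eqVneq (mdegree al) 0%N; first by rewrite moment0E.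
  by rewrite fq// lt0n al0.
have z : mdegree ([ffun=> 0%N] : multi s) = 0%N.
  by rewrite /mdegree big1// => i _; rewrite ffunE.
split; first by rewrite -moment0E H z.
by move=> al /andP[al0 alq]; rewrite H// gtn_eqF.
Qed.

Lemma calAW q q' f : (q <= q')%N -> calA Om q' f -> calA Om q f.
Proof. by move=> qq /calAP H; apply/calAP => al alq; apply: H; exact: leq_trans qq. Qed.

Lemma calA_add q f g a : calA Om q f -> calA0 Om q g -> calA Om q (f + a *: g).
Proof.
move=> /calAP fq gq; apply/calAP => al alq.
by rewrite moment_lin gq// scaler0 addr0 fq.
Qed.

Lemma calA_sub q f g : calA Om q f -> calA Om q g -> calA0 Om q (f - g).
Proof.
move=> /calAP fq /calAP gq al alq; rewrite -scaleN1r moment_lin fq// gq//.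
by rewrite scaleN1r subrr.
Qed.

Lemma calA0_lin q f g a : calA0 Om q f -> calA0 Om q g -> calA0 Om q (f + a *: g).
Proof. by move=> fq gq al alq; rewrite moment_lin fq// gq// scaler0 addr0. Qed.

Lemma calA00 q : calA0 Om q 0.
Proof.
by move=> al _; have := moment_lin al 0 0 (-1); rewrite scaleN1r subrr scaleN1r subrr.
Qed.

(** Dilation and translation preserve the mass of a mollifier. *)
Lemma calA0_rescaled f (phi : DRs) (e : R) x : 0 < e -> calA setT 0 phi ->
  (forall y, f y = e ^- s *: phi (e^-1 *: (y - x))) -> calA Om 0 f.
Proof.
move=> e0 [phi1 _] fE; split; last by move=> al /andP[/leq_trans H /H].
have [L L0 sphi] := testfun_csupp phi.
rewrite -phi1 -(integral_complex_affine (a := e^-1) (- (e^-1 *: x)) L0 _ sphi) ?invr_gt0//.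
congr integral_complex; apply/funext => y.
by rewrite fE scalerBr exprVn.
Qed.

End moments.
End complex_integrals.
End integrals.


(** * Smoothness of the rescaled functions *)

Section rescaling.
Variables (R : realType) (s : nat) (Om : set 'rV[R]_s).
Local Notation C := (Rcomplex R).
Local Notation "'Rs'" := 'rV[R]_s.
Local Notation DRs := (testfun [set: Rs]).

Lemma hausdorff_pair (E F : topologicalType) :
  hausdorff_space E -> hausdorff_space F -> hausdorff_space (E * F)%type.
Proof.
move=> hE hF [a b] [a' b'] pq; congr pair.
  apply: hE => A B aA bB; have [||[x y] [/= [Ax _] [Bx _]]] := pq (A `*` setT) (B `*` setT).
  - by exists (A, setT) => //; split=> //; exact: filterT.
  - by exists (B, setT) => //; split=> //; exact: filterT.
  by exists x.
apply: hF => A B aA bB; have [||[x y] [/= [_ Ay] [_ By]]] := pq (setT `*` A) (setT `*` B).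
- by exists (setT, A) => //; split=> //; exact: filterT.
- by exists (setT, B) => //; split=> //; exact: filterT.
by exists y.
Qed.

Lemma compact_margin K : open Om -> compact_in K Om -> exists2 r : R, 0 < r &
  exists2 K', compact_in K' Om & forall x y, K x -> `|y - x| <= r -> K' y.
Proof.
move=> oOm [cK KO].
have /compact_near_coveringP ncK := cK.
pose P (r : R) x := forall z, `|z - x| <= r -> Om z.
have : \forall r \near (0 : R)^'+, K `<=` P r.
  apply: (ncK R ((0 : R)^'+) P) => x Kx.
  have [d d0 dO] := nbhs_closed_ball (open_nbhs_nbhs (conj oOm (KO _ Kx))).
  have d2 : 0 < d / 2 by rewrite divr_gt0.
  near=> y r; have rd : r <= d / 2 by near: r; exact: nbhs_right_le.
  move=> z /= zy; apply: dO; rewrite -(subrKA y); apply: le_trans (ler_normD _ _) _.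
  rewrite [leRHS]splitr lerD//.
    exact: le_trans zy rd.
move=> nr; near (0 : R)^'+ => r.
have r0 : 0 < r by [].
have rP : K `<=` P r by near: r.
exists r => //; exists ((fun z : Rs * Rs => z.1 + z.2) @` (K `*` [set y | `|y - 0| <= r])).
  split; last first.
    move=> _ [[x y] [/= Kx yr] <-]; apply: (rP x) => //.
    by rewrite addrC addKr -[y]subr0.
  apply: continuous_compact; last exact: compact_setX (@closed_ball_compact R s 0 r).
  by apply: continuous_subspaceT => z; exact: add_continuous.
move=> x y Kx yx; exists (x, y - x) => /=; last by rewrite addrC subrK.
by split => //=; rewrite subr0.
Unshelve. all: by end_near. Qed.

(** The image of (S_e p, x) under T is the test function y |-> e^-s p(e^-1 (y - x)) of
    Om. Along smooth curves p and x it depends smoothly on (t, y), hence it is a smooth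
    curve in D(Om), to which the smoothness of u o T^-1 applies. *)
Lemma rescaled_curve (u : DRs * Rs -> C) (e : R) (p : R -> DRs) (x : R -> Rs) x0 (r rad : R) :
  calE Om u -> 0 < e -> smooth_curve p -> smooth_curve x ->
  (forall t, calA setT 0 (p t)) -> (forall t y, rad < `|y| -> p t y = 0) ->
  (forall t, `|x t - x0| <= r) -> 0 <= rad -> (forall y, `|y - x0| <= r + e * rad -> Om y) ->
  smooth_curve (fun t => rescale u e (p t, x t)).
Proof.
move=> uE e0 sp sx p1 prad xr rad0 bO.
pose F (z : R * Rs) : C := e ^- s *: p z.1 (e^-1 *: (z.2 - x z.1)).
have hRs : hausdorff_space Rs by exact: norm_hausdorff.
have nx n : nder n x by move: n; apply/smooth_curveP.
have bF : diff_bounded setT F.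
  apply: boman; first exact: openT.
  move=> c sc _; apply/smooth_curveP; first exact: hausdorffC.
  move=> n; have nc : nder n c by move: n; apply/smooth_curveP => //; exact: norm_hausdorff.
  apply: nderZ.
  apply: (frame_curve (tx_frame R s) (smooth_curve_joint sp)
    (xi := fun t => ((c t).1, e^-1 *: ((c t).2 - x (c t).1)))).
  apply: nder_pair; first exact: nder_fst nc.
  apply: nderZ; apply: nderB; first exact: nder_snd nc.
  by apply: nder_comp => //; exact: nder_fst nc.
pose K := [set y | `|y - x0| <= r + e * rad].
have cK : compact K by exact: closed_ball_compact.
have F0 t y : ~ K y -> F (t, y) = 0.
  move=> /negP; rewrite -ltNge => Ky; rewrite /F /= prad ?scaler0//.
  rewrite normrZ gtr0_norm ?invr_gt0// ltr_pdivlMl//.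
  rewrite -(ltrD2l r); apply: lt_le_trans Ky _; rewrite -(subrKA (x t)).
  by apply: le_trans (ler_normD _ _) _; rewrite addrC lerD2r.
have /choice[g gE] t : exists f : testfun Om, forall y, f y = F (t, y).
  have tP : (fun y => F (t, y)) \in test_fun Om.
    by apply: (test_funP (slice_diff_bounded t bF) cK bO) => y; exact: F0.
  by exists (TestFun tP).
have sg : smooth_curve g.
  apply: joint_curve.
    by have -> : (fun z : R * Rs => g z.1 z.2) = F by apply/funext => -[t y]; exact: gE.
  by move=> t; exists K => //; exists 1 => // v y _ Ky; rewrite gE F0.
have -> : (fun t => rescale u e (p t, x t)) = (u \o @Tinv R s Om) \o (fun t => (g t, x t)).
  apply/funext => t; rewrite /= /Tinv /rescale /=; congr (u (_, _)).
  apply: testfun_inj => y; rewrite dilateE ?gt_eqF// translateE gE /F /=.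
  by rewrite addrK.
apply: uE => [|t]; last first.
  split=> /=; last first.
    by apply: bO; apply: le_trans (xr t) _; rewrite lerDl mulr_ge0// ltW.
  by apply: (calA0_rescaled (x := x t) e0 (p1 t)) => y; rewrite gE.
apply/smooth_curveP; first by apply: hausdorff_pair => //; exact: testfun_hausdorff.
move=> n; apply: nder_pair => //.
by move: n; apply/smooth_curveP => //; exact: testfun_hausdorff.
Qed.

Lemma rescaled_diff_bounded (V : normedModType R) (U : set V) (u : DRs * Rs -> C) (e : R)
    (P : V -> DRs) (X : V -> Rs) x0 (r rad : R) : open U ->
  calE Om u -> 0 < e ->
  (forall c, smooth_curve c -> (forall t, U (c t)) -> smooth_curve (fun t => P (c t))) ->
  (forall c, smooth_curve c -> (forall t, U (c t)) -> smooth_curve (fun t => X (c t))) ->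
  (forall v, U v -> calA setT 0 (P v)) -> (forall v y, U v -> rad < `|y| -> P v y = 0) ->
  (forall v, U v -> `|X v - x0| <= r) -> 0 <= rad ->
  (forall y, `|y - x0| <= r + e * rad -> Om y) ->
  diff_bounded U (fun v => rescale u e (P v, X v)).
Proof.
move=> oU uE e0 sP sX P1 Prad Xr rad0 bO; apply: boman => // c sc cU.
apply: (rescaled_curve (x0 := x0) (r := r) (rad := rad)) => //.
- exact: sP.
- exact: sX.
- by move=> t; exact: P1.
- by move=> t y; exact: Prad.
- by move=> t; exact: Xr.
Qed.

End rescaling.

(** * Bounded families of test functions; estimates of order zero *)

Section test_families.
Variables (R : realType) (s : nat) (Om : set 'rV[R]_s).
Local Notation C := (Rcomplex R).
Local Notation "'Rs'" := 'rV[R]_s.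
Local Notation DRs := (testfun [set: Rs]).
Hypothesis oOm : open Om.
Implicit Types (u : DRs * Rs -> C) (phi : R * Rs -> DRs) (K : set Rs).

Lemma near_unitI : \forall e \near (0 : R)^'+, unitI e.
Proof.
by near=> e; apply/andP; split=> //; near: e; exact: nbhs_right_le.
Unshelve. all: by end_near. Qed.

Lemma word0 : word ([ffun=> 0%N] : multi s) = [::].
Proof.
by apply: size0nil; rewrite size_word /mdegree big1// => i _; rewrite ffunE.
Qed.

Lemma pderiv0 (E : tvsType R) (f : Rs -> E) : pderiv [ffun=> 0%N] f = f.
Proof. by rewrite /pderiv -/(word _) word0. Qed.

Lemma Cb_inftyW q q' phi : (q <= q')%N -> Cb_infty Om q' phi -> Cb_infty Om q phi.
Proof. by move=> qq [H1 H2 H3]; split=> // p /H1; exact: calAW. Qed.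

Lemma Cb_infty_bounded q phi K : Cb_infty Om q phi -> compact_in K Om ->
  tvs_bounded [set phi p | p in @unitI R `*` K].
Proof.
move=> [_ _ H3] /(H3 _ [ffun=> 0%N]); congr tvs_bounded.
by apply: eq_imagel => -[e x] _; rewrite pderiv0.
Qed.

(** For small e the functions S_e phi(e, y) have their support, translated by y, in Om
    for all y in a neighbourhood of K. *)
Lemma Cb_infty_diff_bounded u phi K : calE Om u -> Cb_infty Om 0 phi -> compact_in K Om ->
  \forall e \near (0 : R)^'+, exists2 U : set Rs, open U /\ K `<=` U &
    diff_bounded U (fun y => rescale u e (phi (e, y), y)).
Proof.
move=> uE Cphi KO; have [r r0 [K' KO' KK']] := compact_margin oOm KO.
have [rad rad0 radP] := bounded_supp (Cb_infty_bounded Cphi KO').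
have [Cphi1 Cphi2 _] := Cphi.
have b0 : 0 < r / 2 / rad by rewrite !divr_gt0.
near=> e; have e0 : 0 < e by [].
have e1 : unitI e by near: e; exact: near_unitI.
have er : e * rad <= r / 2.
  by rewrite -ler_pdivlMr//; near: e; exact: nbhs_right_le.
have K'U x y : K x -> ball x (r / 2) y -> K' y.
  move=> Kx; rewrite -ball_normE /= => xy; apply: KK' Kx _.
  by rewrite distrC; apply: ltW; apply: lt_le_trans xy _; lra.
exists (\bigcup_(x in K) ball x (r / 2)).
  split; last by move=> x Kx; exists x => //; apply: ballxx; rewrite divr_gt0.
  by apply: bigcup_open => x _; apply: ball_open; rewrite divr_gt0.
move=> y [x Kx xy].
have := @rescaled_diff_bounded R s Om Rs (ball x (r / 2)) u e (fun y => phi (e, y)) id x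
  (r / 2) rad; apply => //.
- by apply: ball_open; rewrite divr_gt0.
- move=> c sc cU; apply: (Cphi2 (fun t => (e, c t))) => [|t].
    apply/smooth_curveP; first exact: norm_hausdorff.
    move=> n; apply: nder_pair; first exact: nder_cst.
    by move: n; apply/smooth_curveP => //; exact: norm_hausdorff.
  by split=> //=; apply: KO'.2; exact: K'U (cU t).
- by move=> v xv; apply: Cphi1; split=> //=; apply: KO'.2; exact: K'U xv.
- move=> v z xv zr; apply: radP zr; exists (e, v) => //; split=> //=.
  exact: K'U xv.
- by move=> v; rewrite -ball_normE /= distrC => /ltW.
- exact: ltW.
- move=> z zx; apply: KO'.2; apply: KK' Kx _; apply: le_trans zx _.
  by rewrite [leRHS]splitr lerD2l.
Unshelve. all: by end_near. Qed.

Lemma partials_pderiv (U : set Rs) l (f : Rs -> C) x : open U -> diff_bounded U f -> U x ->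
  partials l f x = pderiv (multi_of l) f x.
Proof.
move=> oU bf Ux; rewrite pderiv_dlist partials_dlist; apply/esym.
by apply: (dlist_perm oU (perm_map _ (perm_word l)) bf Ux).
Qed.

(** Condition (0) of the theorem. *)
Definition zeroth_order u := forall K n, compact_in K Om -> (0 < n)%N ->
  exists2 q, (0 < q)%N & forall B : set DRs, tvs_bounded B ->
    unif_bigO ((B `&` calA _ q) `*` K) (fun e p => rescale u e p) (fun e => e ^+ n).

(** By induction on the order of the derivative. If l-derivatives are at most
    e^(2n + N) and derivatives with two more factors i are at most e^-N, Landau's
    inequality on a segment of length e^(n + N) bounds the derivatives with one more
    factor by a multiple of e^n. *)
Lemma zeroth_order_partials u l : moderate_gf Om u -> zeroth_order u ->
  forall K n, compact_in K Om -> (0 < n)%N ->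
    exists2 q, (0 < q)%N & forall phi, Cb_infty Om q phi ->
      unif_bigO K (fun e x => partials l (fun y => rescale u e (phi (e, y), y)) x)
        (fun e => e ^+ n).
Proof.
move=> [uE umod] u0; elim: l => [|i l IH] K n KO n0.
  have [q q0 H] := u0 K n KO n0; exists q => // phi Cphi.
  have [M HM] := H _ (Cb_infty_bounded Cphi KO); exists M.
  near=> e; have e1 : unitI e by near: e; exact: near_unitI.
  move=> x Kx /=.
  have HMe : forall t, (([set phi p | p in @unitI R `*` K] `&` calA setT q) `*` K) t ->
    `|rescale u e t| <= M * e ^+ n by near: e.
  apply: (HMe (phi (e, x), x)); split=> //=; split; first by exists (e, x).
  by have [+ _ _] := Cphi; apply; split=> //=; exact: KO.2.
have [r r0 [K' KO' KK']] := compact_margin oOm KO.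
have [N N0 modN] := umod K' (multi_of [:: i, i & l]) KO'.
have [|q q0 Hq] := IH K' (2 * n + N)%N KO'; first by rewrite addn_gt0 N0 orbT.
exists q => // phi Cphi; have Cphi0 := Cb_inftyW (leq0n q) Cphi.
have [A HA] := Hq _ Cphi; have [B HB] := modN _ Cphi0.
have HU := Cb_infty_diff_bounded uE Cphi0 KO'.
exists (2 * A + 4 * B).
pose F e y := rescale u e (phi (e, y), y).
near=> e.
have e0 : 0 < e by [].
have e1 : e <= 1 by near: e; exact: nbhs_right_le.
have er : e <= r by near: e; exact: nbhs_right_le.
have HAe : forall x, K' x -> `|partials l (F e) x| <= A * e ^+ (2 * n + N) by near: e.
have HBe : forall x, K' x -> `|pderiv (multi_of [:: i, i & l]) (F e) x| <= B * e ^- N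
  by near: e.
have [U [oU K'U] bf] : exists2 U : set Rs, open U /\ K' `<=` U &
  diff_bounded U (F e) by near: e.
move=> x Kx; rewrite -/(F e); set f := F e in bf HAe HBe *.
have h0 : 0 < e ^+ (n + N) by rewrite exprn_gt0.
have hr : e ^+ (n + N) <= r.
  apply: le_trans er; rewrite -[leRHS]expr1 ler_wiXn2l ?(ltW e0)//.
  by rewrite addn_gt0 n0.
have bl : diff_bounded U (partials l f) by rewrite partials_dlist; exact: dlist_bounded.
have path t : 0 <= t <= e ^+ (n + N) -> K' (t *: delta_mx 0 i + x).
  move=> /andP[t0 th]; apply: KK' Kx _; rewrite addrK normrZ ger0_norm//.
  apply: le_trans (ler_wpM2l t0 (delta_le1 _ i)) _; rewrite mulr1.
  exact: le_trans th hr.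
have := @landau R Rs U oU (partials l f) (delta_mx 0 i) x (A * e ^+ (2 * n + N))
  (B * e ^- N) (e ^+ (n + N)) bl h0.
move/(_ (fun t tP => K'U _ (path t tP)) (fun t tP => HAe _ (path t tP))).
have HB2 t : 0 <= t <= e ^+ (n + N) -> `|dlist [:: delta_mx 0 i; delta_mx 0 i]
    (partials l f) (t *: delta_mx 0 i + x)| <= B * e ^- N.
  move=> /path K't; have := HBe _ K't.
  by rewrite -(partials_pderiv _ oU bf (K'U _ K't)).
move/(_ HB2)/le_trans; apply; apply: eq_ler.
have en0 : e ^+ N != 0 by rewrite expf_neq0// gt_eqF.
have en1 : e ^+ n != 0 by rewrite expf_neq0// gt_eqF.
by rewrite mul2n -addnn !exprD; field; rewrite en0 en1.
Unshelve. all: by end_near. Qed.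

Lemma zeroth_order_negligible u : moderate_gf Om u -> zeroth_order u -> negligible_gf Om u.
Proof.
move=> um u0; split; first by case: um.
by move=> K al n; exact: (zeroth_order_partials (word al) um u0).
Qed.

End test_families.

(** * Interpolating a sequence of test functions *)

Section interpolation.
Variables (R : realType) (s : nat).
Local Notation C := (Rcomplex R).
Local Notation "'Rs'" := 'rV[R]_s.
Local Notation DRs := (testfun [set: Rs]).

(** The forms that occur are a coordinate and, in dimension 0, the zero form. *)
Definition contracting_form (ell : Rs -> R) :=
  (forall (a : R) x y, ell (a *: x + y) = a * ell x + ell y) /\ forall x, `|ell x| <= `|x|.

Section contracting_form_theory.
Variable ell : Rs -> R.
Hypothesis ellP : contracting_form ell.

Lemma form0 : ell 0 = 0.
Proof. by have := ellP.1 (-1) 0 0; rewrite scaler0 addr0 mulN1r addNr. Qed.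

Lemma formB x y : ell (x - y) = ell x - ell y.
Proof. by rewrite addrC -scaleN1r ellP.1 mulN1r addrC. Qed.

Lemma hasd_form x v : hasd ell x v (ell v).
Proof.
apply: (@cvg_near_cst _ _ _ _ _ _); near=> h.
have h0 : h != 0 by near: h; exact: nbhs_dnbhs_neq.
by rewrite ellP.1 addrK scalerA mulVf// scale1r.
Unshelve. all: by end_near. Qed.

Lemma nder_form n (x : R -> Rs) : nder n x -> nder n (fun t => ell (x t)).
Proof.
apply: nder_lin; first by move=> a u v; exact: ellP.1.
by apply: lin_contraction ellP.2 => a u v; exact: ellP.1.
Qed.

(** Functions of y that are affine along ell have constant first derivatives. *)
Lemma partials_form (A B : DRs) l : l != [::] -> exists2 c : R, `|c| <= 1 &
  partials l (fun y => A + ell y *: B) = fun=> c *: B.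
Proof.
have hD : hausdorff_space DRs by exact: testfun_hausdorff.
elim: l => // i l IH _; have [->|/IH[c c1 E]] := eqVneq l [::].
  exists (ell (delta_mx 0 i)); first by apply: le_trans (ellP.2 _) (delta_le1 _ i).
  apply/funext => x; apply: tderive_hasd => //=; rewrite -[_ *: B]add0r.
  by apply: hasdD; [exact: hasd_cst|apply: hasd_scaled_vector; exact: hasd_form].
exists 0; first by rewrite normr0.
by apply/funext => x /=; rewrite scale0r E; apply: tderive_hasd => //; exact: hasd_cst.
Qed.

Lemma pderiv_form_le (A B : DRs) al x p : seminorm p ->
  p (pderiv al (fun y => A + ell y *: B) x) <= p A + (1 + `|x|) * p B.
Proof.
move=> sp; have pA := seminorm_ge0 A sp; have pB := seminorm_ge0 B sp.
rewrite /pderiv -/(word al); have [->|l0] := eqVneq (word al) [::].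
  apply: le_trans (sp.1 _ _) _; rewrite lerD2l sp.2 ler_wpM2r//.
  by apply: le_trans (ellP.2 x) _; rewrite lerDr.
have [c c1 E] := partials_form A B l0.
rewrite E sp.2; apply: (@le_trans _ _ ((1 + `|x|) * p B)); last by rewrite lerDr.
by rewrite ler_wpM2r//; apply: le_trans c1 _; rewrite lerDl.
Qed.

End contracting_form_theory.

Lemma calA0_sum q (I : Type) (r : seq I) (F : I -> DRs) :
  (forall i, calA0 setT q (F i)) -> calA0 setT q (\sum_(i <- r) F i).
Proof.
move=> F0; elim/big_ind: _ => //; first exact: calA00.
by move=> f g f0 g0; rewrite -[g]scale1r; exact: calA0_lin.
Qed.

Section family.
Variables (Om : set Rs) (q : nat) (f g : nat -> DRs) (eps : nat -> R) (xs : nat -> Rs)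
  (rx : R) (ell : Rs -> R).
Hypotheses (ellP : contracting_form ell)
  (fq : forall j, calA setT q (f j)) (gq : forall j, calA0 setT q (g j))
  (bf : tvs_bounded (range f)) (bg : tvs_bounded (range g))
  (xr : forall j, `|xs j| <= rx)
  (eps0 : forall j, 0 < eps j) (eps2 : forall j, eps j <= 2 ^- j)
  (epsS : forall j, 2 * eps j.+1 <= eps j).

Let tau j := (eps j)^-1.
Let w y j : DRs := (f j - f 0%N) + ell (y - xs j) *: g j.

(** Since the supports of the bumps at the eps j are disjoint, the value at eps j is
    f j + ell (y - xs j) g j, while at every e the function is affine in y. *)
Definition interpolant (p : R * Rs) : DRs := f 0%N + bseries (@bump R) tau (w p.2) p.1.

Let tau2 j : 2 ^+ j <= tau j.
Proof. by rewrite -[leLHS]invrK lef_pV2// posrE// invr_gt0 exprn_gt0. Qed.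

Let tauS j : 2 * tau j <= tau j.+1.
Proof. by rewrite -ler_pdivlMl// -invfM lef_pV2 ?posrE// ?mulr_gt0// mulrC. Qed.

Let w0 y j : calA0 setT q (w y j).
Proof. by apply: calA0_lin => //; exact: calA_sub. Qed.

Lemma interpolantE j y : interpolant (eps j, y) = f j + ell (y - xs j) *: g j.
Proof.
have b1 : tau j * eps j = 1 by rewrite mulVf// gt_eqF.
rewrite /interpolant /= (bseries_block tau2 _ tauS (@bump_supp_bump R) (n := j)); last first.
  by rewrite b1; apply/andP; split; lra.
rewrite b1 bump1; last by rewrite subrr normr0; lra.
by rewrite scale1r /w addrA [f 0%N + _]addrC subrK.
Qed.

Lemma interpolant_block e : 0 < e -> exists j (b : R), 0 <= b <= 1 /\
  forall y, interpolant (e, y) = f 0%N + b *: w y j.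
Proof.
move=> e0; have [[j jP]|H] := pselect (exists j, 3 / 4 <= tau j * e <= 5 / 4).
  exists j, (bump (tau j * e)); split; first by rewrite bump_ge0 bump_le1.
  by move=> y; rewrite /interpolant (bseries_block tau2 _ tauS (@bump_supp_bump R) jP).
exists 0%N, 0; split; first by rewrite lexx ler01.
move=> y; rewrite /interpolant /bseries big1 ?scale0r// => j _.
by rewrite bump_supp_bump ?scale0r//; apply/negP => jP; apply: H; exists j.
Qed.

(** The sum is locally finite on the region e > 0. *)
Lemma interpolant_smooth : smooth_map (@unitI R `*` Om) interpolant.
Proof.
have hD : hausdorff_space DRs by exact: testfun_hausdorff.
move=> c sc cU; apply/smooth_curveP => // n; apply: nder_local => // t0.
have nc m : nder m c by move: m; apply/smooth_curveP => //; exact: norm_hausdorff.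
have n1 m : nder m (fun t => (c t).1) by exact: nder_fst (nc m).
have n2 m : nder m (fun t => (c t).2) by exact: nder_snd (nc m).
have e0 t : 0 < (c t).1 by have [/andP[]] := cU t.
pose N := Num.bound (2 / ((c t0).1 / 2)).
have h0 : 0 < (c t0).1 / 2 by rewrite divr_gt0.
have Nt : 2 <= 2 ^+ N * ((c t0).1 / 2) by rewrite -ler_pdivrMr// ltW//; exact: upper_nthrootP.
exists (fun t => f 0%N + \sum_(j < N) (bump (tau j * (c t).1) *: (f j - f 0%N) +
    (bump (tau j * (c t).1) * ell ((c t).2 - xs j)) *: g j)).
  apply: nderD; first exact: nder_cst.
  have nb j m : nder m (fun t => bump (tau j * (c t).1)).
    by apply: nder_comp; [exact: nder_bump|exact: nderZ].
  elim: (index_enum _) => [|j r IH].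
    by under eq_fun do rewrite big_nil; exact: nder_cst.
  under eq_fun do rewrite big_cons; apply: nderD => //; apply: nderD.
    exact: nder_scaled_vector.
  apply: nder_scaled_vector; apply: (nderM (E := R)) => //.
  by apply: (nder_form ellP); apply: nderB => //; exact: nder_cst.
have [c1' cc1' _] := n1 1%N.
have := hasd_continuous (cc1' t0).
move=> /cvgrPdist_lt/(_ _ h0); apply: filterS => t ct.
have tt : (c t0).1 / 2 <= (c t).1.
  by move: ct; rewrite ltr_norml => /andP[_]; lra.
rewrite /= /interpolant (bseriesE tau2 _ (@bump_supp_bump R) (N := N))//; last first.
  by apply: le_trans Nt _; rewrite ler_wpM2l// exprn_ge0.
by congr (_ + _); apply: eq_bigr => j _; rewrite /w scalerDr scalerA.
Qed.

(** At each e at most one bump contributes, with a factor in [0, 1], so that the bounds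
    do not depend on e. The moment conditions are affine. *)
Lemma interpolant_Cb : Cb_infty Om q interpolant.
Proof.
split; last first.
- move=> K al [/compact_bounded[M [_ KM]] _]; apply: seminorm_tvs_bounded => p lp.
  have sp := lp.1.
  have [Mf fM] := tvs_bounded_seminorm bf lp; have [Mg gM] := tvs_bounded_seminorm bg lp.
  have Mf0 : 0 <= Mf by apply: le_trans (seminorm_ge0 (f 0%N) sp) (fM _ _); exists 0%N.
  have Mg0 : 0 <= Mg by apply: le_trans (seminorm_ge0 (g 0%N) sp) (gM _ _); exists 0%N.
  have rx0 : 0 <= rx by apply: le_trans (xr 0%N).
  exists (3 * Mf + rx * Mg + (1 + (`|M| + 1)) * Mg).
  move=> _ [[e x] [/= /andP[e0 _] Kx] <-].
  have xM : `|x| <= `|M| + 1 by apply: KM => //; rewrite ltr_pwDr// ler_norm.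
  have [j [b [/andP[b0 b1] E]]] := interpolant_block e0.
  have fj : p (f j) <= Mf by apply: fM; exists j.
  have f0 : p (f 0%N) <= Mf by apply: fM; exists 0%N.
  have gj : p (g j) <= Mg by apply: gM; exists j.
  have bp v : p (b *: v) <= p v.
    rewrite sp.2 ger0_norm// -[leRHS]mul1r ler_wpM2r//; exact: seminorm_ge0.
  have -> : (fun y => interpolant (e, y)) =
      (fun y => (f 0%N + b *: (f j - f 0%N - ell (xs j) *: g j)) + ell y *: (b *: g j)).
    apply/funext => y; rewrite E /w (formB ellP) scalerBl scalerA [ell y * b]mulrC -scalerA.
    rewrite -[RHS]addrA -scalerDr.
    by congr (_ + b *: _); rewrite -[RHS]addrA; congr (_ + _); exact: addrC.
  apply: le_trans (pderiv_form_le ellP _ _ _ _ sp) _; apply: lerD.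
    apply: le_trans (sp.1 _ _) _.
    have d1 : p (f j - f 0%N) <= p (f j) + p (f 0%N).
      by apply: le_trans (sp.1 _ _) _; rewrite seminormN.
    have d2 : p (f j - f 0%N - ell (xs j) *: g j) <= p (f j) + p (f 0%N) + rx * Mg.
      apply: le_trans (sp.1 _ _) _; rewrite seminormN// sp.2; apply: lerD => //.
      apply: ler_pM => //; first exact: seminorm_ge0.
      by apply: le_trans (ellP.2 _) (xr j).
    have := bp (f j - f 0%N - ell (xs j) *: g j); lra.
  apply: ler_pM => //; [exact: seminorm_ge0|by rewrite lerD2l|].
  exact: le_trans (bp _) gj.
- exact: interpolant_smooth.
- move=> [e y] _; rewrite /interpolant /bseries -[X in _ + X]scale1r; apply: calA_add => //.
  apply: calA0_sum => j; rewrite -[_ *: _]add0r; apply: calA0_lin; first exact: calA00.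
  exact: w0.
Qed.

End family.
End interpolation.

(** * Differentials in the first variable *)

Section differentials.
Variables (R : realType) (s : nat).
Local Notation C := (Rcomplex R).
Local Notation "'Rs'" := 'rV[R]_s.
Local Notation DRs := (testfun [set: Rs]).
Local Notation delta i := (delta_mx 0 i : Rs).

Lemma reach_bound k (a0 w1 : 'rV[R]_k) (e0 w2 : Rs) (r : seq 'I_k) :
  reach (V := ('rV[R]_k * Rs)%type) (a0, e0) [seq (delta_mx 0 i, 0) | i <- r] (w1, w2) ->
  w2 = e0 /\ `|w1| <= `|a0| + (size r)%:R.
Proof.
elim: r a0 => [|i r IH] a0 /=; first by case=> -> ->; rewrite addr0.
move=> [b /andP[b0 b1]]; have -> : (a0, e0) + b *: (delta_mx 0 i, 0) =
  ((a0 + b *: delta_mx 0 i, e0) : 'rV[R]_k * Rs).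
  by congr pair; rewrite /= scaler0 addr0.
move=> /IH[-> w1r]; split=> //; apply: le_trans w1r _.
rewrite -natr1 [_ + 1]addrC addrA lerD2r; apply: le_trans (ler_normD _ _) _.
rewrite lerD2l normrZ ger0_norm//; apply: le_trans b1.
by rewrite -[leRHS]mulr1 ler_wpM2l// delta_le1.
Qed.

(** In positive dimension the first coordinate is used: the m factors of the
    alpha-derivative in its direction e0 join the k directions of the differential,
    and the other factors annihilate the form ell. In dimension 0 only k = 0 occurs. *)
Lemma direction_data k (al : multi s) : (0 < s)%N || (k == 0%N) ->
  exists (ell : Rs -> R) (e0 : Rs) (L rest : seq 'I_s) (m : nat),
    [/\ contracting_form ell, (0 < m + k)%N -> ell e0 = 1,
      forall i, i \in rest -> ell (delta i) = 0,
      [seq delta i | i <- L] = nseq (m + k) e0 &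
      perm_eq [seq delta i | i <- word al] (nseq m e0 ++ [seq delta i | i <- rest])].
Proof.
have [s0 _|s0 /eqP ->] := ltnP 0 s; last first.
  exists (fun=> 0), 0, [::], (word al), 0%N; split=> //.
  by split=> [a x y|x]; rewrite ?mulr0 ?addr0 ?normr0.
pose i0 := Ordinal s0; pose m := size [seq i <- word al | pred1 i0 i].
exists (fun x => x 0 i0), (delta i0), (nseq (m + k) i0),
  [seq i <- word al | predC (pred1 i0) i], m; split.
- by split=> [a x y|x]; [rewrite !mxE|exact: coord_le].
- by rewrite mxE !eqxx.
- move=> i; rewrite mem_filter /= => /andP[ii _].
  by rewrite mxE eqxx /= eq_sym (negbTE ii).
- by rewrite map_nseq.
have -> : nseq m (delta i0) = [seq delta i | i <- [seq i <- word al | pred1 i0 i]].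
  have /all_pred1P -> : all (pred1 i0) [seq i <- word al | pred1 i0 i] by exact: filter_all.
  by rewrite map_nseq.
by rewrite -map_cat; apply: perm_map; rewrite perm_sym perm_filterC.
Qed.

(** Mixed derivatives in (a, x) are controlled by derivatives in x alone of the functions
    obtained by letting the first argument depend on x along a line. *)
Lemma mixed_derivative_reduction k (al : multi s) : (0 < s)%N || (k == 0%N) ->
  exists (be : multi s) (ell : Rs -> R) (c : R), [/\ contracting_form ell, 0 < c &
    forall (U : set ('rV[R]_k * Rs)) (G : 'rV[R]_k * Rs -> C) x M,
      open U -> diff_bounded U G -> U (0, x) ->
      (forall a, `|a| <= k%:R -> `|pderiv be (fun y => G (ell (y - x) *: a, y)) x| <= M) ->
      `|dlist [seq (0, delta i) | i <- word al]
         (dlist [seq (delta_mx 0 i, 0) | i <- enum 'I_k] G) (0, x)| <= c * M].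
Proof.
move=> sk; have [ell [e0 [L [rest [m [ellP elle0 ellr Le perm_al]]]]]] := direction_data al sk.
have [c c0 cP] := mixed_derivative_bound R k m.
exists (multi_of (L ++ rest)), ell, (c + 1); split=> //; first by rewrite ltr_wpDl.
move=> U G x M oU bG Ux GM.
have M0 : 0 <= M by apply: le_trans (GM 0 _); rewrite ?normr0.
set ts := [seq _ | i <- enum 'I_k].
pose rs : seq ('rV[R]_k * Rs) := [seq (0, delta i) | i <- rest].
have perm1 : perm_eq ([seq (0, delta i) | i <- word al] ++ ts) ((nseq m (0, e0) ++ ts) ++ rs).
  rewrite (permPr (permEl (perm_catAC _ _ _))) perm_cat2r.
  have := perm_map (fun v => (0, v) : 'rV[R]_k * Rs) perm_al.
  by rewrite map_cat map_nseq -!map_comp.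
rewrite -dlist_cat (dlist_perm oU perm1 bG Ux) dlist_cat.
apply: (@le_trans _ _ (c * M)); last by rewrite ler_wpM2r// lerDl.
apply: (cP _ U) => //; first exact: dlist_bounded.
  by rewrite size_map size_enum_ord.
move=> [a w2] /reach_bound[-> ak]; rewrite normr0 add0r size_enum_ord in ak.
rewrite -dlist_cat; apply: le_trans (GM a ak); apply: eq_ler; congr `|_|.
pose J v : 'rV[R]_k * Rs := (ell v *: a, v).
rewrite pderiv_dlist (dlist_affine (j := fun y => (ell (y - x) *: a, y)) (J := J)); last first.
  move=> h v y; rewrite /J; congr pair.
  by rewrite /= -addrA ellP.1 scalerDl scalerA.
rewrite subrr (form0 ellP) scale0r.
rewrite (dlist_perm oU (perm_map _ (perm_map _ (perm_word (L ++ rest)))) bG Ux).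
rewrite map_cat Le map_cat map_nseq -map_comp; congr (dlist (_ ++ _) _ _).
  have [mk|] := posnP (m + k); first by rewrite mk.
  by move=> /elle0 e1; rewrite /J e1 scale1r.
by apply/eq_in_map => i ir; rewrite /= /J ellr// scale0r.
Qed.

(** The differential at phi in the directions psi_i consists of partial derivatives of a
    function of finitely many real parameters. *)
Lemma pderiv_diff1 k (u : DRs * Rs -> C) (e : R) (phi : DRs) (psi : k.-tuple DRs) al x :
  pderiv al (fun y => diff1 (rescale u e) (phi, y) psi) x =
  dlist [seq (0, delta i) | i <- word al]
    (dlist [seq (delta_mx 0 i, 0) | i <- enum 'I_k]
      (fun z : 'rV[R]_k * Rs => rescale u e (phi + \sum_i z.1 0 i *: tnth psi i, z.2))) (0, x).
Proof.
set G := (fun z : 'rV[R]_k * Rs => _).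
have E y : diff1 (rescale u e) (phi, y) psi =
    dlist [seq (delta_mx 0 i, 0) | i <- enum 'I_k] G (0, y).
  pose A (t : 'rV[R]_k) := phi + \sum_i t 0 i *: tnth psi i.
  have -> : [seq (delta_mx 0 i, 0) | i <- enum 'I_k] =
      [seq (v, 0) | v <- [seq delta_mx 0 i | i <- enum 'I_k]] :> seq ('rV[R]_k * Rs).
    by rewrite -map_comp.
  rewrite -(dlist_affine (j := fun t => (t, y))); last first.
    by move=> h v t; congr pair; rewrite /= scaler0 add0r.
  have -> : dlist [seq delta_mx 0 i | i <- enum 'I_k] (fun t => G (t, y)) 0 =
      dlist [seq \sum_i v 0 i *: tnth psi i | v : 'rV[R]_k <- [seq delta_mx 0 i | i <- enum 'I_k]]
        (fun p => rescale u e (p, y)) (A 0).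
    apply: (dlist_affine (j := A)) => h v t; rewrite /A addrCA scaler_sumr -big_split; congr (_ + _).
    by apply: eq_bigr => i _; rewrite !mxE scalerDl scalerA.
  have -> : A 0 = phi by rewrite /A big1 ?addr0// => i _; rewrite mxE scale0r.
  rewrite /diff1 /=; congr (foldr _ _ _ _).
  rewrite -map_comp; transitivity [seq tnth psi i | i <- enum 'I_k].
    by rewrite map_tnth_enum.
  apply: eq_map => i /=.
  rewrite (bigD1 i)//= mxE !eqxx scale1r big1 ?addr0// => j ji.
  by rewrite mxE (negbTE ji) scale0r.
have -> : (fun y => diff1 (rescale u e) (phi, y) psi) =
    (fun y => dlist [seq (delta_mx 0 i, 0) | i <- enum 'I_k] G (0, y)) by exact/funext.
rewrite pderiv_dlist.
rewrite (dlist_affine (j := fun y => (0, y)) (J := fun v => (0, v))) -?map_comp// => h v y.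
by congr pair; rewrite /= scaler0 add0r.
Qed.

End differentials.

(** * Negligible functions satisfy all differential estimates *)

Section negligible_differentials.
Variables (R : realType).
Local Notation C := (Rcomplex R).

(** On a space with one point the integral is the value at this point, so that the
    second condition is void there for k > 0. *)
Lemma calA0_dim0 s (psi : testfun [set: 'rV[R]_s]) q : s = 0%N -> calA0 setT q psi -> psi = 0.
Proof.
move=> s0; subst s => pq; apply: testfun_inj => x.
have := pq [ffun=> 0%N]; rewrite moment0E /integral_complex /=.
have -> : x = 0 by apply/matrixP => i [].
move=> E; transitivity (0 : C) => //.
by rewrite -[RHS]E; [case: (psi 0)|rewrite /mdegree big_ord0].
Qed.

Lemma tderive_dir0 (V : lmodType R) (f : V -> C) x : tderive f x 0 = 0.
Proof.
apply: tderive_hasd; first exact: hausdorffC.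
rewrite /hasd; under eq_fun do rewrite scaler0 add0r subrr scaler0.
exact: cvg_cst.
Qed.

Lemma at_right_ball (P : R -> Prop) : (\forall e \near 0^'+, P e) ->
  exists2 d : R, 0 < d & forall e, 0 < e -> e <= d -> P e.
Proof.
rewrite /at_right near_withinE => /nbhs_closed_ball[d d0 dP]; exists d => // e e0 ed.
by apply: dP => //; rewrite subr0 gtr0_norm.
Qed.

(** If the estimate failed, for each j there would be a counterexample with constant j at
    some e_j. The e_j may be chosen to decrease rapidly. The counterexamples then fit into
    a single test object, the interpolant, for which the derivatives provided by
    [mixed_derivative_reduction] would violate negligibility. *)
Lemma negligible_differential s (Om : set 'rV[R]_s)
    (u : testfun [set: 'rV[R]_s] * 'rV[R]_s -> C) K (al : multi s) k n :
  open Om -> negligible_gf Om u -> compact_in K Om -> (0 < n)%N ->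
  exists2 q, (0 < q)%N & forall B : set (testfun [set: 'rV[R]_s]), tvs_bounded B ->
    unif_bigO (((B `&` calA _ q) `*` K) `*`
        [set psi : k.-tuple _ | forall i, (B `&` calA0 _ q) (tnth psi i)])
      (fun e t => pderiv al (fun y => diff1 (rescale u e) (t.1.1, y) t.2) t.1.2)
      (fun e => e ^+ n).
Proof.
move=> oOm [uE uN] KO n0; have [sk|] := boolP ((0 < s)%N || (k == 0%N)); last first.
  rewrite negb_or -eqn0Ngt => /andP[/eqP s0 k0]; exists 1%N => // B _; exists 0.
  apply: nearW => e [[phi x] psi] [_ /= psiq].
  have -> : pderiv al (fun y => diff1 (rescale u e) (phi, y) psi) x =
      diff1 (rescale u e) (phi, x) psi.
    rewrite /pderiv -/(word al) (_ : word al = [::])//.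
    apply: size0nil; rewrite size_word /mdegree big1// => i _.
    by have := ltn_ord i; rewrite [X in (_ < X)%N]s0.
  have psi0 i : tnth psi i = 0 by have [_] := psiq i; exact: calA0_dim0.
  rewrite mul0r normr_le0; apply/eqP; move: psi psi0 {psiq} => [[|v l] /= lk] psi0.
    by exfalso; move: k0; rewrite -(eqP lk).
  have v0 : v = 0 by have := psi0 (cast_ord (eqP lk) ord0); rewrite (tnth_nth 0).
  by rewrite /diff1 /= v0 tderive_dir0.
have [be [ell [c [ellP c0 red]]]] := mixed_derivative_reduction R al sk.
have [q q0 Hq] := uN K be n KO n0; exists q => // B bB; apply: contrapT => H.
have [r r0 [K' KO' KK']] := compact_margin oOm KO.
have [rad rad0 radP] := bounded_supp bB.
pose D e (t : testfun [set: 'rV[R]_s] * 'rV[R]_s * k.-tuple (testfun [set: 'rV[R]_s])) :=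
  pderiv al (fun y => diff1 (rescale u e) (t.1.1, y) t.2) t.1.2.
pose T := ((B `&` calA setT q) `*` K) `*`
  [set psi : k.-tuple _ | forall i, (B `&` calA0 setT q) (tnth psi i)].
(* a violation of the estimate with constant j, at a parameter of at most d *)
have large (jd : nat * R) : exists et, 0 < jd.2 ->
    [/\ 0 < et.1, et.1 <= jd.2, T et.2 & jd.1%:R * et.1 ^+ n < `|D et.1 et.2|].
  apply: contrapT => Hno; apply: H; exists jd.1%:R.
  have d0 : 0 < jd.2 by apply: contrapT => nd; apply: Hno; exists (0, (0, 0, [tuple of nseq k 0])).
  near=> e => t Tt; rewrite leNgt; apply/negP => Dt; apply: Hno; exists (e, t) => _.
  by split=> //=; near: e; exact: nbhs_right_le.
have [sel selP] := choice large.
(* up to d0 the supports of the rescaled functions stay inside the margin of K *)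
pose d0 := Num.min 1 (r / 2 / rad).
have d00 : 0 < d0 by rewrite lt_min ltr01 !divr_gt0.
pose es := fix es (j : nat) := if j is j'.+1 then sel (j, (es j').1 / 2) else sel (0%N, d0).
have esP j : [/\ 0 < (es j).1, (es j).1 <= d0 * 2 ^- j, T (es j).2 &
    j%:R * (es j).1 ^+ n < `|D (es j).1 (es j).2|].
  elim: j => [|j [e0 ed _ _]] /=.
    by have [] := selP (0%N, d0) d00; rewrite expr0 invr1 mulr1.
  have h0 : 0 < (es j).1 / 2 by rewrite divr_gt0.
  have [e1 e2 Te De] := selP (j.+1, (es j).1 / 2) h0; split=> //.
  by apply: le_trans e2 _; rewrite exprS invfM mulrCA mulrC ler_wpM2l// invr_ge0.
pose eps j := (es j).1; pose phi j := (es j).2.1.1; pose x j := (es j).2.1.2.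
pose psi j := (es j).2.2.
have e0 j : 0 < eps j by case: (esP j).
have pow j : 0 < 2 ^- j :> R by rewrite invr_gt0 exprn_gt0.
have ed j : eps j <= d0.
  have [_ + _ _] := esP j; move/le_trans; apply; rewrite ler_piMr// ?(ltW d00)//.
  by rewrite invf_le1 ?exprn_gt0// exprn_ege1// ler1n.
have e2 j : eps j <= 2 ^- j.
  have [_ + _ _] := esP j; move/le_trans; apply; rewrite ler_piMl ?(ltW (pow j))//.
  by rewrite /d0 ge_min lexx.
have eS j : 2 * eps j.+1 <= eps j.
  have h0 : 0 < (es j).1 / 2 by rewrite divr_gt0// e0.
  by have [_ + _ _] := selP (j.+1, (es j).1 / 2) h0; rewrite ler_pdivlMr// mulrC.
have phiB j : B (phi j) by case: (esP j) => _ _ [[[]]].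
have phiq j : calA setT q (phi j) by case: (esP j) => _ _ [[[]]].
have xK j : K (x j) by case: (esP j) => _ _ [[]].
have psiB j i : B (tnth (psi j) i) by case: (esP j) => _ _ [_ /(_ i)[]].
have psiq j i : calA0 setT q (tnth (psi j) i) by case: (esP j) => _ _ [_ /(_ i)[]].
pose A j (t : 'rV[R]_k) := phi j + \sum_i t 0 i *: tnth (psi j) i.
pose G j (z : 'rV[R]_k * 'rV[R]_s) := rescale u (eps j) (A j z.1, z.2).
pose U j : set ('rV[R]_k * 'rV[R]_s) := [set z | ball (x j) (r / 2) z.2].
have oU j : open (U j).
  apply: (@open_comp _ _ (fun z : 'rV[R]_k * 'rV[R]_s => z.2)).
    by move=> z _; exact: cvg_snd.
  by apply: ball_open; rewrite divr_gt0.
have bG j : diff_bounded (U j) (G j).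
  apply: (@rescaled_diff_bounded R s Om _ (U j) u (eps j) (fun z => A j z.1) snd (x j)
    (r / 2) rad) => //.
  - move=> d sd _; apply/smooth_curveP; first exact: testfun_hausdorff.
    move=> m; have nd : nder m d.
      by move: m; apply/smooth_curveP => //; exact: norm_hausdorff.
    apply: nderD; first exact: nder_cst.
    elim: (index_enum _) => [|i l IH].
      by under eq_fun do rewrite big_nil; exact: nder_cst.
    under eq_fun do rewrite big_cons; apply: nderD => //; apply: nder_scaled_vector.
    exact: nder_coord (nder_fst nd).
  - move=> d sd _; apply/smooth_curveP; first exact: norm_hausdorff.
    move=> m; apply: nder_snd.
    by move: m; apply/smooth_curveP => //; exact: norm_hausdorff.
  - move=> z _; rewrite /A -[X in _ + X]scale1r; apply: calA_add.
      exact: calAW (leq0n q) (phiq j).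
    apply: calA0_sum => i; rewrite -[_ *: _]add0r; apply: calA0_lin; first exact: calA00.
    by move=> ga; rewrite leqn0 => /eqP ga0; apply: psiq; rewrite ga0.
  - move=> z y _ yr; rewrite /A testfunD (radP _ (phiB j) _ yr) add0r.
    elim/big_ind: _ => // [f g f0 g0|i _]; first by rewrite testfunD f0 g0 addr0.
    by rewrite testfunZ (radP _ (psiB j i) _ yr) scaler0.
  - by move=> z; rewrite /U /= -ball_normE /= distrC => /ltW.
  - exact: ltW.
  - move=> y yr; apply: KO'.2; apply: KK' (xK j) _; apply: le_trans yr _.
    rewrite [leRHS]splitr lerD2l -ler_pdivlMr//; apply: le_trans (ed j) _.
    by rewrite /d0 ge_min lexx orbT.
have Ux j : U j (0, x j) by apply: ballxx; rewrite divr_gt0.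
(* coefficients of the direction in which the violation becomes a pure one *)
have /choice[a aP] j : exists a : 'rV[R]_k, `|a| <= k%:R /\
    j%:R * eps j ^+ n < c * `|pderiv be (fun y => G j (ell (y - x j) *: a, y)) (x j)|.
  apply: contrapT => Hno; have [_ _ _] := esP j; apply/negP; rewrite -leNgt.
  rewrite /D pderiv_diff1.
  have := red (U j) (G j) (x j) (c^-1 * (j%:R * eps j ^+ n)) (oU j) (bG j) (Ux j).
  rewrite mulVKf ?gt_eqF//; apply => b bk; rewrite ler_pdivlMl// leNgt; apply/negP => lt.
  by apply: Hno; exists b.
pose g j := \sum_i (a j) 0 i *: tnth (psi j) i.
have gq j : calA0 setT q (g j).
  by apply: calA0_sum => i; rewrite -[_ *: _]add0r; apply: calA0_lin; first exact: calA00.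
have bphi : tvs_bounded (range phi).
  apply: seminorm_tvs_bounded => p lp; have [M pM] := tvs_bounded_seminorm bB lp.
  by exists M => _ [j _ <-]; exact: pM.
have bg : tvs_bounded (range g).
  apply: seminorm_tvs_bounded => p lp; have [M pM] := tvs_bounded_seminorm bB lp.
  have sp := lp.1; exists (\sum_(i < k) k%:R * M) => _ [j _ <-].
  rewrite /g; elim/big_ind2 : _ => [|f1 M1 f2 M2 H1 H2|i _].
  - by rewrite (seminorm0 sp).
  - by apply: le_trans (sp.1 _ _) _; exact: lerD.
  rewrite sp.2; apply: ler_pM => //; [exact: seminorm_ge0| |exact: pM].
  by apply: le_trans (coord_le _ i) _; case: (aP j).
have /compact_bounded[rx [_ rxP]] := KO.1.
have xr j : `|x j| <= `|rx| + 1 by apply: rxP (xK j); rewrite ltr_pwDr// ler_norm.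
have CPhi := interpolant_Cb Om ellP phiq gq bphi bg xr e0 e2 eS.
have [M /at_right_ball[d d1 HM]] := Hq _ CPhi.
pose j := maxn (Num.bound d^-1) (Num.bound `|c * M|).
have jd : eps j <= d.
  apply: le_trans (e2 j) _; rewrite -[leRHS]invrK lef_pV2 ?posrE ?invr_gt0// ?exprn_gt0//.
  by apply/ltW/upper_nthrootP; rewrite leq_maxl.
have [_] := aP j; apply/negP; rewrite -leNgt.
have := HM _ (e0 j) jd _ (xK j).
have -> : (fun y => rescale u (eps j) (interpolant phi g eps x ell (eps j, y), y)) =
    (fun y => G j (ell (y - x j) *: a j, y)).
  have E y : interpolant phi g eps x ell (eps j, y) = A j (ell (y - x j) *: a j).
    rewrite interpolantE// /A /g scaler_sumr; congr (_ + _); apply: eq_bigr => i _.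
    by rewrite mxE scalerA.
  by apply/funext => y; rewrite E.
move=> le; apply: (@le_trans _ _ (c * (M * eps j ^+ n))); first by rewrite ler_wpM2l// ltW.
rewrite mulrA ler_wpM2r ?exprn_ge0 ?(ltW (e0 j))//.
apply: le_trans (ler_norm _) _; apply: ltW; apply: lt_le_trans (archi_boundP _) _ => //.
by rewrite ler_nat leq_maxr.
Unshelve. all: by end_near. Qed.

End negligible_differentials.

Theorem theorem13p1 (R : realType) (s : nat) (Om : set 'rV[R]_s)
    (u : testfun [set: 'rV[R]_s] * 'rV[R]_s -> Rcomplex R) :
  open Om -> moderate_gf Om u ->
  [/\ negligible_gf Om u <->
        (forall K n, compact_in K Om -> (0 < n)%N ->
          exists2 q, (0 < q)%N &
          forall B : set (testfun [set: 'rV[R]_s]), tvs_bounded B ->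
            unif_bigO ((B `&` calA _ q) `*` K)
              (fun e p => rescale u e p)
              (fun e => e ^+ n)),
      negligible_gf Om u <->
        (forall K (al : multi s) n, compact_in K Om -> (0 < n)%N ->
          exists2 q, (0 < q)%N &
          forall B : set (testfun [set: 'rV[R]_s]), tvs_bounded B ->
            unif_bigO ((B `&` calA _ q) `*` K)
              (fun e p => pderiv al (fun y => rescale u e (p.1, y)) p.2)
              (fun e => e ^+ n)) &
      negligible_gf Om u <->
        (forall K (al : multi s) k n, compact_in K Om -> (0 < n)%N ->
          exists2 q, (0 < q)%N &
          forall B : set (testfun [set: 'rV[R]_s]), tvs_bounded B ->
            unif_bigO (((B `&` calA _ q) `*` K) `*`
                [set psi : k.-tuple _ |
                  forall i, (B `&` calA0 _ q) (tnth psi i)])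
              (fun e t =>
                pderiv al (fun y => diff1 (rescale u e) (t.1.1, y) t.2) t.1.2)
              (fun e => e ^+ n))].
Proof.
move=> oOm um.
set c2 := (X in [/\ _, _ & _ <-> X]).
set c1 := (X in [/\ _, _ <-> X & _]).
set c0 := (X in [/\ _ <-> X, _ & _]).
have to_c2 : negligible_gf Om u -> c2.
  by move=> un K al k n KO n0; exact: (negligible_differential al k oOm un KO n0).
have c2_c1 : c2 -> c1.
  move=> H K al n KO n0; have [q q0 Hq] := H K al 0%N n KO n0; exists q => // B bB.
  have [M HM] := Hq B bB; exists M; apply: filterS HM => e He p pT.
  by apply: (He (p, [tuple])); split=> //= -[].
have c1_c0 : c1 -> c0.
  move=> H K n KO n0; have [q q0 Hq] := H K [ffun=> 0%N] n KO n0; exists q => // B bB.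
  have [M HM] := Hq B bB; exists M; apply: filterS HM => e He [f x] /He.
  by rewrite pderiv0.
have c0_neg : c0 -> negligible_gf Om u by exact: zeroth_order_negligible.
by split; split; auto.
Qed.
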